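(* Let $X$ be a Hunt process on a locally compact metric space $(\mathcal X,d)$ with infinitesimal generator $\mathcal L$ and with a Lévy system of the form $(J(x,dy),t)$, and let $\phi$ be as in the context. Suppose that $(\mathbf{Jc})_{\bar r}$, $(\mathbf{Jt})_{\phi,\bar r}$ and $(\mathbf{EP})_{\phi,r_0,\le}$ hold for some $\bar r,r_0\in(0,\infty]$. Then the uniform boundary Harnack principle holds for $\mathcal L$ (equivalently, for $X$) with radius $R:=\min\{\bar r/2,r_0\}$ on any proper open set, in the following sense. For every $\kappa\in(0,2)$ there is a constant $C\in(1,\infty)$, depending only on $\kappa$ and the parameters in $(\mathbf{Jc})_{\bar r}$, $(\mathbf{Jt})_{\phi,\bar r}$, $(\mathbf{EP})_{\phi,r_0,\le}$ and in the growth bound $\phi(R)/\phi(r)\le c(R/r)^\beta$ ($0<r\le R<\infty$), such that for any proper open set $D\subset\mathcal X$, any $r\in(0,R)$, any $\xi\in\partial D$ and any two non-negative functions $h_1,h_2$ that are regular harmonic with respect to $X$ in $D\cap B(\xi,2r)$ and vanish on $B(\xi,2r)\setminus D$, we have $$h_1(x)h_2(y)\le C\,h_1(y)h_2(x)\qquad\text{for all }x,y\in D\cap B(\xi,\kappa r).$$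
   Context: Setting. $(\mathcal X,d)$ is a locally compact metric space, $B(x,r)=\{y\in\mathcal X:d(x,y)<r\}$, and complements $A^c$ are taken in $\mathcal X$. $X=(X_t,\zeta,\mathcal G_t,\mathbb P_x)$ is a Hunt process on $\mathcal X$ with lifetime $\zeta\in(0,\infty]$, minimal admissible augmented filtration $\{\mathcal G_t\}$, and $X_t=\partial$ for $t\ge\zeta$, where $\partial$ is the cemetery point (functions on $\mathcal X$ are taken to be $0$ at $\partial$). For Borel $D\subset\mathcal X$, $\tau_D=\inf\{t\ge0:X_t\notin D\}$. Lévy system. It is assumed that there is a kernel $J(x,dy)$ (for each $x$ a $\sigma$-finite measure on $\mathcal X\setminus\{x\}$) such that $(J(x,dy),t)$ is a Lévy system of $X$: for every nonnegative $f$ on $[0,\infty)\times\mathcal X\times\mathcal X$ vanishing on the diagonal of $\mathcal X\times \mathcal X$, every $\{\mathcal G_t\}$-stopping time $T$ and every $x\in\mathcal X$, $$\mathbb E_x\sum_{s\le T}f(s,X_{s-},X_s)=\mathbb E_x\int_0^T\int_{\mathcal X}f(s,X_s,y)\,J(X_s,dy)\,ds.$$ The function $\phi:[0,\infty)\to[0,\infty)$ is strictly increasing with $\phi(0)=0$, $\phi(1)=1$, and doubling: $\phi(2r)\le C\phi(r)$ for all $r>0$ and some $C\in(1,\infty)$; equivalently there are $c\ge1,\beta>0$ with $\phi(R)/\phi(r)\le c(R/r)^\beta$ for all $0<r\le R<\infty$. Conditions (for $\bar r,r_0\in(0,\infty]$): $(\mathbf{Jc})_{\bar r}$: there are constants $C_1\in(0,\infty)$,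 $C_2\in(0,1)$, $C_3\in(1,\infty)$, $\theta\in(0,\infty)$ such that for all $x,y\in\mathcal X$: (Jc.1) if $d(x,y)<\bar r$ then $J(x,dz)\le C_1\left(1+\frac{d(y,z)}{d(x,z)}\right)^\theta J(y,dz)$ as measures on $\mathcal X$; and (Jc.2) for all $r,s\in(0,\bar r)$, if $d(x,y)>s+C_3r$ then $J(x,B(y,s))\le C_2\,J(x,B(x,r)^c)$. $(\mathbf{Jt})_{\phi,\bar r}$: there are constants $0<C_4\le C_5$ such that $\frac{C_4}{\phi(r)}\le J(x,B(x,r)^c)\le\frac{C_5}{\phi(r)}$ for every $x\in\mathcal X$ and $0<r<\bar r$. $(\mathbf{EP})_{\phi,r_0,\le}$: there is $C>0$ such that $\mathbb P_x(\tau_{B(x,r)}<t)\le C\,t/\phi(r)$ for every $t>0$, $x\in\mathcal X$, $r\in(0,r_0)$. Regular harmonic: a function $h$ on $\mathcal X$ is regular harmonic with respect to $X$ in an open set $U\subset\mathcal X$ if $\mathbb E_x[|h(X_{\tau_U})|;\tau_U<\infty]<\infty$ and $h(x)=\mathbb E_x[h(X_{\tau_U});\tau_U<\infty]$ for every $x\in U$. *)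

(* Defs.v *)
From HB Require Import structures.
From mathcomp Require Export all_boot all_order all_algebra.
From mathcomp Require Export all_classical all_reals all_analysis measurable_realfun.

Set Implicit Arguments.
Unset Strict Implicit.
Unset Printing Implicit Defensive.

Import Order.TTheory GRing.Theory Num.Theory.
Import numFieldNormedType.Exports.

Local Open Scope classical_set_scope.
Local Open Scope ring_scope.

(* Measurable types are pointed in the library, so a metric space carrying a
   Borel sigma-algebra has to be pointed as well. *)
#[short(type="pmetricType")]
HB.structure Definition PointedMetric (K : numDomainType) :=
  {M of Pointed M & Metric K M}.

Definition borel (T : ptopologicalType) := g_sigma_algebraType (@open T).

(* The state space with its cemetery point, which is [None].  If [E] is compact
   the topology of the library makes [None] isolated. *)
Notation cemetery E := (one_point_compactification E).

Section process.
Context {R : realType} {E : pmetricType R} {d : measure_display}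
  {Omega : measurableType d}.
Variable X : R -> Omega -> cemetery E.

(* Values of [X] at negative times are irrelevant: every definition below looks
   at [X t] for [0 <= t] only.  The convention at infinite time is that the
   process is at the cemetery. *)
Definition at_time (t : \bar R) (w : Omega) : cemetery E :=
  if t is t'%:E then X t' w else None.

Definition left_limit (t : R) (w : Omega) : cemetery E :=
  lim (X s w @[s --> t^'-]).

Definition lifetime (w : Omega) : \bar R :=
  ereal_inf [set t%:E | t in [set t : R | 0 <= t /\ X t w = None]].

(* The cemetery is outside every [D], so [exit_time D w <= lifetime w]. *)
Definition exit_time (D : set E) (w : Omega) : \bar R :=
  ereal_inf [set t%:E | t in [set t : R | 0 <= t /\ ~ (Some @` D) (X t w)]].

Definition natural (I : set R) : set (set Omega) :=
  <<s \bigcup_(s in I)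
        preimage_set_system setT (X s) (@measurable _ (borel (cemetery E))) >>.

Variable P : cemetery E -> probability Omega R.

Definition null_sets (mu : probability (borel (cemetery E)) R) :
    set (set Omega) :=
  [set N | exists A, [/\ natural `[0, +oo[ A, N `<=` A
                       & (\int[mu]_x P x A)%E = 0%E]].

(* [augmented `[0, t]] is the minimal augmented admissible filtration at time
   [t], and [augmented `[0, +oo[] is its terminal sigma-algebra. *)
Definition augmented (I : set R) : set (set Omega) :=
  \bigcap_(mu in [set: probability (borel (cemetery E)) R])
    <<s natural I `|` null_sets mu >>.

Definition stopping_time (T : Omega -> \bar R) : Prop :=
  (forall w, (0 <= T w)%E) /\
  (forall t : R, 0 <= t -> augmented `[0, t] [set w | (T w <= t%:E)%E]).

Definition stopped_sigma_algebra (T : Omega -> \bar R) : set (set Omega) :=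
  [set A | augmented `[0, +oo[ A /\
     forall t : R, 0 <= t ->
       augmented `[0, t] (A `&` [set w | (T w <= t%:E)%E])].

(* Stating the properties under every [P x] is the same as stating them under
   every initial distribution: integrate over the starting point. *)
Record hunt_process : Prop := {
  hunt_augmented : augmented `[0, +oo[ `<=` measurable ;
  hunt_measurable : forall t : R, 0 <= t ->
    forall B : set (borel (cemetery E)), measurable B ->
    measurable_fun [set: borel (cemetery E)] (fun x => P x (X t @^-1` B)) ;
  hunt_normal : forall x : cemetery E, P x [set w | X 0 w = x] = 1%E ;
  hunt_lifetime : forall (w : Omega) (t : R), 0 <= t ->
    (lifetime w <= t%:E)%E -> X t w = None ;
  hunt_shift : exists shift : R -> Omega -> Omega,
    forall s t : R, 0 <= s -> 0 <= t ->
    forall w, X s (shift t w) = X (s + t) w ;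
  hunt_right_continuous : forall (w : Omega) (t : R), 0 <= t ->
    X s w @[s --> t^'+] --> X t w ;
  hunt_left_limits : forall (w : Omega) (t : R), 0 < t ->
    cvg (X s w @[s --> t^'-]) ;
  hunt_filtration_right_continuous : forall t : R, 0 <= t ->
    \bigcap_(s in `]t, +oo[) augmented `[0, s] `<=` augmented `[0, t] ;
  (* P_x(X_{T+t} \in B | G_T) = P_{X_T}(X_t \in B) P_x-a.s. on {T < oo}, with
     the conditional probability given by its defining integral identity *)
  hunt_strong_markov : forall T : Omega -> \bar R, stopping_time T ->
    forall t : R, 0 <= t ->
    forall B : set (borel (cemetery E)), measurable B ->
    forall A, stopped_sigma_algebra T A ->
    forall x : cemetery E,
    P x (A `&` [set w | (T w < +oo)%E]
           `&` [set w | B (at_time (T w + t%:E)%E w)]) =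
    (\int[P x]_(w in A `&` [set w | (T w < +oo)%E])
        P (at_time (T w) w) (X t @^-1` B))%E ;
  hunt_quasi_left_continuous : forall T_ : nat -> Omega -> \bar R,
    (forall n, stopping_time (T_ n)) ->
    (forall n w, (T_ n w <= T_ n.+1 w)%E) ->
    forall T : Omega -> \bar R,
    (forall w, T w = ereal_sup (range (T_ ^~ w))) ->
    forall x : cemetery E,
    {ae P x, forall w, (T w < +oo)%E ->
       at_time (T_ n w) w @[n --> \oo] --> at_time (T w) w} }.

(* Functions on [E] are extended by [0] at the cemetery, and a function on
   [0, +oo[ by [0] to negative times. *)
Definition levy_system (J : R.-ker (borel E) ~> (borel E)) : Prop :=
  forall f : R * borel E * borel E -> R,
  measurable_fun [set: R * borel E * borel E] f ->
  (forall z, 0 <= f z) ->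
  (forall (s : R) (x : E), f (s, x, x) = 0) ->
  forall T : Omega -> \bar R, stopping_time T ->
  forall x : E,
  (\int[P (Some x)]_w
     (\esum_(s in [set s : R | (0 < s)%R /\ s%:E <= T w])
        (if left_limit s w is Some y then
           if X s w is Some z then (f (s, y, z))%:E else 0
         else 0)))%E =
  (\int[P (Some x)]_w
     (\int[lebesgue_measure]_(s in [set s : R | (0 <= s)%R /\ s%:E <= T w])
        (if X s w is Some y then \int[J y]_z (f (s, y, z))%:E else 0)))%E.

Definition EP (phi : R -> R) (r0 : \bar R) (C : R) : Prop :=
  forall (t : R) (x : E) (r : R), 0 < t -> 0 < r -> (r%:E < r0)%E ->
  (P (Some x) [set w | exit_time (ball x r) w < t%:E]
     <= (C * t / phi r)%:E)%E.

Definition regular_harmonic (h : E -> R) (U : set E) : Prop :=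
  measurable_fun [set: borel E] (h : borel E -> R) /\
  forall x : E, U x ->
  let hX w := if at_time (exit_time U w) w is Some y then h y else 0 in
  let exits := [set w | (exit_time U w < +oo)%E] in
  ((\int[P (Some x)]_(w in exits) `|hX w|%:E) < +oo)%E /\
  (h x)%:E = (\int[P (Some x)]_(w in exits) (hX w)%:E)%E.

End process.

Section kernel_conditions.
Context {R : realType} {E : pmetricType R}.
Implicit Types (J : R.-ker (borel E) ~> (borel E)) (rbar : \bar R).

(* A sigma-finite measure on E \ {x} is seen as one on [E] not charging [x]. *)
Definition jump_kernel J : Prop :=
  forall x : E, J x [set x] = 0%E /\ sigma_finite setT (J x).

(* In the first item the integrand at [z = x] is irrelevant, since [J x] does
   not charge [x]. *)
Definition Jc J rbar (C1 C2 C3 theta : R) : Prop :=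
  forall x y : E,
  ((mdist x y)%:E < rbar ->
    forall A : set (borel E), measurable A ->
    J x A <=
      \int[J y]_(z in A)
        (C1 * (1 + mdist y z / mdist x z) `^ theta)%:E)%E /\
  (forall r s : R, 0 < r -> (r%:E < rbar)%E -> 0 < s -> (s%:E < rbar)%E ->
    s + C3 * r < mdist x y ->
    (J x (ball y s) <= C2%:E * J x (~` ball x r))%E).

Definition Jt J (phi : R -> R) rbar (C4 C5 : R) : Prop :=
  forall (x : E) (r : R), 0 < r -> (r%:E < rbar)%E ->
  ((C4 / phi r)%:E <= J x (~` ball x r) <= (C5 / phi r)%:E)%E.

End kernel_conditions.

Record scale_function {R : realType} (phi : R -> R) : Prop := {
  scale_increasing : forall r s : R, 0 <= r -> r < s -> phi r < phi s ;
  scale0 : phi 0 = 0 ;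
  scale1 : phi 1 = 1 ;
  scale_doubling : exists2 C : R, 1 < C &
    forall r, 0 < r -> phi (2 * r) <= C * phi r }.

Definition growth_bound {R : realType} (phi : R -> R) (c beta : R) : Prop :=
  forall r s : R, 0 < r -> r <= s -> phi s / phi r <= c * (s / r) `^ beta.

Definition boundary {T : topologicalType} (D : set T) : set T :=
  closure D `\` interior D.

(* Main.v *)
(* Let [u >= 0] be bounded, harmonic in [D] inside [B(xi, 2 r)] and zero on the
   rest of that ball.  With [k_n = kappa + n (2 - kappa) / 5], let [L] be the
   integral of [u] over the complement of [B(xi, k_2 r)] against [J(xi, dz)] and
   [v(x)] the mean exit time from [W = D `&` B(xi, k_1 r)].  Near [xi] the function
   [u] is comparable to [L v], a number depending on [u] times a function that
   does not; in the product inequality for [h1] and [h2] these factors cancel.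

   The Levy system expresses expected jumps out of [W] by mean exit times, and
   (Jc.1) makes the kernels at different points comparable, so the jumps landing
   outside [B(xi, k_2 r)] contribute a multiple of [L v] to [u].  Inside that ball
   [u] is at most [C phi(r) L], and the probability of leaving [W] to it is at most
   [C v / phi(r)], by the strong Markov property at exits from balls of halved
   radii and (EP).  The bound [C phi(r) L] is a contraction: the
   supremum [m] of [u] weighted by a power of the distance to the complement of
   [B(xi, 2 r)] satisfies [m <= C phi(r) L + q m] with [q < 1], because by (Jc.2) a
   path leaving a small ball jumps far away with a definite probability.

   General [h] are limits of the harmonic functions with exit data [min(h, n)]. *)

Require Import Defs.
From mathcomp Require Import ring lra.

Set Implicit Arguments.
Unset Strict Implicit.
Unset Printing Implicit Defensive.

Import Order.TTheory GRing.Theory Num.Theory.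
Import numFieldNormedType.Exports.
Local Open Scope classical_set_scope.
Local Open Scope ring_scope.

(** Two obstacles shape the argument. The exit time of an open set is not visibly measurable for the
    natural sigma-algebra, the one on which the strong Markov property for path functionals is
    proved; the true exit time therefore gives way to a supremum of exit times of closed sets, equal
    to it off a null event. Next, the Lévy sum restricted to jumps out of a set misses an exit whose
    left limit lies on the boundary or at the cemetery, so it bounds exit values from below only.
    The upper bound is reached through compact sets, where no left limit escapes; for closed sets
    the path is restarted at exits from small compact balls, with (EP) forcing the error to 0; for
    open sets Fatou's lemma is used.

    The exponent of the weight is the [theta] of (Jc.1): comparing kernels at a distance of order
    [s] costs a factor of order [r / s] to the power [theta], which the weight must absorb. The
    contraction is usable only because [u] is bounded, so that the supremum is finite; the bound
    itself does not enter the constants, and truncations can pass to the limit. *)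

(** The integral of a nonnegative function is a supremum over simple functions below it, hence
    monotone without any measurability; jump sums and compensators are compared in this way. *)
Lemma ge0_integral_le d (T : measurableType d) (R : realType)
    (mu : {measure set T -> \bar R}) (D : set T) (f g : T -> \bar R) :
  (forall x, D x -> (0 <= f x)%E) -> (forall x, D x -> (f x <= g x)%E) ->
  (\int[mu]_(x in D) f x <= \int[mu]_(x in D) g x)%E.
Proof.
move=> f0 fg.
have g0 x : D x -> (0 <= g x)%E by move=> Dx; exact: le_trans (f0 _ Dx) (fg _ Dx).
rewrite !ge0_integralE//; apply: le_ereal_sup => _ [h hf <-].
exists h => // x; apply: le_trans (hf x) _.
by rewrite /patch; case: ifPn => // /set_mem /fg.
Qed.

(** Presents a sigma-algebra given as a set system as the measurable sets of a type, so that closure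
    properties can be quoted; the proofs below do so through a local type [O]. *)
Lemma sigma_algebra_gE (T : pointedType) (F : set (set T)) :
  sigma_algebra setT F -> @measurable _ (g_sigma_algebraType F) = F.
Proof. exact: sigma_algebra_id. Qed.

Lemma open_borel (T : ptopologicalType) (A : set T) :
  open A -> measurable (A : set (borel T)).
Proof. by move=> oA; exact: sub_sigma_algebra. Qed.

Lemma closed_borel (T : ptopologicalType) (A : set T) :
  closed A -> measurable (A : set (borel T)).
Proof.
move=> cA; rewrite -[A]setCK; apply: measurableC; apply: open_borel.
exact: closed_openC.
Qed.

(** * Balls, and the Borel structure of the state space with its cemetery *)

Section metric.
Context {R : realType} {E : pmetricType R}.
Implicit Types (x y : E) (A V : set E).

Lemma ballE x r y : ball x r y = (mdist x y < r) :> Prop.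
Proof. by rewrite ballEmdist. Qed.

Definition cball x (r : R) : set E := [set y | mdist x y <= r].

Lemma cball_closed x r : closed (cball x r).
Proof.
rewrite -openC openE => y /= /negP; rewrite -ltNge => ry.
rewrite /interior; apply/nbhs_ballP; exists (mdist x y - r); first by rewrite /= subr_gt0.
move=> z; rewrite /= ballE => yz /=; apply/negP; rewrite -ltNge.
have := metric_triangle x z y; rewrite (metric_sym z y); lra.
Qed.

Lemma mball_open x r : open (ball x r).
Proof.
rewrite openE => y; rewrite ballE => xy.
apply/nbhs_ballP; exists (r - mdist x y); first by rewrite /= subr_gt0.
move=> z; rewrite /= !ballE => yz; have := metric_triangle x y z; lra.
Qed.

Lemma open_ballP A : open A <-> forall x, A x -> exists2 e, 0 < e & ball x e `<=` A.
Proof.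
rewrite openE; split => [oA x /oA /nbhs_ballP[e e0 eA]|oA x /oA[e e0 eA]].
  by exists e.
by apply/nbhs_ballP; exists e.
Qed.

(** The points at distance at least [e] from the complement of [V]: closed for every [V], and
    exhausting [V] as [e] tends to 0 when [V] is open. *)
Definition shrink V (e : R) : set E := [set x | ball x e `<=` V].

Lemma shrink_closed V e : closed (shrink V e).
Proof.
rewrite -openC; apply/open_ballP => x /= /existsNP[z /not_implyP[xz nVz]].
move: xz; rewrite ballE => xz.
exists (e - mdist x z); first by rewrite subr_gt0.
move=> y; rewrite ballE => xy /= /(_ z); rewrite ballE => yV; apply: nVz; apply: yV.
have := metric_triangle y x z; rewrite (metric_sym y x); lra.
Qed.

(** An open set containing [None] is its trace on [E] together with the point [None], the complement
    of the image of [E]. Measurability need only be tested on open subsets of [E], without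
    neighbourhoods of infinity. *)
Lemma cemetery_measurable_gen :
  @measurable _ (borel (cemetery E)) =
  <<s [set B : set (cemetery E) | exists2 V : set E, open V & B = Some @` V] >>.
Proof.
set G := (X in <<s X >>).
apply/seteqP; split; apply: smallest_sub.
- exact: smallest_sigma_algebra.
- move=> O oO.
  have oV : open (Some @^-1` O : set E).
    exact: open_comp (fun x _ => @one_point_compactification_some_continuous E x) oO.
  have GV : <<s G >> (Some @` (Some @^-1` O)).
    by apply: sub_sigma_algebra; exists (Some @^-1` O).
  have [ON|nON] := pselect (O None); last first.
    rewrite (_ : O = Some @` (Some @^-1` O))//.
    apply/seteqP; split => [[x|] Ox|_ [x Ox <-]//]; first by exists x.
    by case: nON.
  have GT : <<s G >> (~` (Some @` setT)).
    by apply: sigma_algebraC; apply: sub_sigma_algebra; exists setT => //; exact: openT.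
  rewrite (_ : O = (Some @` (Some @^-1` O)) `|` (~` (Some @` setT))).
    exact: (@measurableU _ (g_sigma_algebraType G)).
  apply/seteqP; split => [[x|] Ox|z [[x Ox <-//]|]].
  + by left; exists x.
  + by right => -[].
  + by case: z => // x /= []; exists x.
- exact: smallest_sigma_algebra.
- move=> _ [V oV ->]; apply: sub_sigma_algebra.
  exact: one_point_compactification_open_some.
Qed.

Lemma measurable_Some :
  measurable_fun [set: borel E] (Some : borel E -> borel (cemetery E)).
Proof.
apply: (@measurability _ _ _ (borel (cemetery E)) setT _ (@open (cemetery E))) => //.
move=> _ [B oB <-]; rewrite setTI; apply: open_borel.
exact: open_comp (fun x _ => @one_point_compactification_some_continuous E x) oB.
Qed.

Lemma measurable_Some_image (B : set E) :
  measurable (B : set (borel E)) -> measurable (Some @` B : set (borel (cemetery E))).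
Proof.
have H0 (V : set E) : open V -> measurable (Some @` V : set (borel (cemetery E))).
  by move=> oV; apply: open_borel; exact: one_point_compactification_open_some.
have -> : @measurable _ (borel E) = <<s @open E >> by [].
move: B; apply: smallest_sub; last by move=> A /H0.
split => [|A /= mA|F /= mF].
- by rewrite /= image_set0; exact: measurable0.
- rewrite setTD (_ : Some @` _ = (Some @` setT) `\` (Some @` A)).
    by apply: measurableD => //; apply: H0; exact: openT.
  apply/seteqP; split => [_ [x nAx <-]|_ [[x _ <-] nA]].
    by split; [exists x|case=> y Ay [xy]; apply: nAx; rewrite -xy].
  by exists x => // Ax; apply: nA; exists x.
- by rewrite /= image_bigcup; exact: bigcupT_measurable.
Qed.

Lemma measurable_None : measurable ([set None] : set (borel (cemetery E))).
Proof.
rewrite (_ : [set None] = ~` (Some @` setT)).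
  by apply: measurableC; apply: measurable_Some_image; exact: measurableT.
apply/seteqP; split => [_ -> [] //|[x|//] nx]; by case: nx; exists x.
Qed.

Definition ext (g : E -> \bar R) (z : cemetery E) : \bar R :=
  if z is Some y then g y else 0%E.

Lemma ext_ge0 g z : (forall y, 0 <= g y)%E -> (0 <= ext g z)%E.
Proof. by case: z => [y|] g0 /=. Qed.

Lemma measurable_ext (g : borel E -> \bar R) : measurable_fun setT g ->
  measurable_fun [set: borel (cemetery E)] (ext g).
Proof.
move=> mg _ B mB; rewrite setTI.
have mgB : measurable (g @^-1` B : set (borel E)) by rewrite -[X in measurable X]setTI; exact: mg.
have [B0|nB0] := pselect (B 0%E).
  rewrite (_ : _ @^-1` _ = (Some @` (g @^-1` B)) `|` [set None]).
    by apply: measurableU; [exact: measurable_Some_image|exact: measurable_None].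
  apply/seteqP; split => [[x|] /= Bx|z [[x Bx <-//]|->//]]; last by right.
  by left; exists x.
rewrite (_ : _ @^-1` _ = (Some @` (g @^-1` B))); first exact: measurable_Some_image.
apply/seteqP; split => [[x|] /= Bx|z [x Bx <-//]] //.
by exists x.
Qed.

End metric.

(** * The augmented filtration and right continuity of the paths *)

Section filtration.
Context {R : realType} {E : pmetricType R} {d : measure_display}
  {Omega : measurableType d} (X : R -> Omega -> cemetery E)
  (P : cemetery E -> probability Omega R).

Lemma augmented_sigma_algebra I : sigma_algebra setT (augmented X P I).
Proof.
split.
- by move=> mu _; exact: sigma_algebra0.
- by move=> A mA mu _; apply: sigma_algebraCD; exact: mA.
- by move=> F mF mu _; apply: sigma_algebra_bigcup => n; exact: mF.
Qed.

Lemma natural_augmented I : natural X I `<=` augmented X P I.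
Proof. by move=> A nA mu _; apply: sub_sigma_algebra; left. Qed.

Lemma natural_mono I J : I `<=` J -> natural X I `<=` natural X J.
Proof.
move=> IJ; apply: sub_sigma_algebra2 => A [s Is XA]; exists s => //.
exact: IJ.
Qed.

Lemma augmented_mono I J : I `<=` J -> augmented X P I `<=` augmented X P J.
Proof.
move=> IJ A nA mu _; have := nA mu Logic.I.
by apply: sub_sigma_algebra2 => B [/(natural_mono IJ)|]; [left|right].
Qed.

Lemma natural_preimage (I : set R) s (B : set (borel (cemetery E))) :
  I s -> measurable B -> natural X I (X s @^-1` B).
Proof.
by move=> Is mB; apply: sub_sigma_algebra; exists s => //; exists B => //; rewrite setTI.
Qed.

Hypothesis hp : hunt_process X P.

Local Notation nat_oo := (natural X `[0, +oo[).
Local Notation aug := (augmented X P).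

Lemma natural_measurable A : nat_oo A -> measurable A.
Proof. by move/natural_augmented; exact: hunt_augmented. Qed.

Lemma measurable_X s : 0 <= s ->
  measurable_fun setT (X s : Omega -> borel (cemetery E)).
Proof.
move=> s0 _ B mB; rewrite setTI; apply: natural_measurable.
by apply: natural_preimage => //=; rewrite in_itv /= s0.
Qed.

(* [N] is a null set of every initial distribution, so its subsets are in [augmented]. *)
Lemma augmented_null I (N A A' : set Omega) : nat_oo N ->
  (forall x, P x N = 0%E) -> aug I A -> A `\` N = A' `\` N -> aug I A'.
Proof.
move=> mN N0 mA AA' mu _.
set G := (X in <<s X >>).
have null B : B `<=` N -> <<s G >> B.
  move=> BN; apply: sub_sigma_algebra; right; exists N; split => //.
  by apply: integral0_eq => x _; rewrite N0.
rewrite (_ : A' = (A `\` (A `&` N)) `|` (A' `&` N)).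
  apply: (@measurableU _ (g_sigma_algebraType G)); last by apply: null => w [].
  apply: (@measurableD _ (g_sigma_algebraType G)); first exact: mA.
  by apply: null => w [].
rewrite setDIr setDv set0U AA'.
by rewrite setUC setUIDK.
Qed.

(** The symmetric difference lies in an event that is null from every starting point, so [A'] is in
    the augmented sigma-algebra, all of whose members are measurable. This carries statements from
    [open_exit] over to [exit_time]. *)
Lemma ae_eq_measurable N A A' : nat_oo N -> (forall x, P x N = 0%E) ->
  nat_oo A -> A `\` N = A' `\` N ->
  measurable A' /\ forall x, P x A' = P x A.
Proof.
move=> mN N0 mA AA'.
have mA' : measurable A'.
  apply: (hunt_augmented hp); apply: (augmented_null mN N0 _ AA').
  exact: natural_augmented.
split=> // x.
have E0 B : measurable B -> P x B = P x (B `\` N).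
  move=> mB; have mN' := natural_measurable mN.
  rewrite (measureDI (P x) mB mN') [X in (_ + X)%E](_ : _ = 0%E) ?adde0//.
  by apply/eqP; rewrite eq_le measure_ge0 andbT -(N0 x) le_measure ?inE//; exact: measurableI.
by rewrite (E0 A') // (E0 A) ?AA' //; exact: natural_measurable.
Qed.

Lemma cemetery_absorbing s t w : 0 <= s -> s <= t -> X s w = None -> X t w = None.
Proof.
move=> s0 st Xs; apply: (hunt_lifetime hp); first exact: le_trans st.
by apply: le_trans (_ : s%:E <= _)%E; [apply: ereal_inf_lbound; exists s|rewrite lee_fin].
Qed.

(** Right continuity in metric form at a time when the path is alive; at the cemetery,
    [cemetery_absorbing] takes its place. *)
Lemma right_nbhs s w (V : set E) x : 0 <= s -> X s w = Some x -> open V -> V x ->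
  exists2 e, 0 < e & forall t, s <= t -> t < s + e -> (Some @` V) (X t w).
Proof.
move=> s0 Xs oV Vx.
have /(_ (Some @` V)) := @hunt_right_continuous _ _ _ _ _ _ hp w s s0.
rewrite Xs => H.
have /H : nbhs (Some x : cemetery E) (Some @` V).
  by apply: one_point_compactification_some_nbhs; exact: open_nbhs_nbhs.
rewrite /= => /nbhs_ballP[e /= e0 He]; exists e => // t st te.
have [<-|nst] := eqVneq s t; first by rewrite Xs; exists x.
apply: He; last by rewrite lt_neqAle nst.
by rewrite /ball /= ltr_distlC; apply/andP; split; lra.
Qed.

End filtration.

(** * Exit times *)

Lemma bigcapT_measurable_rat d (T : measurableType d) (F : rat -> set T) :
  (forall q, measurable (F q)) -> measurable (\bigcap_q F q).
Proof.
move=> mF; rewrite -[X in measurable X]setCK setC_bigcap.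
by apply/measurableC/bigcupT_measurable_rat => q; exact: measurableC.
Qed.

Lemma ereal_rat_between (R : realType) (x : \bar R) (s : R) : (0 <= x)%E -> (x < s%:E)%E ->
  exists q : rat, (x < (ratr q)%:E)%E /\ ratr q < s.
Proof.
case: x => [x| |]//; rewrite !lee_fin lte_fin => x0 xs.
have [q] := rat_in_itvoo xs; rewrite in_itv /= => /andP[xq qs].
by exists q; rewrite lte_fin.
Qed.

(** * Measurability of the position at a random time *)

Section progressive.
Context {R : realType} {E : pmetricType R} {d : measure_display}
  {Omega : measurableType d} (X : R -> Omega -> cemetery E)
  (P : cemetery E -> probability Omega R) (hp : hunt_process X P).

(** By right continuity, for [T < t] the path at time [T] is in the open set [V] iff it is in one
    fixed [shrink] of [V] at all rational times shortly after [T]: countably many events known by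
    time [t]. The case [T = t] reads off [X t]. The sigma-algebra [F] is abstract in order to serve
    the natural and the augmented filtration alike. *)
Lemma at_time_measurable (F : set (set Omega)) (T : Omega -> \bar R) (t : R)
    (B : set (borel (cemetery E))) :
  0 <= t -> sigma_algebra setT F -> (forall w, 0 <= T w)%E ->
  (forall s (A : set (borel (cemetery E))), 0 <= s -> s <= t -> measurable A ->
    F (X s @^-1` A)) ->
  (forall s, 0 <= s -> s <= t -> F [set w | (T w <= s%:E)%E]) ->
  measurable B ->
  F ([set w | (T w <= t%:E)%E] `&` [set w | B (at_time X (T w) w)]).
Proof.
move=> t0 sF T0 FX FT mB.
pose O := g_sigma_algebraType F.
have mE : @measurable _ O = F by exact: sigma_algebra_gE.
rewrite -mE in FX FT *.
have mTt : measurable ([set w | (T w <= t%:E)%E] : set O) by apply: FT.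
have Tlt (q : R) : q <= t -> measurable ([set w | (T w < q%:E)%E] : set O).
  move=> qt.
  rewrite (_ : [set _ | _] = \bigcup_(p in [set p : rat | 0 <= (ratr p : R) < q])
      [set w | (T w <= (ratr p)%:E)%E]).
    rewrite bigcup_mkcond; apply: bigcupT_measurable_rat => p.
    case: ifPn => [/set_mem /= /andP[p0 pq]|_]; last exact: measurable0.
    by apply: FT => //; lra.
  apply/seteqP; split => [w /= Tq|w [p /= /andP[p0 pq] Tp]].
    have [p [Tp pq]] := ereal_rat_between (T0 w) Tq.
    exists p => /=; last exact: ltW.
    by rewrite pq andbT -lee_fin; apply: le_trans (T0 w) (ltW Tp).
  by apply: le_lt_trans Tp _; rewrite lte_fin.
have HV (V : set E) : open V -> measurable ([set w | (T w <= t%:E)%E] `&`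
    [set w | (Some @` V) (at_time X (T w) w)] : set O).
  move=> oV.
  pose V_ m := shrink V m.+1%:R^-1.
  have mV_ m : measurable (Some @` V_ m : set (borel (cemetery E))).
    by apply: measurable_Some_image; apply: closed_borel; exact: shrink_closed.
  (* Over all [q] these events say that at every rational time of [[0, t[] strictly between [T] and
     [T + n.+1%:R^-1] the path is in [V_ m]. *)
  pose G m n (q : rat) : set O :=
    if (0 <= (ratr q : R)) && (ratr q < t) then
      ~` [set w | (T w < (ratr q)%:E)%E] `|`
      [set w | (T w <= (ratr q - n.+1%:R^-1)%:E)%E] `|` X (ratr q) @^-1` (Some @` V_ m)
    else setT.
  have mG m n q : measurable (G m n q).
    rewrite /G; case: ifPn => // /andP[q0 qt].
    apply: measurableU; last by apply: FX => //; exact: ltW.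
    apply: measurableU; first by apply: measurableC; apply: Tlt; exact: ltW.
    have [q1|q1] := leP 0 (ratr q - n.+1%:R^-1 : R).
      by apply: FT => //; apply: le_trans (ltW qt); rewrite gerBl invr_ge0.
    rewrite (_ : [set _ | _] = set0); first exact: measurable0.
    apply/seteqP; split => w //= Tq; move: q1; rewrite ltNge -lee_fin => /negP; apply.
    exact: le_trans (T0 w) Tq.
  rewrite (_ : _ `&` _ = ([set w | (T w < t%:E)%E] `&`
      \bigcup_m \bigcup_n \bigcap_q G m n q) `|`
      (([set w | (T w <= t%:E)%E] `\` [set w | (T w < t%:E)%E]) `&`
        X t @^-1` (Some @` V))); last first.
    apply/seteqP; split => [w [/= Tt [x Vx]]|w [[/= Tt [m _ [n _ H]]]|]].
    - case ETw : (T w) => [s| |]//= Xs.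
      have s0 : 0 <= s by rewrite -lee_fin -ETw.
      have [st|st] := ltP s t; last first.
        right; split; first split => /=.
        + by rewrite -ETw.
        + by rewrite lte_fin ltNge st.
        + exists x => //=; rewrite Xs; congr (X _ w).
          by apply/eqP; rewrite eq_le st -lee_fin -ETw Tt.
      left; split; first by rewrite /= lte_fin.
      have [e e0 eV] := (open_ballP V).1 oV x Vx.
      have [m m2] : exists m : nat, m.+1%:R^-1 < e / 2.
        have : 0 < e / 2 by lra.
        by move/ltr_add_invr => [k]; rewrite add0r; exists k.
      have e20 : 0 < e / 2 by lra.
      have [f f0 fX] := right_nbhs hp s0 (esym Xs) (mball_open x (e/2)) (ballxx x e20).
      have [n nf] : exists n : nat, n.+1%:R^-1 < f.
        by have [k] := ltr_add_invr f0; rewrite add0r; exists k.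
      exists m => //; exists n => // q _; rewrite /G; case: ifPn => // /andP[q0 qt].
      have [Tq|Tq] := boolP (T w < (ratr q)%:E)%E; last by left; left; apply/negP.
      have [nq|nq] := leP s (ratr q - n.+1%:R^-1 : R).
        by left; right; rewrite /= ETw lee_fin.
      right; move: Tq; rewrite ETw lte_fin => sq.
      have [y yx yq] : (Some @` ball x (e/2)) (X (ratr q) w).
        apply: fX; first exact: ltW.
        by move: nq; rewrite ltrBlDr => /lt_trans; apply; rewrite ltrD2l.
      rewrite /= -yq; exists y => // z yz; apply: eV; move: yx yz; rewrite !ballE => yx /lt_trans/(_ m2) yz.
      have := metric_triangle x y z; lra.
    - split => /=; first exact: ltW.
      case ETw : (T w) Tt (T0 w) => [s| |]//= st; rewrite !lte_fin lee_fin in st * => s0.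
      have near_q (e : R) : 0 < e -> exists q : rat, [/\ s < ratr q, ratr q < s + e &
          (Some @` V_ m) (X (ratr q) w)].
        move=> e0.
        pose u := Num.min (s + e) (Num.min t (s + n.+1%:R^-1)).
        have su : s < u by rewrite /u !lt_min st ltrDl e0 ltrDl invr_gt0 ltr0Sn.
        have [q] := rat_in_itvoo su; rewrite in_itv /= /u !lt_min => /andP[sq /and3P[qe qt qn]].
        exists q; split => //; have := H q Logic.I; rewrite /G.
        have -> : 0 <= (ratr q : R) by lra.
        rewrite qt /= ETw !lte_fin lee_fin => -[[/negP|]|//]; first by rewrite sq.
        by rewrite lerBrDr leNgt qn.
      (* A path that is dead at [T] stays dead, hence is not in [V_ m] afterwards. *)
      case EX : (X s w) => [x|]; last first.
        have [q [sq _ [y _]]] := near_q 1 ltr01.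
        by rewrite (cemetery_absorbing hp s0 (ltW sq) EX).
      have m0 : 0 < m.+1%:R^-1 :> R by [].
      have [e e0 eX] := right_nbhs hp s0 EX (mball_open x m.+1%:R^-1) (ballxx x m0).
      have [q [sq qe [y yV yq]]] := near_q _ e0.
      have [z xz zq] := eX (ratr q) (ltW sq) qe.
      (* A point of [V_ m] closer than [m.+1%:R^-1] to [x] has [x] in its ball, and that ball lies
         in [V]. *)
      exists x => //; apply: yV; move: yq; rewrite -zq => -[->].
      by apply: ball_sym.
    - move=> [[/= Tt] /negP]; rewrite -leNgt => tT Xt.
      by have -> : T w = t%:E by apply/eqP; rewrite eq_le Tt tT.
  apply: measurableU; apply: measurableI.
  - exact: Tlt.
  - apply: bigcupT_measurable => m; apply: bigcupT_measurable => n.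
    exact: bigcapT_measurable_rat.
  - by apply: measurableD => //; exact: Tlt.
  - apply: FX => //; apply: measurable_Some_image; exact: open_borel.
move: mB; rewrite cemetery_measurable_gen => GB.
pose K := [set A : set (cemetery E) | measurable ([set w | (T w <= t%:E)%E] `&`
    [set w | A (at_time X (T w) w)] : set O)].
suff : K B by [].
move: B GB; apply: smallest_sub; last by move=> _ [V oV ->]; exact: HV.
split.
- rewrite /K /= (_ : _ `&` _ = set0); first exact: measurable0.
  by apply/seteqP; split => w [].
- move=> A KA; rewrite setTD /K /=.
  rewrite (_ : _ `&` _ = [set w | (T w <= t%:E)%E] `\` ([set w | (T w <= t%:E)%E] `&`
    [set w | A (at_time X (T w) w)])); first exact: measurableD.
  by rewrite setDIr setDv set0U.
- move=> A KA; rewrite /K /=.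
  rewrite (_ : _ `&` _ = \bigcup_n ([set w | (T w <= t%:E)%E] `&`
    [set w | A n (at_time X (T w) w)])); first exact: bigcupT_measurable.
  by rewrite -setI_bigcupr.
Qed.

End progressive.

(** * Exhaustion of an open set by closed sets with compact small balls *)

Section inner.
Context {R : realType} {E : pmetricType R}.
Implicit Types U : set E.

(** Besides staying away from the complement of [U], the points must have compact small closed
    balls, which local compactness provides at no uniform radius. Here all radii below [n.+1%:R^-1]
    work, as [iw_closed] requires. *)
Definition inner U (n : nat) : set E :=
  [set y | forall e, 0 < e -> e < n.+1%:R^-1 -> compact (cball y e) /\ cball y e `<=` U].

Lemma cball_sub (x y : E) (a b : R) : mdist x y + b <= a -> cball y b `<=` cball x a.
Proof. by move=> ab z; rewrite /cball /= => yz; have := metric_triangle x y z; lra. Qed.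

(** A failing radius [e] at [x] is strictly below [n.+1%:R^-1], and half of the gap is room to move
    the centre: a good ball about a nearby point would contain [cball x e]. *)
Lemma inner_closed U n : closed (inner U n).
Proof.
rewrite -openC; apply/open_ballP => x /= /existsNP[e /not_implyP[e0 /not_implyP[en nH]]].
exists ((n.+1%:R^-1 - e) / 2); first by rewrite divr_gt0 // subr_gt0.
move: en; set a := n.+1%:R^-1 => en.
move=> y; rewrite ballE => xy /= H; apply: nH.
have [||cy yU] := H (e + (a - e) / 2); rewrite -/a; [lra|lra|].
have sub : cball x e `<=` cball y (e + (a - e) / 2).
  by apply: cball_sub; rewrite (metric_sym y x); lra.
split; last exact: subset_trans sub yU.
by apply: subclosed_compact sub => //; exact: cball_closed.
Qed.

Lemma inner_interior U n (x : E) : inner U n x ->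
  exists2 e, 0 < e & ball x e `<=` inner U n.+1.
Proof.
move=> Ux; pose a : R := n.+1%:R^-1; pose b : R := n.+2%:R^-1.
have ba : b < a by rewrite /a /b ltf_pV2 ?posrE ?ltr0Sn // ltr_nat.
exists (a - b); first by rewrite subr_gt0.
move=> y; rewrite ballE => xy e e0 eb; rewrite -/b in eb.
have [||cx xU] := Ux (mdist x y + e); [have := mdist_ge0 x y; lra| rewrite -/a; lra|].
have sub : cball y e `<=` cball x (mdist x y + e) by exact: cball_sub.
split; last exact: subset_trans sub xU.
by apply: subclosed_compact sub => //; exact: cball_closed.
Qed.

Lemma inner_mono U m n : (m <= n)%N -> inner U m `<=` inner U n.
Proof.
move=> mn x Ux e e0 en; apply: Ux => //; apply: lt_le_trans en _.
by rewrite lef_pV2 ?posrE ?ltr0Sn // ler_nat.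
Qed.

Lemma inner_sub U n : inner U n `<=` U.
Proof.
move=> x Ux; have [||_] := Ux (n.+1%:R^-1 / 2).
- by rewrite divr_gt0.
- by rewrite ltr_pdivrMr // mulr_natr mulr2n ltrDl invr_gt0.
- by apply; rewrite /cball /= mdistxx divr_ge0.
Qed.

Lemma inner_cover U (x : E) : locally_compact [set: E] -> open U -> U x ->
  exists n, inner U n x.
Proof.
move=> lc oU Ux.
have [K] := lc x Logic.I; rewrite withinET => /nbhs_ballP[e /= e0 eK] [cK clK].
have [f f0 fU] := (open_ballP U).1 oU x Ux.
have m0 : 0 < Num.min e f by rewrite lt_min e0.
have [n] := ltr_add_invr m0; rewrite add0r => nm; exists n => a a0 an.
have sub : cball x a `<=` ball x (Num.min e f).
  by move=> y /= xy; rewrite ballE; apply: le_lt_trans xy (lt_trans an nm).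
split.
  apply: (subclosed_compact _ cK); first exact: cball_closed.
  apply: subset_trans sub _; apply: subset_trans eK.
  by apply: le_ball; rewrite ge_min lexx.
apply: subset_trans sub _; apply: subset_trans fU.
by apply: le_ball; rewrite ge_min lexx orbT.
Qed.

End inner.

(** * Exit times of closed sets as stopping times *)

Section exit.
Context {R : realType} {E : pmetricType R} {d : measure_display}
  {Omega : measurableType d} (X : R -> Omega -> cemetery E)
  (P : cemetery E -> probability Omega R) (hp : hunt_process X P).
Implicit Types (D K : set E) (w : Omega).

Lemma exit_time_ge0 D w : (0 <= exit_time X D w)%E.
Proof. by apply: le_ereal_inf_tmp => _ [t [t0 _] <-]; rewrite lee_fin. Qed.

Lemma exit_time_lb D w s : 0 <= s -> ~ (Some @` D) (X s w) -> (exit_time X D w <= s%:E)%E.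
Proof. by move=> s0 sD; apply: ereal_inf_lbound; exists s. Qed.

Lemma before_exit D w s : 0 <= s -> (s%:E < exit_time X D w)%E -> (Some @` D) (X s w).
Proof.
by move=> s0; apply: contraPP => /(exit_time_lb s0); rewrite leNgt => /negP.
Qed.

Lemma exit_time_lt D w (x : \bar R) : (exit_time X D w < x)%E ->
  exists s, [/\ 0 <= s, (s%:E < x)%E & ~ (Some @` D) (X s w)].
Proof. by case/ereal_inf_lt => _ [s [s0 sD] <-] sx; exists s. Qed.

Lemma exit_time_mono D D' w : D `<=` D' -> (exit_time X D w <= exit_time X D' w)%E.
Proof.
move=> DD'; apply: le_ereal_inf => _ [s [s0 sD] <-]; exists s => //; split => //.
by apply: contra_not sD; apply: image_subset.
Qed.

Lemma exit_time0 D w : ~ (Some @` D) (X 0 w) -> exit_time X D w = 0%E.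
Proof.
by move=> D0; apply/eqP; rewrite eq_le exit_time_ge0 andbT; exact: exit_time_lb.
Qed.

(** If the path were in [V] at the exit time, right continuity would keep it in [D] for some time
    longer. *)
Lemma exit_time_interior D w V : exit_time X D w \is a fin_num -> open V -> V `<=` D ->
  ~ (Some @` V) (at_time X (exit_time X D w) w).
Proof.
move=> /fineK; have := exit_time_ge0 D w.
set T := exit_time X D w; case ET : T => [t| |]//; rewrite lee_fin => t0 _ oV VD [x Vx /esym Xt].
have [e e0 He] := right_nbhs hp t0 Xt oV Vx.
have : (T < (t + e)%:E)%E by rewrite ET lte_fin ltrDl.
move=> /exit_time_lt[s [s0]]; rewrite lte_fin => se; apply.
have [ts|st] := leP t s; first exact: image_subset VD _ (He _ ts se).
by apply: before_exit => //; rewrite -/T ET lte_fin.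
Qed.

(** The complement of [K] is open and the cemetery is absorbing, so a path outside [K] remains
    outside during a short interval, which contains a rational time. *)
Lemma closed_exit_lt K w (t : R) : closed K -> (exit_time X K w < t%:E)%E ->
  exists q : rat, [/\ 0 <= (ratr q : R), ratr q < t & ~ (Some @` K) (X (ratr q) w)].
Proof.
move=> cK /exit_time_lt[s [s0]]; rewrite lte_fin => st sK.
case EX : (X s w) => [x|]; last first.
  have [q] := rat_in_itvoo st; rewrite in_itv /= => /andP[sq qt].
  exists q; split => //; first exact: le_trans s0 (ltW sq).
  by rewrite (cemetery_absorbing hp s0 (ltW sq) EX) => -[].
have nKx : (~` K) x by move=> Kx; apply: sK; rewrite EX; exists x.
have [e e0 He] := right_nbhs hp s0 EX (closed_openC cK) nKx.
have su : s < Num.min t (s + e) by rewrite lt_min st ltrDl.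
have [q] := rat_in_itvoo su; rewrite in_itv /= lt_min => /and3P[sq qt qe].
exists q; split => //; first exact: le_trans s0 (ltW sq).
have [y nKy <-] := He _ (ltW sq) qe.
by case=> z Kz [zy]; apply: nKy; rewrite -zy.
Qed.

Lemma closed_exit_ltE K (t : R) : closed K ->
  [set w | (exit_time X K w < t%:E)%E] =
  \bigcup_(q in [set q : rat | 0 <= (ratr q : R) < t])
    (X (ratr q) @^-1` (~` (Some @` K))).
Proof.
move=> cK; apply/seteqP; split => [w /= /(closed_exit_lt cK)[q [q0 qt Kq]]|].
  by exists q => //=; rewrite q0 qt.
move=> w [q /= /andP[q0 qt] Kq]; apply: le_lt_trans (exit_time_lb q0 Kq) _.
by rewrite lte_fin.
Qed.

Lemma closed_exit_natural K (t : R) : closed K ->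
  natural X `[0, t] [set w | (exit_time X K w < t%:E)%E].
Proof.
move=> cK; rewrite closed_exit_ltE //.
pose O := g_sigma_algebraType (natural X `[0, t]).
have mE : @measurable _ O = natural X `[0, t].
  by apply: sigma_algebra_gE; exact: smallest_sigma_algebra.
rewrite -mE bigcup_mkcond; apply: bigcupT_measurable_rat => q.
case: ifPn => [/set_mem /= /andP[q0 qt]|_]; last exact: measurable0.
rewrite mE; apply: natural_preimage; first by rewrite /= in_itv /= q0 ltW.
by apply: measurableC; apply: measurable_Some_image; exact: closed_borel.
Qed.

Local Notation nat_oo := (natural X `[0, +oo[).
Local Notation aug := (augmented X P).

(** Strict inequalities suffice because the augmented filtration is right-continuous: for every
    [s > t], the event [T <= t] is an intersection of events [T < t + (s - t) / n.+1%:R], all known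
    by time [s]. *)
Lemma stopping_lt (T : Omega -> \bar R) : (forall w, 0 <= T w)%E ->
  (forall t, 0 <= t -> natural X `[0, t] [set w | (T w < t%:E)%E]) ->
  stopping_time X P T.
Proof.
move=> T0 Tlt; split => // t t0.
apply: (hunt_filtration_right_continuous hp t0) => s /=; rewrite in_itv /= andbT => ts.
pose O := g_sigma_algebraType (aug `[0, s]).
have mE : @measurable _ O = aug `[0, s].
  by apply: sigma_algebra_gE; exact: augmented_sigma_algebra.
rewrite -mE.
rewrite (_ : [set _ | _] = \bigcap_n [set w | (T w < (t + (s - t) / n.+1%:R)%:E)%E]).
  apply: bigcapT_measurable => n; rewrite mE; apply: natural_augmented.
  have n0 : 0 <= (s - t) / n.+1%:R by rewrite divr_ge0 // subr_ge0 ltW.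
  have : natural X `[0, t + (s - t) / n.+1%:R] [set w | (T w < (t + (s - t) / n.+1%:R)%:E)%E].
    by apply: Tlt; rewrite addr_ge0.
  apply: natural_mono => u /=; rewrite !in_itv /= => /andP[-> /= /le_trans]; apply.
  rewrite -lerBrDl ler_pdivrMr ?ltr0Sn //.
  by apply: ler_peMr; rewrite ?subr_ge0 ?ler1n // ltW.
apply/seteqP; split => [w /= Tt n _ /=|w /= H].
  apply: le_lt_trans Tt _; rewrite lte_fin ltrDl divr_gt0 // subr_gt0 //.
apply/lee_addgt0Pr => e e0.
have st0 : 0 < s - t by rewrite subr_gt0.
have [n] := ltr_add_invr (divr_gt0 e0 st0); rewrite add0r => ne.
apply: le_trans (ltW (H n Logic.I)) _.
by rewrite -EFinD lee_fin lerD2l mulrC -ler_pdivlMr // ltW.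
Qed.

Lemma closed_exit_stopping K : closed K -> stopping_time X P (exit_time X K).
Proof.
move=> cK; apply: stopping_lt => [w|t t0]; first exact: exit_time_ge0.
exact: closed_exit_natural.
Qed.

Lemma stopping_natural_oo (T : Omega -> \bar R) (t : R) : 
  (forall s, 0 <= s -> natural X `[0, s] [set w | (T w < s%:E)%E]) ->
  0 <= t -> nat_oo [set w | (T w <= t%:E)%E].
Proof.
move=> Tlt t0.
pose O := g_sigma_algebraType nat_oo.
have mE : @measurable _ O = nat_oo.
  by apply: sigma_algebra_gE; exact: smallest_sigma_algebra.
rewrite -mE.
rewrite (_ : [set _ | _] = \bigcap_n [set w | (T w < (t + n.+1%:R^-1)%:E)%E]).
  apply: bigcapT_measurable => n; rewrite mE.
  have : natural X `[0, t + n.+1%:R^-1] [set w | (T w < (t + n.+1%:R^-1)%:E)%E].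
    by apply: Tlt; rewrite addr_ge0.
  by apply: natural_mono => u /=; rewrite !in_itv /= => /andP[->].
apply/seteqP; split => [w /= Tt n _ /=|w /= H].
  by apply: le_lt_trans Tt _; rewrite lte_fin ltrDl.
apply/lee_addgt0Pr => e e0.
have [n] := ltr_add_invr e0; rewrite add0r => ne; apply: le_trans (ltW (H n Logic.I)) _.
by rewrite -EFinD lee_fin lerD2l ltW.
Qed.

(** At [T = +oo] the position is the cemetery by convention, so this event is added or not according
    to whether [B] contains [None]. *)
Lemma at_time_measurable_oo (F : set (set Omega)) (T : Omega -> \bar R)
    (B : set (borel (cemetery E))) : sigma_algebra setT F ->
  (forall w, 0 <= T w)%E ->
  (forall s (A : set (borel (cemetery E))), 0 <= s -> measurable A -> F (X s @^-1` A)) ->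
  (forall s, 0 <= s -> F [set w | (T w <= s%:E)%E]) ->
  measurable B -> F [set w | B (at_time X (T w) w)].
Proof.
move=> sF T0 FX FT mB.
pose O := g_sigma_algebraType F.
have mE : @measurable _ O = F by exact: sigma_algebra_gE.
rewrite -mE in FX FT *.
have fin_meas : measurable (\bigcup_n ([set w | (T w <= n%:R%:E)%E] `&`
    [set w | B (at_time X (T w) w)]) : set O).
  apply: bigcupT_measurable => n; rewrite mE.
  apply: (@at_time_measurable _ _ _ _ X P hp F T n%:R B) => //.
  - by move=> s A s0 _ mA; rewrite -mE; exact: FX.
  - by move=> s s0 _; rewrite -mE; exact: FT.
have TE w : (exists n : nat, (T w <= n%:R%:E)%E) \/ T w = +oo%E.
  case: (T w) (T0 w) => [t| |]// _; [left|by right].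
  by exists (Num.truncn t).+1; rewrite lee_fin ltW // truncnS_gt.
have mfin : measurable (\bigcup_n [set w | (T w <= n%:R%:E)%E] : set O).
  by apply: bigcupT_measurable => n; exact: FT.
have [BN|nBN] := pselect (B None).
  rewrite (_ : [set w | _] = \bigcup_n ([set w | (T w <= n%:R%:E)%E] `&`
    [set w | B (at_time X (T w) w)]) `|` ~` (\bigcup_n [set w | (T w <= n%:R%:E)%E])).
    by apply: measurableU => //; exact: measurableC.
  apply/seteqP; split => w /=.
    move=> Bw; have [[n Tn]|Ty] := TE w; first by left; exists n.
    by right => -[n _ /=]; rewrite Ty.
  case=> [[n _ []]//|nT]; have [[n Tn]|->//] := TE w.
  by exfalso; apply: nT; exists n.
rewrite (_ : [set w | _] = \bigcup_n ([set w | (T w <= n%:R%:E)%E] `&`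
  [set w | B (at_time X (T w) w)])) //.
apply/seteqP; split => w /=.
  move=> Bw; have [[n Tn]|Ty] := TE w; first by exists n.
  by move: Bw; rewrite Ty.
by case=> n _ [].
Qed.

Lemma stopped_at_time (T : Omega -> \bar R) (B : set (borel (cemetery E))) :
  stopping_time X P T -> measurable B ->
  stopped_sigma_algebra X P T [set w | B (at_time X (T w) w)].
Proof.
move=> [T0 FT] mB; split.
  apply: at_time_measurable_oo => //; first exact: augmented_sigma_algebra.
  - move=> s A s0 mA; apply: natural_augmented; apply: natural_preimage => //.
    by rewrite /= in_itv /= s0.
  - move=> s s0; have := FT s s0; apply: augmented_mono => u /=.
    by rewrite !in_itv /= => /andP[->].
move=> t t0; rewrite setIC; apply: (at_time_measurable hp) => //.
- exact: augmented_sigma_algebra.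
- move=> s A s0 st mA; apply: natural_augmented; apply: natural_preimage => //.
  by rewrite /= in_itv /= s0.
- move=> s s0 st; have := FT s s0; apply: augmented_mono => u /=.
  by rewrite !in_itv /= => /andP[-> /= /le_trans]; exact.
Qed.

End exit.

(** * The strong Markov property *)

Section mixture.
Import HBSimple HBNNSimple.
Context d1 d2 (S : measurableType d1) (T : measurableType d2) (R : realType).
Variables (m : {measure set S -> \bar R}) (D : set S) (phi : S -> T)
  (k : S -> {measure set T -> \bar R}).
Hypotheses (mD : measurable D) (mphi : measurable_fun setT phi)
  (mk : forall U, measurable U -> measurable_fun setT (fun w => k w U))
  (mE : forall U, measurable U -> m (D `&` phi @^-1` U) = (\int[m]_(w in D) k w U)%E).

Let mphi_pre U : measurable U -> measurable (phi @^-1` U).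
Proof. by move=> mU; rewrite -[X in measurable X]setTI; exact: mphi. Qed.

Let mixture_nnsfun (g : {nnsfun T >-> R}) :
  (\int[m]_(w in D) (g (phi w))%:E = \int[m]_(w in D) \int[k w]_z (g z)%:E)%E.
Proof.
have gE z : ((g z)%:E = \sum_(r \in range g) (r * \1_(g @^-1` [set r]) z)%:E)%E.
  by rewrite fsumEFin // -fimfunE.
under eq_integral do rewrite gE.
under [in RHS]eq_integral => w _ do (under eq_integral do rewrite gE).
rewrite ge0_integral_fsum //; last 2 first.
- move=> r; apply/measurable_EFinP; apply: measurable_funM => //.
  by apply: measurableT_comp => //; apply: measurable_funTS.
- by move=> r w _; rewrite EFinM nnfun_muleindic_ge0.
under [in RHS]eq_integral => w _.
  rewrite ge0_integral_fsum //; last 2 first.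
  - by move=> r; apply/measurable_EFinP; exact: measurable_funM.
  - by move=> r z _; rewrite EFinM nnfun_muleindic_ge0.
  over.
have mf r : measurable (g @^-1` [set r]) by exact: measurable_funPTI.
have kE w r : (\int[k w]_z (r * \1_(g @^-1` [set r]) z)%:E = r%:E * k w (g @^-1` [set r]))%E.
  rewrite (integralZl_indic _ (fun r => g @^-1` [set r])) //; last first.
    by move=> r0; rewrite preimage_nnfun0.
  by rewrite integral_indic // setIT.
have k_ge0 w r : (0 <= r%:E * k w (g @^-1` [set r]))%E.
  have := mulemu_ge0 (mu := k w) (fun n => g @^-1` [set n]).
  by apply; exact: preimage_nnfun0.
under [in RHS]eq_integral => w _ do (under eq_fsbigr do rewrite kE).
rewrite [RHS]ge0_integral_fsum //; last first.
  by move=> r; apply: measurable_funeM; apply: measurable_funTS; exact: mk.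
apply: eq_fsbigr => r _.
have [r0|r0] := leP 0 r; last first.
  rewrite integral0_eq; last by move=> w _; rewrite preimage_nnfun0 // indic0 mulr0.
  by rewrite integral0_eq // => w _; rewrite preimage_nnfun0 // measure0 mule0.
have -> : (\int[m]_(w in D) (r * \1_(g @^-1` [set r]) (phi w))%:E =
    \int[m]_(w in D) (r * \1_(phi @^-1` (g @^-1` [set r])) w)%:E)%E by [].
under eq_integral do rewrite EFinM.
rewrite ge0_integralZl_EFin //; last first.
  apply/measurable_EFinP; apply: measurable_funTS; apply: measurable_indic.
  exact: (mphi_pre (mf r)).
rewrite integral_indic //; last exact: (mphi_pre (mf r)).
rewrite setIC (mE (mf r)) [in RHS]ge0_integralZl //.
by apply: measurable_funTS; exact: mk.
Qed.

(** The hypothesis [mE] says that the image under [phi] of [m] on [D] is the mixture of the measures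
    [k w]; the identity passes from sets to simple functions and to their increasing limits. *)
Lemma integral_mixture (f : T -> \bar R) : (forall z, 0 <= f z)%E ->
  measurable_fun setT f ->
  (\int[m]_(w in D) f (phi w) = \int[m]_(w in D) \int[k w]_z f z)%E.
Proof.
move=> f0 mf; pose f_ := nnsfun_approx measurableT mf.
have f_cvg z : (f_ n z)%:E @[n --> \oo] --> f z by exact: cvg_nnsfun_approx.
have f_nd z a b : (a <= b)%N -> ((f_ a z)%:E <= (f_ b z)%:E)%E.
  by move=> ab; rewrite lee_fin; exact/lefP/nd_nnsfun_approx.
have mfphi n : measurable_fun D (fun w => (f_ n (phi w))%:E).
  by apply/measurable_EFinP; apply: measurable_funTS; exact: measurableT_comp.
transitivity (\int[m]_(w in D) limn (fun n => (f_ n (phi w))%:E))%E.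
  by apply/eq_integral => w _; apply/esym/cvg_lim => //; exact: f_cvg.
rewrite monotone_convergence //; last 2 first.
- by move=> n w _; rewrite lee_fin.
- by move=> w _ a b; exact: f_nd.
rewrite (_ : (fun _ => _) = (fun n => \int[m]_(w in D) \int[k w]_z (f_ n z)%:E)%E); last first.
  by apply/funext => n; exact: mixture_nnsfun.
rewrite -monotone_convergence //; last 3 first.
- move=> n; apply: measurable_funTS; apply: measurable_fun_integral_kernel => //.
  + by move=> z; rewrite lee_fin.
  + exact/measurable_EFinP.
- by move=> n w _; apply: integral_ge0 => z _; rewrite lee_fin.
- move=> w _ a b ab; apply: ge0_integral_le => z _; first by rewrite lee_fin.
  exact: f_nd.
apply: eq_integral => w _; rewrite -monotone_convergence //; last 3 first.
- by move=> n; exact/measurable_EFinP.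
- by move=> n z _; rewrite lee_fin.
- by move=> z _ a b; exact: f_nd.
by apply: eq_integral => z _; apply/cvg_lim => //; exact: f_cvg.
Qed.

End mixture.

Section strong_markov.
Context {R : realType} {E : pmetricType R} {d : measure_display}
  {Omega : measurableType d} (X : R -> Omega -> cemetery E)
  (P : cemetery E -> probability Omega R) (hp : hunt_process X P).

Local Notation aug := (augmented X P).
Local Notation bC := (borel (cemetery E)).

(** Only the coordinates of a shifted path are prescribed, so measurability of the shift is
    available only with the natural sigma-algebra on the target. *)
Definition shift : R -> Omega -> Omega := sval (cid (hunt_shift hp)).

Lemma shiftE s t w : 0 <= s -> 0 <= t -> X s (shift t w) = X (s + t) w.
Proof. by move=> s0 t0; rewrite /shift; case: cid => f /= ->. Qed.

Lemma stopping_measurable T s : stopping_time X P T -> measurable [set w | (T w <= s%:E)%E].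
Proof.
move=> [T0 FT]; have [s0|s0] := leP 0 s.
  apply: (hunt_augmented hp); have := FT s s0; apply: augmented_mono => u /=.
  by rewrite !in_itv /= => /andP[->].
rewrite (_ : [set _ | _] = set0); first exact: measurable0.
apply/seteqP; split => w //= Ts; have := le_trans (T0 w) Ts.
by rewrite lee_fin leNgt s0.
Qed.

Lemma stopping_finite_measurable T : stopping_time X P T ->
  measurable [set w | (T w < +oo)%E].
Proof.
move=> sT; rewrite (_ : [set _ | _] = \bigcup_n [set w | (T w <= n%:R%:E)%E]).
  by apply: bigcupT_measurable => n; exact: stopping_measurable.
apply/seteqP; split => w /=.
  case ET : (T w) (sT.1 w) => [t| |]// _ _.
  by exists (Num.truncn t).+1 => //=; rewrite ET lee_fin ltW // truncnS_gt.
by case=> n _ /= /le_lt_trans; apply; rewrite ltry.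
Qed.

Lemma at_time_measurable_fun T : stopping_time X P T ->
  measurable_fun setT (fun w => at_time X (T w) w : bC).
Proof.
move=> sT _ B mB; rewrite setTI; apply: (hunt_augmented hp).
by have [] := stopped_at_time hp sT mB.
Qed.

Lemma stopping_cst t : 0 <= t -> stopping_time X P (fun=> t%:E).
Proof.
move=> t0; split => [w|s s0]; first by rewrite lee_fin.
have [sg0 sgC _] := augmented_sigma_algebra X P `[0, s].
have [ts|ts] := leP t s.
  rewrite (_ : [set w : Omega | (t%:E <= s%:E)%E] = setT `\` set0); first exact: sgC.
  by rewrite setD0; apply/seteqP; split => w //=; rewrite lee_fin.
rewrite (_ : [set w : Omega | (t%:E <= s%:E)%E] = set0) //.
by apply/seteqP; split => w //=; rewrite lee_fin leNgt ts.
Qed.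

Lemma stopping_add T t : stopping_time X P T -> 0 <= t ->
  stopping_time X P (fun w => (T w + t%:E)%E).
Proof.
move=> [T0 FT] t0; split => [w|s s0]; first by rewrite adde_ge0 // lee_fin.
have [ts|ts] := leP t s.
  rewrite (_ : [set w | (T w + t%:E <= s%:E)%E] = [set w | (T w <= (s - t)%:E)%E]).
    have st0 : 0 <= s - t by rewrite subr_ge0.
    have := FT _ st0; apply: augmented_mono => u /=.
    by rewrite !in_itv /= => /andP[-> /= ust]; apply: le_trans ust _; rewrite gerBl.
  by apply/seteqP; split => w /=; rewrite EFinB leeBrDr.
have [sg0 _ _] := augmented_sigma_algebra X P `[0, s].
rewrite (_ : [set w | (T w + t%:E <= s%:E)%E] = set0) //.
apply/seteqP; split => w //= Ts.
have : (t%:E <= s%:E)%E by apply: le_trans Ts; rewrite leeDr.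
by rewrite lee_fin leNgt ts.
Qed.

Lemma stopped_mono S T : stopping_time X P T -> (forall w, S w <= T w)%E ->
  stopped_sigma_algebra X P S `<=` stopped_sigma_algebra X P T.
Proof.
move=> sT ST A [AA AS]; split => // t t0.
pose O := g_sigma_algebraType (aug `[0, t]).
have mE : @measurable _ O = aug `[0, t].
  by apply: sigma_algebra_gE; exact: augmented_sigma_algebra.
rewrite (_ : _ `&` _ = (A `&` [set w | (S w <= t%:E)%E]) `&` [set w | (T w <= t%:E)%E]).
  by rewrite -mE; apply: measurableI; rewrite mE; [exact: AS|exact: sT.2].
apply/seteqP; split => w [Aw /= Tt]; last by case: Aw.
by do !split => //; exact: le_trans (ST w) Tt.
Qed.

Lemma stoppedI T A B : stopped_sigma_algebra X P T A ->
  stopped_sigma_algebra X P T B -> stopped_sigma_algebra X P T (A `&` B).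
Proof.
move=> [A1 A2] [B1 B2]; split.
  pose O := g_sigma_algebraType (aug `[0, +oo[).
  have mE : @measurable _ O = aug `[0, +oo[.
    by apply: sigma_algebra_gE; exact: augmented_sigma_algebra.
  by rewrite -mE; apply: measurableI; rewrite mE.
move=> t t0; pose O := g_sigma_algebraType (aug `[0, t]).
have mE : @measurable _ O = aug `[0, t].
  by apply: sigma_algebra_gE; exact: augmented_sigma_algebra.
by rewrite setIIl -mE; apply: measurableI; rewrite mE; [exact: A2|exact: B2].
Qed.

Lemma stoppedT T : stopping_time X P T -> stopped_sigma_algebra X P T setT.
Proof.
move=> [T0 FT]; split; last by move=> t t0; rewrite setTI; exact: FT.
have [sg0 sgC _] := augmented_sigma_algebra X P `[0, +oo[.
by rewrite -[setT]setD0; exact: sgC.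
Qed.

Lemma stopped_measurable T A : stopped_sigma_algebra X P T A -> measurable A.
Proof. by move=> [A1 _]; exact: (hunt_augmented hp). Qed.

Lemma strong_markov_fun T t A x (f : bC -> \bar R) : stopping_time X P T -> 0 <= t ->
  stopped_sigma_algebra X P T A -> (forall z, 0 <= f z)%E -> measurable_fun setT f ->
  (\int[P x]_(w in A `&` [set w | (T w < +oo)%E]) f (at_time X (T w + t%:E) w) =
   \int[P x]_(w in A `&` [set w | (T w < +oo)%E])
     \int[P (at_time X (T w) w)]_w' f (X t w'))%E.
Proof.
move=> sT t0 GA f0 mf.
pose k (w : Omega) : {measure set bC -> \bar R} := pushforward (P (at_time X (T w) w)) (X t : Omega -> bC).
have mX := measurable_X hp t0.
have mT := at_time_measurable_fun sT.
rewrite (@integral_mixture _ _ Omega bC R (P x) _ (fun w => at_time X (T w + t%:E) w) (k mX)) //.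
- apply: eq_integral => w _.
  by rewrite ge0_integral_pushforward // preimage_setT.
- apply: measurableI; last exact: stopping_finite_measurable.
  exact: stopped_measurable GA.
- by apply: at_time_measurable_fun; exact: stopping_add.
- move=> U mU.
  exact: (measurableT_comp (hunt_measurable hp t0 mU) mT).
- by move=> U mU; exact: (hunt_strong_markov hp sT t0 mU GA x).
Qed.

End strong_markov.

(** * Strong Markov property for constraints at finitely many times *)

Section path_strong_markov.
Context {R : realType} {E : pmetricType R} {d : measure_display}
  {Omega : measurableType d} (X : R -> Omega -> cemetery E)
  (P : cemetery E -> probability Omega R) (hp : hunt_process X P).

Local Notation nat_oo := (natural X `[0, +oo[).
Local Notation bC := (borel (cemetery E)).
Local Notation paths := (g_sigma_algebraType nat_oo).
Local Notation theta := (shift hp).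

Definition constraint := (R * set (cemetery E))%type.

Definition cylinder (l : seq constraint) : set Omega :=
  [set w | forall p, p \in l -> p.2 (X p.1 w)].

Definition admissible (p : constraint) : bool :=
  (0 <= p.1) && `[< measurable (p.2 : set bC) >].

Definition earlier : rel constraint := fun p q => p.1 <= q.1.

Lemma nat_ooE : @measurable _ paths = nat_oo.
Proof. by apply: sigma_algebra_gE; exact: smallest_sigma_algebra. Qed.

Lemma cylinder_cons p l : cylinder (p :: l) = X p.1 @^-1` p.2 `&` cylinder l.
Proof.
apply/seteqP; split => w /=.
  by move=> H; split => [|q ql]; apply: H; rewrite inE ?eqxx // ql orbT.
by move=> [Hp Hl] q; rewrite inE => /orP[/eqP ->|/Hl].
Qed.

Lemma cylinder_nil : cylinder [::] = setT.
Proof. by apply/seteqP; split. Qed.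

Lemma cylinder_natural l : all admissible l -> nat_oo (cylinder l).
Proof.
elim: l => [_|p l IH /= /andP[/andP[p0 /asboolP mp] al]].
  by rewrite cylinder_nil -nat_ooE; exact: measurableT.
rewrite cylinder_cons -nat_ooE; apply: measurableI; rewrite nat_ooE; last exact: IH.
by apply: natural_preimage => //=; rewrite in_itv /= p0.
Qed.

Definition shift_constraint t (p : constraint) : constraint := (p.1 - t, p.2).

Lemma cylinder_shift t l w : 0 <= t -> all (fun p => t <= p.1) l ->
  cylinder (map (shift_constraint t) l) (theta t w) = cylinder l w.
Proof.
move=> t0 /allP tl; apply/propext; split => H p pl.
  have := H (shift_constraint t p) (map_f _ pl).
  by rewrite /shift_constraint /= shiftE // ?subr_ge0 ?tl // subrK.
have /mapP[q ql ->] := pl.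
by rewrite /shift_constraint /= shiftE // ?subr_ge0 ?tl // subrK; exact: H.
Qed.

Lemma cylinder_ext l w w' : all admissible l ->
  (forall t, 0 <= t -> X t w = X t w') -> cylinder l w -> cylinder l w'.
Proof. by move=> /allP al ww' H p pl; have /andP[p0 _] := al _ pl; rewrite -ww' //; exact: H. Qed.

(** The shifts need not form a semigroup on [Omega], but their coordinates compose, and by
    [cylinder_ext] a cylinder sees nothing else. *)
Lemma shift_add s t u w : 0 <= s -> 0 <= t -> 0 <= u ->
  X u (theta t (theta s w)) = X u (theta (s + t) w).
Proof. by move=> s0 t0 u0; rewrite !shiftE ?addr_ge0 // addrAC -addrA. Qed.

(* The shift by a time that may be infinite, where its value is immaterial. *)
Definition shift_at (T : Omega -> \bar R) (w : Omega) : Omega :=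
  if T w is t%:E then theta t w else w.

Lemma measurable_shift_at T : stopping_time X P T ->
  measurable_fun setT (shift_at T : Omega -> paths).
Proof.
move=> sT; have T0 := sT.1.
apply: (@measurability _ _ _ paths _ _ (\bigcup_(s in `[0, +oo[)
        preimage_set_system setT (X s) (@measurable _ bC))).
  by rewrite nat_ooE.
move=> _ [_ [s] + [A mA <-] <-]; rewrite /= in_itv /= andbT => s0.
rewrite !setTI.
have mTs := at_time_measurable_fun hp (stopping_add sT s0).
have mXs := measurable_X hp s0.
have mT := stopping_finite_measurable hp sT.
rewrite (_ : _ @^-1` _ = ([set w | (T w < +oo)%E] `&`
   (fun w => at_time X (T w + s%:E)%E w) @^-1` A) `|`
   (~` [set w | (T w < +oo)%E] `&` X s @^-1` A)).
  apply: measurableU; apply: measurableI => //.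
  - by rewrite -[X in measurable X]setTI; exact: mTs.
  - exact: measurableC.
  - by rewrite -[X in measurable X]setTI; exact: mXs.
apply/seteqP; split => w; rewrite /= /shift_at.
  case ET : (T w) (T0 w) => [t| |]// _; rewrite ?lee_fin.
    move=> At; left; rewrite ltry; split => //; move: At.
    by rewrite shiftE //= 1?addrC // -lee_fin -ET.
  by move=> As; right; split => //; rewrite ltxx.
case ET : (T w) (T0 w) => [t| |]// t0 [[//]|[]]//.
- by move=> _; rewrite shiftE //= 1?addrC.
- by rewrite ltry.
Qed.

(** The earliest constraint, at time [t], is absorbed into the event at the stopping time [T + t];
    from there the induction hypothesis treats the other constraints, moved back by [t], and the
    property for a single time leads from [T + t] back to [T]. The induction is on the length since
    the moved list is not a sublist of [l]. *)
Lemma sorted_cylinder_markov n (l : seq constraint) : size l = n ->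
  sorted earlier l -> all admissible l ->
  measurable_fun setT (fun y : bC => P y (cylinder l)) /\
  forall T A x, stopping_time X P T -> stopped_sigma_algebra X P T A ->
   (P x ((A `&` [set w | (T w < +oo)%E]) `&` shift_at T @^-1` (cylinder l)) =
    \int[P x]_(w in A `&` [set w | (T w < +oo)%E]) P (at_time X (T w) w) (cylinder l))%E.
Proof.
elim: n l => [|n IH] [|[t B] l]// => [_ _ _|[sl] srt /= /andP[/andP[/= t0 /asboolP mB] al]].
  rewrite cylinder_nil; split.
    by apply: (eq_measurable_fun (fun=> 1%E)) => [y _|]; rewrite ?probability_setT.
  move=> T A x sT GA; rewrite preimage_setT setIT.
  under eq_integral do rewrite probability_setT.
  have mD : measurable (A `&` [set w | (T w < +oo)%E]).
    apply: measurableI; last exact: (stopping_finite_measurable hp).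
    exact: (stopped_measurable hp GA).
  by rewrite integral_cst // mul1e.
have tl : all (fun p => t <= p.1) l.
  by move: srt => /= /order_path_min; apply; move=> a b c; exact: le_trans.
pose l' := map (shift_constraint t) l.
have sl' : size l' = n by rewrite size_map.
have srt' : sorted earlier l'.
  rewrite sorted_map; apply: sub_sorted (path_sorted srt) => p q.
  by rewrite /earlier /= lerD2r.
have al' : all admissible l'.
  rewrite all_map; apply/allP => p pl.
  have /andP[_ mp] := allP al p pl.
  by rewrite /admissible /= subr_ge0 (allP tl p pl).
have [mG SM] := IH _ sl' srt' al'.
pose G (y : bC) : \bar R := P y (cylinder l').
(* [f y] is the probability from [y] of the later constraints when [y] meets the earliest one, and 0
   otherwise. *)
pose f : bC -> \bar R := (G \_ B)%R.
have f0 y : (0 <= f y)%E by rewrite /f /patch; case: ifPn.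
have mf : measurable_fun setT f.
  by apply: (measurable_restrictT _ mB).1; apply: measurable_funS mG.
have mXt := measurable_X hp t0.
(* This is the induction hypothesis at the deterministic time [t]. *)
have Py y : (P y (cylinder ((t, B) :: l)) = \int[P y]_w f (X t w))%E.
  have st := stopping_cst X P t0.
  have := SM _ _ y st (stopped_at_time hp st mB).
  have -> : [set w : Omega | (t%:E < +oo :> \bar R)%E] = setT.
    by apply/seteqP; split => w //= _; rewrite ltry.
  rewrite setIT => H.
  transitivity (P y ([set w | B (at_time X t%:E w)] `&` shift_at (fun=> t%:E) @^-1` (cylinder l'))).
    congr (P y _); rewrite cylinder_cons; apply/seteqP; split => w [Bw lw]; split => //=.
      by rewrite /shift_at cylinder_shift.
    by move: lw; rewrite /= /shift_at cylinder_shift.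
  rewrite H integral_mkcond; apply: eq_integral => w _.
  rewrite /f /patch /=.
  have [Bw|Bw] := pselect (B (X t w)); first by rewrite !mem_set.
  by rewrite !memNset.
split.
  pose k (y : bC) : {measure set bC -> \bar R} :=
    pushforward (P y) (X t : Omega -> bC).
  rewrite (_ : (fun y => _) = (fun y => \int[k mXt y]_z f z)%E); last first.
    by apply/funext => y; rewrite Py ge0_integral_pushforward // preimage_setT.
  apply: measurable_fun_integral_kernel => //.
  by move=> U mU; exact: (hunt_measurable hp t0 mU).
move=> T A x sT GA.
have T0 := sT.1.
have sTt := stopping_add sT t0.
have TTt w : (T w <= T w + t%:E)%E by rewrite leeDl // lee_fin.
have Ttfin w : (T w + t%:E < +oo)%E = (T w < +oo)%E.
  by case: (T w) (T0 w) => [s| |]//=; rewrite !ltry.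
have GA' := stoppedI (stopped_mono sTt TTt GA) (stopped_at_time hp sTt mB).
have := SM _ _ x sTt GA'.
rewrite (_ : [set w | (T w + t%:E < +oo)%E] = [set w | (T w < +oo)%E]); last first.
  by apply/seteqP; split => w /=; rewrite Ttfin.
move=> H.
transitivity (P x (A `&` [set w | B (at_time X (T w + t%:E)%E w)] `&` [set w | (T w < +oo)%E]
  `&` shift_at (fun w => T w + t%:E)%E @^-1` (cylinder l'))).
  congr (P x _).
  have E2 w u : 0 <= u -> cylinder ((t, B) :: l) (theta u w) <->
      B (X (u + t) w) /\ cylinder l' (theta (u + t) w).
    move=> u0; rewrite cylinder_cons /= shiftE // (addrC t u).
    rewrite -(cylinder_shift (theta u w) t0 tl).
    by split=> -[Bw lw]; split => //; apply: cylinder_ext lw => // v v0; rewrite shift_add.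
  apply/seteqP; split => w.
    case=> -[Aw /= Tw]; rewrite /shift_at.
    case ET : (T w) (T0 w) Tw => [s| |]//=; rewrite lee_fin => s0 _ lw0.
    have [Bw lw] := (E2 w s s0).1 lw0.
    by do !split => //=; rewrite ltry.
  case=> -[[Aw /= Bw] Tw]; rewrite /shift_at; move: Bw.
  case ET : (T w) (T0 w) Tw => [s| |]//=; rewrite lee_fin => s0 _ Bw lw.
  by split; [split => //=; rewrite ltry|exact: (E2 _ _ s0).2].
rewrite H.
transitivity (\int[P x]_(w in A `&` [set w | (T w < +oo)%E]) f (at_time X (T w + t%:E) w))%E.
  rewrite setIAC -integral_mkcondr; apply: eq_integral => w _.
  by [].
rewrite (strong_markov_fun hp x sT t0 GA f0 mf).
by apply: eq_integral => w _; rewrite Py.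
Qed.

End path_strong_markov.

Lemma measure_bigcupT d (T : measurableType d) (R : realType)
    (mu : {measure set T -> \bar R}) (F : (set T)^nat) :
  (forall n, measurable (F n)) -> trivIset setT F ->
  mu (\bigcup_n F n) = (\sum_(n <oo) mu (F n))%E.
Proof.
move=> mF tF; rewrite measure_bigcup //.
by apply: eq_eseriesl => n; rewrite in_setT.
Qed.

(** * Strong Markov property for natural events and path functionals *)

Section strong_markov_natural.
Context {R : realType} {E : pmetricType R} {d : measure_display}
  {Omega : measurableType d} (X : R -> Omega -> cemetery E)
  (P : cemetery E -> probability Omega R) (hp : hunt_process X P).

Local Notation nat_oo := (natural X `[0, +oo[).
Local Notation bC := (borel (cemetery E)).
Local Notation paths := (g_sigma_algebraType nat_oo).

Let G : set (set Omega) := [set cylinder X l | l in [set l | all (@admissible R E) l]].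

Let cylinder_setI_closed : setI_closed G.
Proof.
move=> _ _ [l al <-] [m am <-]; exists (l ++ m); first by rewrite /= all_cat al.
apply/seteqP; split => w.
  by move=> H; split => p pl; apply: H; rewrite mem_cat pl ?orbT.
by move=> [Hl Hm] p; rewrite mem_cat => /orP[/Hl|/Hm].
Qed.

Let natural_G : nat_oo = <<s G >>.
Proof.
apply/seteqP; split; apply: smallest_sub; try exact: smallest_sigma_algebra.
- move=> C [s]; rewrite /= in_itv /= andbT => s0 [B mB <-].
  apply: sub_sigma_algebra; exists [:: (s, B)] => /=.
    by rewrite /admissible /= s0 andbT; exact/asboolP.
  by rewrite cylinder_cons cylinder_nil setTI setIT.
- by move=> _ [l al <-]; exact: cylinder_natural.
Qed.

Let cylinder_markov l : all (@admissible R E) l ->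
  measurable_fun setT (fun y : bC => P y (cylinder X l)) /\
  forall T A x, stopping_time X P T -> stopped_sigma_algebra X P T A ->
   (P x ((A `&` [set w | (T w < +oo)%E]) `&` shift_at hp T @^-1` (cylinder X l)) =
    \int[P x]_(w in A `&` [set w | (T w < +oo)%E]) P (at_time X (T w) w) (cylinder X l))%E.
Proof.
move=> al.
(* A cylinder does not depend on the order of its constraints, so they may be sorted by time. *)
have -> : cylinder X l = cylinder X (sort (@earlier R E) l).
  by apply/seteqP; split => w H p pl; apply: H; move: pl; rewrite mem_sort.
apply: (sorted_cylinder_markov hp (erefl _)).
  by apply: sort_sorted => p q; rewrite /earlier; exact: le_total.
by rewrite all_sort.
Qed.

(** Cylinders are stable under intersection and generate the natural sigma-algebra, so Dynkin's
    argument applies. Measurability of [P y L] in [y] is carried along because the right-hand side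
    integrates it. *)
Lemma markov_natural L : nat_oo L ->
  measurable_fun setT (fun y : bC => P y L) /\
  forall T A x, stopping_time X P T -> stopped_sigma_algebra X P T A ->
   (P x ((A `&` [set w | (T w < +oo)%E]) `&` shift_at hp T @^-1` L) =
    \int[P x]_(w in A `&` [set w | (T w < +oo)%E]) P (at_time X (T w) w) L)%E.
Proof.
rewrite natural_G => mL.
pose Q L := measurable_fun setT (fun y : bC => P y L) /\
  forall T A x, stopping_time X P T -> stopped_sigma_algebra X P T A ->
   (P x ((A `&` [set w | (T w < +oo)%E]) `&` shift_at hp T @^-1` L) =
    \int[P x]_(w in A `&` [set w | (T w < +oo)%E]) P (at_time X (T w) w) L)%E.
have mE : @measurable _ (g_sigma_algebraType G) = <<s G >> by [].
have mO S : <<s G >> S -> measurable (S : set Omega).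
  by rewrite -natural_G; exact: (natural_measurable hp).
have mD T A : stopping_time X P T -> stopped_sigma_algebra X P T A ->
    measurable (A `&` [set w | (T w < +oo)%E]).
  move=> sT GA; apply: measurableI; last exact: (stopping_finite_measurable hp).
  exact: (stopped_measurable hp GA).
have mS T S : stopping_time X P T -> <<s G >> S -> measurable (shift_at hp T @^-1` S).
  move=> sT mS; rewrite -[X in measurable X]setTI; apply: (measurable_shift_at hp sT) => //.
  by rewrite nat_ooE natural_G.
have mcomp T (f : bC -> \bar R) D : stopping_time X P T -> measurable_fun setT f ->
    measurable_fun D (fun w => f (at_time X (T w) w)).
  move=> sT mf; apply: measurable_funTS.
  exact: (measurableT_comp mf (at_time_measurable_fun hp sT)).
suff : Q L by [].
apply: (dynkin_induction mE cylinder_setI_closed _ _ _ _ mL).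
- rewrite -(cylinder_nil X); exact: cylinder_markov.
- by move=> _ [l al <-]; exact: cylinder_markov.
- move=> S mGS [mPS SM]; split.
    rewrite (_ : (fun y => _) = (fun y => 1 - P y S)%E); last first.
      by apply/funext => y; rewrite probability_setC //; exact: mO.
    exact: emeasurable_funB.
  move=> T A x sT GA; have mTA := mD _ _ sT GA; have mTS := mS _ _ sT mGS.
  have mPC : measurable_fun setT (fun y : bC => P y (~` S)).
    rewrite (_ : (fun y => _) = (fun y => 1 - P y S)%E); first exact: emeasurable_funB.
    by apply/funext => y; rewrite probability_setC //; exact: mO.
  have -> : P x ((A `&` [set w | (T w < +oo)%E]) `&` shift_at hp T @^-1` (~` S)) =
      (P x (A `&` [set w | (T w < +oo)%E]) -
       P x ((A `&` [set w | (T w < +oo)%E]) `&` shift_at hp T @^-1` S))%E.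
    rewrite preimage_setC -setDE measureD //.
    exact: le_lt_trans (probability_le1 _ _) (ltry 1).
  have PD : P x (A `&` [set w | (T w < +oo)%E]) =
      (\int[P x]_(w in A `&` [set w | (T w < +oo)%E]) P (at_time X (T w) w) (~` S) +
       \int[P x]_(w in A `&` [set w | (T w < +oo)%E]) P (at_time X (T w) w) S)%E.
    rewrite -ge0_integralD //; [|exact: (mcomp _ (fun y => P y (~` S)))|exact: (mcomp _ (fun y => P y S))].
    transitivity (\int[P x]_(w in A `&` [set w | (T w < +oo)%E]) (cst 1 w))%E.
      by rewrite integral_cst // mul1e.
    apply: eq_integral => w _; rewrite probability_setC; last exact: mO.
    by rewrite subeK // fin_num_measure //; exact: mO.
  have SMx := SM _ _ x sT GA; rewrite PD SMx addeK // -SMx fin_num_measure //.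
  exact: measurableI.
- move=> F mF tF QF; split.
    rewrite (_ : (fun y => _) = (fun y => \sum_(n <oo) P y (F n))%E); last first.
      apply/funext => y; apply: (measure_bigcupT (P y)); last exact: tF.
      by move=> n; apply: mO; exact: mF.
    apply: ge0_emeasurable_sum => //.
    by move=> n _; exact: (QF n).1.
  move=> T A x sT GA; have mTA := mD _ _ sT GA.
  rewrite preimage_bigcup setI_bigcupr measure_bigcupT //; last 2 first.
  + by move=> n; apply: measurableI => //; apply: mS => //; exact: mF.
  + apply/trivIsetP => i j _ _ ij; rewrite setIACA setIid.
    rewrite -preimage_setI; move/trivIsetP : tF => -> //.
    by rewrite preimage_set0 setI0.
  transitivity (\sum_(n <oo) \int[P x]_(w in A `&` [set w | (T w < +oo)%E])
      P (at_time X (T w) w) (F n))%E.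
    by apply: eq_eseriesr => n _; exact: (QF n).2.
  rewrite -integral_nneseries //; last by move=> n; apply: (mcomp _ (fun y => P y (F n))) => //; exact: (QF n).1.
  by apply: eq_integral => w _; rewrite measure_bigcupT // => n; apply: mO; exact: mF.
Qed.

Lemma measurable_expectation (F : paths -> \bar R) : (forall w, 0 <= F w)%E ->
  measurable_fun setT F -> measurable_fun setT (fun y : bC => \int[P y]_w F w)%E.
Proof.
move=> F0 mF.
have mid : measurable_fun setT (idfun : Omega -> paths).
  by move=> _ B mB; rewrite setTI preimage_id; apply: (natural_measurable hp); rewrite -nat_ooE.
pose k (y : bC) : {measure set paths -> \bar R} := pushforward (P y) (idfun : Omega -> paths).
rewrite (_ : (fun y => _) = (fun y => \int[k mid y]_w F w)%E); last first.
  by apply/funext => y; rewrite ge0_integral_pushforward // preimage_setT.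
apply: measurable_fun_integral_kernel => // U mU.
by have [] := markov_natural (_ : nat_oo U); first by rewrite -nat_ooE.
Qed.

Theorem strong_markov T A x (F : paths -> \bar R) : stopping_time X P T ->
  stopped_sigma_algebra X P T A -> (forall w, 0 <= F w)%E -> measurable_fun setT F ->
  (\int[P x]_(w in A `&` [set w | (T w < +oo)%E]) F (shift_at hp T w) =
   \int[P x]_(w in A `&` [set w | (T w < +oo)%E]) \int[P (at_time X (T w) w)]_w' F w')%E.
Proof.
move=> sT GA F0 mF.
have mid : measurable_fun setT (idfun : Omega -> paths).
  by move=> _ B mB; rewrite setTI preimage_id; apply: (natural_measurable hp); rewrite -nat_ooE.
pose k (w : Omega) : {measure set paths -> \bar R} :=
  pushforward (P (at_time X (T w) w)) (idfun : Omega -> paths).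
rewrite (@integral_mixture _ _ Omega paths R (P x) _ (shift_at hp T) (k mid)) //.
- by apply: eq_integral => w _; rewrite ge0_integral_pushforward // preimage_setT.
- apply: measurableI; last exact: (stopping_finite_measurable hp).
  exact: (stopped_measurable hp GA).
- exact: measurable_shift_at.
- move=> U; rewrite nat_ooE => mU.
  exact: (measurableT_comp (markov_natural mU).1 (at_time_measurable_fun hp sT)).
- by move=> U; rewrite nat_ooE => mU; exact: (markov_natural mU).2.
Qed.

End strong_markov_natural.

(** * Exit from open sets *)

Lemma measurable_time d (T : measurableType d) (R : realType) (f : T -> \bar R) :
  (forall w, 0 <= f w)%E -> (forall s : R, 0 <= s -> measurable [set w | (f w <= s%:E)%E]) ->
  measurable_fun setT f.
Proof.
move=> f0 mf; apply: (measurability _ (ErealGenOInfty.measurableE R)).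
move=> _ [_ [r ->] <-]; rewrite setTI.
rewrite (_ : _ @^-1` _ = ~` [set w | (f w <= r%:E)%E]); last first.
  apply/seteqP; split => w; rewrite /= in_itv /= andbT.
    by move=> rw; apply/negP; rewrite -ltNge.
  by move/negP; rewrite -ltNge.
apply: measurableC; have [r0|r0] := leP 0 r; first exact: mf.
rewrite (_ : [set _ | _] = set0); first exact: measurable0.
apply/seteqP; split => w //= wr; have := le_trans (f0 w) wr.
by rewrite lee_fin leNgt r0.
Qed.

Section open_exit.
Context {R : realType} {E : pmetricType R} {d : measure_display}
  {Omega : measurableType d} (X : R -> Omega -> cemetery E)
  (P : cemetery E -> probability Omega R) (hp : hunt_process X P)
  (lc : locally_compact [set: E]).

Local Notation nat_oo := (natural X `[0, +oo[).
Local Notation bC := (borel (cemetery E)).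
Local Notation paths := (g_sigma_algebraType nat_oo).
Local Notation theta := (shift hp).
Implicit Types (U : set E) (w : Omega).

Lemma measurable_paths d' (T : measurableType d') (f : Omega -> T) :
  measurable_fun setT (f : paths -> T) -> measurable_fun setT f.
Proof.
move=> mf _ B mB; rewrite setTI; apply: (natural_measurable hp); rewrite -nat_ooE.
by rewrite -[X in measurable X]setTI; exact: mf.
Qed.

(* Unlike the exit time of [U], this is measurable with respect to the natural
   filtration; quasi-left continuity makes the two agree almost surely. *)
Definition open_exit U w : \bar R :=
  ereal_sup (range (fun n => exit_time X (inner U n) w)).

Lemma open_exit_lb U n w : (exit_time X (inner U n) w <= open_exit U w)%E.
Proof. by apply: ereal_sup_ubound; exists n. Qed.

Lemma open_exit_ge0 U w : (0 <= open_exit U w)%E.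
Proof. exact: le_trans (exit_time_ge0 X (inner U 0) w) (open_exit_lb U 0 w). Qed.

Lemma open_exit_le U w : (open_exit U w <= exit_time X U w)%E.
Proof. by apply: ge_ereal_sup => _ [n _ <-]; apply: exit_time_mono; exact: inner_sub. Qed.

Lemma open_exit_mono U V w : U `<=` V -> (open_exit U w <= open_exit V w)%E.
Proof.
move=> UV; apply: ge_ereal_sup => _ [n _ <-]; apply: le_trans (open_exit_lb V n w).
apply: exit_time_mono => x Ux e e0 en; have [cx xU] := Ux e e0 en.
by split => //; exact: subset_trans xU UV.
Qed.

Lemma before_open_exit U w s : 0 <= s -> (s%:E < open_exit U w)%E -> (Some @` U) (X s w).
Proof.
move=> s0 /ereal_sup_gt[_ [n _ <-]] sn.
by apply: image_subset (before_exit s0 sn); exact: inner_sub.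
Qed.

Lemma inner_exit_natural U n (t : R) :
  natural X `[0, t] [set w | (exit_time X (inner U n) w < t%:E)%E].
Proof. apply: (closed_exit_natural hp); exact: inner_closed. Qed.

Lemma open_exit_leE U (t : R) : [set w | (open_exit U w <= t%:E)%E] =
  \bigcap_n [set w | (exit_time X (inner U n) w <= t%:E)%E].
Proof.
apply/seteqP; split => [w /= wt n _ /=|w H].
  by apply: le_trans wt; exact: open_exit_lb.
by apply: ge_ereal_sup => _ [n _ <-]; exact: (H n Logic.I).
Qed.

Lemma open_exit_natural U (t : R) : 0 <= t ->
  nat_oo [set w | (open_exit U w <= t%:E)%E].
Proof.
move=> t0; rewrite open_exit_leE -nat_ooE; apply: bigcapT_measurable => n.
rewrite nat_ooE; apply: stopping_natural_oo => // s s0; exact: inner_exit_natural.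
Qed.

Lemma open_exit_stopping U : stopping_time X P (open_exit U).
Proof.
split => [w|t t0]; first exact: open_exit_ge0.
have mE : @measurable _ (g_sigma_algebraType (augmented X P `[0, t])) = augmented X P `[0, t].
  by apply: sigma_algebra_gE; exact: augmented_sigma_algebra.
rewrite open_exit_leE -mE; apply: bigcapT_measurable => n; rewrite mE.
by have [_] := closed_exit_stopping hp (@inner_closed R E U n); exact.
Qed.

Lemma measurable_open_exit U : measurable_fun setT (open_exit U : paths -> \bar R).
Proof.
apply: measurable_time => [w|s s0]; first exact: open_exit_ge0.
by rewrite nat_ooE; exact: open_exit_natural.
Qed.

Lemma open_exit_lt_natural U (t : R) : nat_oo [set w | (open_exit U w < t%:E)%E].
Proof.
have -> : [set w | (open_exit U w < t%:E)%E] = open_exit U @^-1` `]-oo, t%:E[.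
  by apply/seteqP; split => w; rewrite /= in_itv.
rewrite -nat_ooE -[X in measurable X]setTI; apply: measurable_open_exit => //.
exact: emeasurable_itv.
Qed.

Lemma measurable_closed_exit (K : set E) : closed K ->
  measurable_fun setT (exit_time X K : paths -> \bar R).
Proof.
move=> cK; apply: measurable_time => [w|s s0]; first exact: exit_time_ge0.
rewrite nat_ooE; apply: stopping_natural_oo => // t t0; exact: (closed_exit_natural hp).
Qed.

Lemma measurable_at_time (T : paths -> \bar R) : (forall w, 0 <= T w)%E ->
  measurable_fun setT T -> measurable_fun setT (fun w : paths => at_time X (T w) w : bC).
Proof.
move=> T0 mT _ B mB; rewrite setTI nat_ooE.
apply: (at_time_measurable_oo hp) => //.
- exact: smallest_sigma_algebra.
- by move=> s A s0 mA; apply: natural_preimage => //=; rewrite in_itv /= s0.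
- move=> s s0; rewrite -nat_ooE.
  have -> : [set w | (T w <= s%:E)%E] = T @^-1` `]-oo, s%:E].
    by apply/seteqP; split => w; rewrite /= in_itv.
  rewrite -[X in measurable X]setTI; apply: mT => //; exact: emeasurable_itv.
Qed.

(** The only way for [open_exit] to fall short of the exit time: every [inner U n] has been left,
    and yet at the supremum of these exit times the path is in [U]. *)
Definition bad U : set Omega := [set w | (Some @` U) (at_time X (open_exit U w) w)].

Lemma bad_natural U : open U -> nat_oo (bad U).
Proof.
move=> oU; rewrite -nat_ooE.
have mU : measurable (Some @` U : set bC) by apply: measurable_Some_image; exact: open_borel.
have := measurable_at_time (open_exit_ge0 U) (measurable_open_exit U) measurableT mU.
by rewrite setTI.
Qed.

Lemma good_exit U w : ~ bad U w -> open_exit U w = exit_time X U w.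
Proof.
move=> good; apply/eqP; rewrite eq_le open_exit_le /=.
case ES : (open_exit U w) (open_exit_ge0 U w) => [s| |]//; rewrite ?leey // lee_fin => s0.
by apply: exit_time_lb => //; move: good; rewrite /bad /= ES.
Qed.

Lemma inner_exit_homo U w : {homo (fun n => exit_time X (inner U n) w) : m n / (m <= n)%N >-> (m <= n)%E}.
Proof. by move=> m n mn; apply: exit_time_mono; exact: inner_mono. Qed.

Lemma quasi_left_open_exit U x : open U ->
  {ae P x, forall w, (open_exit U w < +oo)%E ->
     at_time X (exit_time X (inner U n) w) w @[n --> \oo] --> at_time X (open_exit U w) w}.
Proof.
move=> oU; apply: (hunt_quasi_left_continuous hp (T_ := fun n => exit_time X (inner U n))) => //.
- by move=> n; apply: (closed_exit_stopping hp); exact: inner_closed.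
- by move=> n w; exact: inner_exit_homo.
Qed.

(** By quasi-left continuity, on a bad path the positions at the exits from [inner U n] converge to
    a point [y] of [U]. Some [inner U m.+1] is a neighbourhood of [y], so for large [n] the exit
    from [inner U n] would take place in its interior, against [exit_time_interior]. *)
Lemma bad_null U : open U -> forall x, P x (bad U) = 0%E.
Proof.
move=> oU x.
have mbad : measurable (bad U) by apply: (natural_measurable hp); exact: bad_natural.
have [N [mN N0 subN]] := quasi_left_open_exit x oU.
apply/eqP; rewrite eq_le measure_ge0 andbT -N0 le_measure ?inE //.
apply: subset_trans subN => w; rewrite /bad /= => -[y Uy yS].
case ES : (open_exit U w) (open_exit_ge0 U w) yS => [s| |]//; rewrite lee_fin => s0 /= yS /(_ (ltry _)).
have [m Um] := inner_cover lc oU Uy.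
have [e e0 eU] := inner_interior Um.
have oB : open (ball y e) by exact: mball_open.
have nb : nbhs (X s w) (Some @` ball y e).
  rewrite -yS; apply: one_point_compactification_some_nbhs; exact: nbhsx_ballx.
move=> /(_ _ nb) [k _ Hk].
have := Hk (maxn k m.+1); rewrite /= leq_maxl => /(_ isT).
have fS : exit_time X (inner U (maxn k m.+1)) w \is a fin_num.
  rewrite ge0_fin_numE ?exit_time_ge0 //; apply: le_lt_trans (open_exit_lb _ _ _) _.
  by rewrite ES ltry.
apply: (exit_time_interior hp fS oB).
by apply: subset_trans eU _; apply: inner_mono; exact: leq_maxr.
Qed.

Lemma exit_time_shift D t w : 0 <= t -> (t%:E <= exit_time X D w)%E ->
  (exit_time X D w = t%:E + exit_time X D (theta t w))%E.
Proof.
move=> t0 tD; apply/eqP; rewrite eq_le; apply/andP; split.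
  rewrite -leeBlDl //; apply: le_ereal_inf_tmp => _ [s [s0 sD] <-].
  rewrite leeBlDl // -EFinD addrC; apply: exit_time_lb; first exact: addr_ge0.
  by rewrite -(shiftE hp).
apply: le_ereal_inf_tmp => _ [s [s0 sD] <-].
have ts : t <= s.
  by rewrite -lee_fin; apply: le_trans tD _; exact: exit_time_lb.
rewrite -leeBrDl // -EFinB; apply: exit_time_lb; first by rewrite subr_ge0.
by rewrite shiftE ?subr_ge0 // subrK.
Qed.

Lemma at_time_shift t (s : \bar R) w : 0 <= t -> (0 <= s)%E ->
  at_time X (t%:E + s)%E w = at_time X s (theta t w).
Proof.
move=> t0; case: s => [s| |]//; rewrite lee_fin => s0 /=.
by rewrite shiftE // addrC.
Qed.

Lemma P_cemetery (y : cemetery E) : {ae P y, forall w, X 0 w = y}.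
Proof.
have my : measurable [set w | X 0 w = y].
  have -> : [set w | X 0 w = y] = X 0 @^-1` [set y] by [].
  rewrite -[X in measurable X]setTI; apply: (measurable_X hp (lexx 0)) => //.
  case: y => [y|]; last exact: measurable_None.
  rewrite (_ : [set Some y] = Some @` [set y]); last by rewrite image_set1.
  apply: measurable_Some_image; apply: closed_borel.
  by apply: accessible_closed_set1; apply: hausdorff_accessible; exact: metric_hausdorff.
exists (~` [set w | X 0 w = y]); split => //; first exact: measurableC.
by rewrite probability_setC // (hunt_normal hp) subee.
Qed.

End open_exit.

(** * Harmonic measure and mean exit time *)

Section exit_operators.
Context {R : realType} {E : pmetricType R} {d : measure_display}
  {Omega : measurableType d} (X : R -> Omega -> cemetery E)
  (P : cemetery E -> probability Omega R) (hp : hunt_process X P)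
  (lc : locally_compact [set: E]).

Local Notation nat_oo := (natural X `[0, +oo[).
Local Notation bC := (borel (cemetery E)).
Local Notation paths := (g_sigma_algebraType nat_oo).
Local Notation theta := (shift hp).
Local Notation S := (open_exit X).
Implicit Types (U V : set E) (w : Omega) (g : E -> \bar R) (x : cemetery E).

(** The harmonic measure of [U] applied to [g]. Taking [open_exit] keeps the integrand measurable
    for the natural sigma-algebra, as [strong_markov] demands. *)
Definition hit U g x : \bar R := (\int[P x]_w ext g (at_time X (S U w) w))%E.
Definition mean_exit U x : \bar R := (\int[P x]_w S U w)%E.

Lemma measurable_exit_value (T : paths -> \bar R) g : (forall w, 0 <= T w)%E ->
  measurable_fun setT T -> measurable_fun setT (g : borel E -> \bar R) ->
  measurable_fun setT (fun w : paths => ext g (at_time X (T w) w)).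
Proof.
move=> T0 mT mg.
exact: (measurableT_comp (measurable_ext mg) (measurable_at_time hp T0 mT)).
Qed.

Lemma measurable_open_exit_value U g : measurable_fun setT (g : borel E -> \bar R) ->
  measurable_fun setT (fun w : paths => ext g (at_time X (S U w) w)).
Proof.
move=> mg; apply: measurable_exit_value => //; first exact: open_exit_ge0.
exact: (measurable_open_exit hp).
Qed.

Lemma ae_good U x : open U -> {ae P x, forall w, ~ bad X U w}.
Proof.
move=> oU; exists (bad X U); split => //; last by move=> w /= /contrapT.
  by apply: (natural_measurable hp); exact: (bad_natural hp).
exact: (bad_null hp lc).
Qed.

(** [bad] is null from every starting point, hence by the Markov property also for the path
    restarted at [T]. *)
Lemma ae_good_shift U T x : open U -> stopping_time X P T ->
  {ae P x, forall w, (T w < +oo)%E -> ~ bad X U (shift_at hp T w)}.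
Proof.
move=> oU sT.
have [_ SM] := markov_natural hp (bad_natural hp oU).
exists ((setT `&` [set w | (T w < +oo)%E]) `&` shift_at hp T @^-1` bad X U); split.
- apply: measurableI.
    by rewrite setTI; exact: (stopping_finite_measurable hp).
  rewrite -[X in measurable X]setTI; apply: (measurable_shift_at hp sT) => //.
  by rewrite nat_ooE; exact: (bad_natural hp).
- rewrite SM //; last exact: stoppedT.
  by apply: integral0_eq => w _; exact: (bad_null hp lc).
- by move=> w /= /not_implyP[Tw /contrapT bw].
Qed.

Lemma hit_ge0 U g x : (forall y, 0 <= g y)%E -> (0 <= hit U g x)%E.
Proof. by move=> g0; apply: integral_ge0 => w _; exact: ext_ge0. Qed.

Lemma mean_exit_ge0 U x : (0 <= mean_exit U x)%E.
Proof. by apply: integral_ge0 => w _; exact: open_exit_ge0. Qed.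

Lemma measurable_hit U g : (forall y, 0 <= g y)%E ->
  measurable_fun setT (g : borel E -> \bar R) ->
  measurable_fun setT (fun y : borel E => hit U g (Some y)).
Proof.
move=> g0 mg.
have mH : measurable_fun setT (fun y : bC => hit U g y).
  apply: (@measurable_expectation _ _ _ _ _ _ hp (fun w => ext g (at_time X (S U w) w))).
    by move=> w; exact: ext_ge0.
  exact: measurable_open_exit_value.
exact: (measurableT_comp mH measurable_Some).
Qed.

Lemma hit_le U V g1 g2 x : (forall y, 0 <= g1 y)%E ->
  {ae P x, forall w, ext g1 (at_time X (S U w) w) <= ext g2 (at_time X (S V w) w)}%E ->
  (forall y, 0 <= g2 y)%E ->
  measurable_fun setT (g1 : borel E -> \bar R) -> measurable_fun setT (g2 : borel E -> \bar R) ->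
  (hit U g1 x <= hit V g2 x)%E.
Proof.
move=> g10 g12 g20 mg1 mg2; apply: ae_ge0_le_integral => //.
- by move=> w _; exact: ext_ge0.
- by apply: (measurable_paths hp); exact: measurable_open_exit_value.
- by move=> w _; exact: ext_ge0.
- by apply: (measurable_paths hp); exact: measurable_open_exit_value.
- by apply: filterS g12 => w H _.
Qed.

Lemma hit_mono U g1 g2 x : open U -> (forall y, 0 <= g1 y)%E -> (forall y, 0 <= g2 y)%E ->
  measurable_fun setT (g1 : borel E -> \bar R) -> measurable_fun setT (g2 : borel E -> \bar R) ->
  (forall y, ~ U y -> g1 y <= g2 y)%E ->
  (hit U g1 x <= hit U g2 x)%E.
Proof.
move=> oU g10 g20 mg1 mg2 g12; apply: hit_le => //.
apply: filterS (ae_good x oU) => w; rewrite /bad /=.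
case: at_time => //= y nb; apply: g12 => Uy; apply: nb; exists y => //.
Qed.

Lemma hitD U g1 g2 x : (forall y, 0 <= g1 y)%E -> (forall y, 0 <= g2 y)%E ->
  measurable_fun setT (g1 : borel E -> \bar R) -> measurable_fun setT (g2 : borel E -> \bar R) ->
  hit U (fun y => g1 y + g2 y)%E x = (hit U g1 x + hit U g2 x)%E.
Proof.
move=> g10 g20 mg1 mg2; rewrite /hit -ge0_integralD //.
- by apply: eq_integral => w _; case: at_time => //=; rewrite adde0.
- by move=> w _; exact: ext_ge0.
- by apply: (measurable_paths hp); exact: measurable_open_exit_value.
- by move=> w _; exact: ext_ge0.
- by apply: (measurable_paths hp); exact: measurable_open_exit_value.
Qed.

Lemma hitZ U g k x : (0 <= k)%R -> (forall y, 0 <= g y)%E ->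
  measurable_fun setT (g : borel E -> \bar R) ->
  hit U (fun y => k%:E * g y)%E x = (k%:E * hit U g x)%E.
Proof.
move=> k0 g0 mg; rewrite /hit -ge0_integralZl_EFin //.
- by apply: eq_integral => w _; case: at_time => //=; rewrite mule0.
- by move=> w _; exact: ext_ge0.
- by apply: (measurable_paths hp); exact: measurable_open_exit_value.
Qed.

Lemma hit_cst1 U x : (hit U (cst 1) x <= 1)%E.
Proof.
apply: (@le_trans _ _ (\int[P x]_w (cst 1 w)))%E; last first.
  by rewrite integral_cst // mul1e; exact: probability_le1.
apply: ge0_integral_le => w _.
  by apply: ext_ge0 => z; rewrite /= lee_fin ler01.
by case: (at_time X (S U w) w) => [z|] /=; rewrite lee_fin ?lexx ?ler01.
Qed.

Lemma open_exit0 U w : ~ (Some @` U) (X 0 w) -> S U w = 0%E.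
Proof.
move=> H; apply/eqP; rewrite eq_le open_exit_ge0 andbT.
by apply: le_trans (open_exit_le X U w) _; rewrite exit_time0.
Qed.

Lemma hit_out U g (y : cemetery E) : (forall z, 0 <= g z)%E ->
  measurable_fun setT (g : borel E -> \bar R) ->
  ~ (Some @` U) y -> hit U g y = ext g y.
Proof.
move=> g0 mg Uy.
transitivity (\int[P y]_w (cst (ext g y) w))%E; last first.
  by rewrite integral_cst // [X in (_ * X)%E](_ : _ = 1%E) ?mule1 //; exact: probability_setT.
apply: ge0_ae_eq_integral => //.
- by apply: (measurable_paths hp); exact: measurable_open_exit_value.
- by move=> w _; exact: ext_ge0.
- by move=> w _; exact: ext_ge0.
- by apply: filterS (P_cemetery hp y) => w Xw _; rewrite open_exit0 /= Xw.
Qed.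

Lemma mean_exit_mono U V x : U `<=` V -> (mean_exit U x <= mean_exit V x)%E.
Proof.
move=> UV; apply: ge0_integral_le => w _; first exact: open_exit_ge0.
exact: open_exit_mono.
Qed.

(** Additivity under shifts holds for [exit_time]; it passes to [open_exit] when neither the path
    nor its shift is bad. *)
Lemma open_exit_value_shift U t w : 0 <= t -> (t%:E <= S U w)%E ->
  ~ bad X U w -> ~ bad X U (theta t w) ->
  S U w = (t%:E + S U (theta t w))%E /\
  at_time X (S U w) w = at_time X (S U (theta t w)) (theta t w).
Proof.
move=> t0 tS gw gtw.
have SE : S U w = (t%:E + S U (theta t w))%E.
  rewrite (good_exit gw) (good_exit gtw); apply: exit_time_shift => //.
  by rewrite -(good_exit gw).
by split => //; rewrite [in LHS]SE (at_time_shift hp) // open_exit_ge0.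
Qed.

(** The strong Markov property at [T]. Where [T] is infinite so is [open_exit], and both integrands
    vanish because the position is the cemetery. *)
Lemma hit_stopping U T g x : open U -> stopping_time X P T ->
  (forall w, T w <= S U w)%E -> (forall z, 0 <= g z)%E ->
  measurable_fun setT (g : borel E -> \bar R) ->
  hit U g x = (\int[P x]_w ext (fun y => hit U g (Some y)) (at_time X (T w) w))%E.
Proof.
move=> oU sT TS g0 mg.
pose F w := ext g (at_time X (S U w) w).
have F0 w : (0 <= F w)%E by exact: ext_ge0.
have mF : measurable_fun setT (F : paths -> \bar R) by exact: measurable_open_exit_value.
pose D := setT `&` [set w | (T w < +oo)%E].
have mD : measurable D by rewrite /D setTI; exact: (stopping_finite_measurable hp).
transitivity (\int[P x]_(w in D) F w)%E.
  rewrite [RHS]integral_mkcond; apply: eq_integral => w _; rewrite /patch.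
  case: ifPn => // /negP; rewrite inE /D setTI /= => /negP; rewrite -leNgt leye_eq => /eqP Ty.
  by rewrite /F; have := TS w; rewrite Ty leye_eq => /eqP ->.
transitivity (\int[P x]_(w in D) F (shift_at hp T w))%E.
  apply: ge0_ae_eq_integral => //.
  - by apply: measurable_funTS; exact: (measurable_paths hp).
  - apply: measurable_funTS.
    exact: (measurableT_comp mF (measurable_shift_at hp sT)).
  apply: filterS2 (ae_good x oU) (ae_good_shift x oU sT) => w gw gsw [_ /= Tw].
  have := gsw Tw; move: Tw; rewrite /F /shift_at.
  case ET : (T w) (sT.1 w) => [t| |]//; rewrite lee_fin => t0 _ gtw.
  have tS : (t%:E <= S U w)%E by rewrite -ET; exact: TS.
  by have [_ ->] := open_exit_value_shift t0 tS gw gtw.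
rewrite (strong_markov hp x sT (stoppedT sT)) // [LHS]integral_mkcond.
apply: eq_integral => w _; rewrite /patch.
case: ifPn => [_|/negP]; last first.
  by rewrite inE /D setTI /= => /negP; rewrite -leNgt leye_eq => /eqP ->.
case: at_time => //=; apply: hit_out => //; by case.
Qed.

Lemma hit_hit U V g x : open U -> open V -> V `<=` U -> (forall z, 0 <= g z)%E ->
  measurable_fun setT (g : borel E -> \bar R) ->
  hit V (fun y => hit U g (Some y)) x = hit U g x.
Proof.
move=> oU oV VU g0 mg; rewrite [RHS](hit_stopping (T := S V)) //.
- exact: (open_exit_stopping hp).
- by move=> w; exact: open_exit_mono.
Qed.

(** (EP) speaks of [exit_time], the strong Markov arguments of [open_exit]; the two events differ by
    a null set. *)
Lemma exit_time_ball_lt (z : E) r t x : 0 < r ->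
  measurable [set w | (exit_time X (ball z r) w < t%:E)%E] /\
  P x [set w | (exit_time X (ball z r) w < t%:E)%E] =
  P x [set w | (S (ball z r) w < t%:E)%E].
Proof.
move=> r0; have oB : open (ball z r) by exact: mball_open.
have mA := open_exit_lt_natural hp (ball z r) t.
have AA' : [set w | (S (ball z r) w < t%:E)%E] `\` bad X (ball z r) =
    [set w | (exit_time X (ball z r) w < t%:E)%E] `\` bad X (ball z r).
  by apply/seteqP; split => w [/= St gw]; split => //=; move: St; rewrite (good_exit gw).
have [mA' E'] := ae_eq_measurable hp (bad_natural hp oB) (bad_null hp lc oB) mA AA'.
by split => //; rewrite E'.
Qed.

End exit_operators.

(** * Mean exit times and jumps *)

Lemma esum_le_single (R : realType) (T : choiceType) (I : set T) (a : T -> \bar R) (s : T) :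
  (forall t, 0 <= a t)%E -> (forall t, I t -> t <> s -> a t = 0%E) ->
  (\esum_(t in I) a t <= a s)%E.
Proof.
move=> a0 Ia; rewrite -(esum_set1 (a0 s)) (esum_mkcond I) (esum_mkcond [set s]).
apply: le_esum => t _; case: ifPn => [/set_mem It|_]; last by case: ifPn.
case: ifPn => [//|/negP]; rewrite inE /= => ts.
by rewrite Ia.
Qed.

Section levy.
Context {R : realType} {E : pmetricType R} {d : measure_display}
  {Omega : measurableType d} (X : R -> Omega -> cemetery E)
  (P : cemetery E -> probability Omega R) (J : R.-ker (borel E) ~> (borel E))
  (hp : hunt_process X P) (lc : locally_compact [set: E]) (hJ : levy_system X P J).

Local Notation S := (open_exit X).
Local Notation leb := (@lebesgue_measure R).

(** The factor [\1_A] keeps only jumps that start in [A], so the kernel has to be controlled on [A]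
    only. *)
Definition jump_weight (A : set E) (g : E -> R) (z : R * borel E * borel E) : R :=
  \1_A z.1.2 * g z.2.

Lemma measurable_jump_weight (A : set E) (g : E -> R) :
  measurable (A : set (borel E)) -> measurable_fun setT (g : borel E -> R) ->
  measurable_fun setT (jump_weight A g).
Proof.
move=> mA mg; apply: measurable_funM.
  apply: (@measurableT_comp _ _ _ _ _ _ (\1_A : borel E -> R) _ (fun z => z.1.2)).
    exact: measurable_indic.
  exact: (measurableT_comp measurable_snd measurable_fst).
exact: (measurableT_comp mg measurable_snd).
Qed.

Lemma jump_weight_in A g s (y z : E) : A y -> jump_weight A g (s, y, z) = g z.
Proof. by move=> Ay; rewrite /jump_weight /= indicE mem_set // mul1r. Qed.

Lemma jump_weight_out A g s (y z : E) : ~ A y -> jump_weight A g (s, y, z) = 0.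
Proof. by move=> Ay; rewrite /jump_weight /= indicE memNset // mul0r. Qed.

Definition jump_sum A g (T : Omega -> \bar R) w : \bar R :=
  (\esum_(s in [set s : R | (0 < s)%R /\ s%:E <= T w])
        (if left_limit X s w is Some y then
           if X s w is Some z then (jump_weight A g (s, y, z))%:E else 0
         else 0))%E.

Definition jump_compensator A g (T : Omega -> \bar R) w : \bar R :=
  (\int[lebesgue_measure]_(s in [set s : R | (0 <= s)%R /\ s%:E <= T w])
        (if X s w is Some y then \int[J y]_z (jump_weight A g (s, y, z))%:E else 0))%E.

Lemma jump_sum_ge0 A g T w : (forall z, 0 <= g z) -> (0 <= jump_sum A g T w)%E.
Proof.
move=> g0; apply: esum_ge0 => s _; case: left_limit => // y; case: (X s w) => // z.
by rewrite lee_fin mulr_ge0.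
Qed.

Lemma levy_jump A g T (x : E) : measurable (A : set (borel E)) ->
  measurable_fun setT (g : borel E -> R) -> (forall z, 0 <= g z) ->
  (forall z, A z -> g z = 0) -> stopping_time X P T ->
  (\int[P (Some x)]_w jump_sum A g T w = \int[P (Some x)]_w jump_compensator A g T w)%E.
Proof.
move=> mA mg g0 gA sT; apply: hJ => //.
- exact: measurable_jump_weight.
- by move=> z; rewrite mulr_ge0.
- move=> s y; rewrite /jump_weight /= indicE.
  by case: (boolP (y \in A)) => [/set_mem /gA ->|_]; rewrite ?mulr0 ?mul0r.
Qed.

Let kernel_ge0 A g (s : R) (w : Omega) : (forall z, 0 <= g z) ->
  (0 <= if X s w is Some y then \int[J y]_z (jump_weight A g (s, y, z))%:E else 0)%E.
Proof.
move=> g0; case: (X s w) => // y; apply: integral_ge0 => z _.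
by rewrite lee_fin mulr_ge0.
Qed.

(** Before [T] the path is known to be in the set, at [T] it need not be, while the compensator
    includes the time [T]. Both time sets have Lebesgue measure [T], hence this lemma and the
    next. *)
Lemma lebesgue_time_co (T : \bar R) : (0 <= T)%E ->
  measurable [set s : R | (0 <= s)%R /\ (s%:E < T)%E] /\
  leb [set s : R | (0 <= s)%R /\ (s%:E < T)%E] = T.
Proof.
case: T => [t| |]// t0.
  rewrite (_ : [set _ | _] = `[0, t[%classic).
    split; first exact: measurable_itv.
    rewrite lebesgue_measure_itv /= lte_fin sube0.
    by move: t0; rewrite lee_fin le_eqVlt => /predU1P[<-|->]; rewrite ?ltxx.
  by apply/seteqP; split => s /=; rewrite in_itv /= lte_fin; [case=> -> -> //|by case/andP].
rewrite (_ : [set _ | _] = `[0, +oo[%classic).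
  by split; [exact: measurable_itv|rewrite lebesgue_measure_itv /= ltry].
by apply/seteqP; split => s /=; rewrite in_itv /= ltry andbT; [case|].
Qed.

Lemma lebesgue_time_cc (T : \bar R) : (0 <= T)%E ->
  measurable [set s : R | (0 <= s)%R /\ (s%:E <= T)%E] /\
  leb [set s : R | (0 <= s)%R /\ (s%:E <= T)%E] = T.
Proof.
case: T => [t| |]// t0.
  rewrite (_ : [set _ | _] = `[0, t]%classic).
    split; first exact: measurable_itv.
    rewrite lebesgue_measure_itv /= lte_fin sube0.
    by move: t0; rewrite lee_fin le_eqVlt => /predU1P[<-|->]; rewrite ?ltxx.
  by apply/seteqP; split => s /=; rewrite in_itv /= lee_fin; [case=> -> -> //|by case/andP].
rewrite (_ : [set _ | _] = `[0, +oo[%classic).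
  by split; [exact: measurable_itv|rewrite lebesgue_measure_itv /= ltry].
by apply/seteqP; split => s /=; rewrite in_itv /= leey andbT; [case|].
Qed.

Lemma compensator_ge A g (T : Omega -> \bar R) (a : R) w : (0 <= T w)%E -> 0 <= a ->
  (forall z, 0 <= g z) ->
  (forall s, 0 <= s -> (s%:E < T w)%E -> (Some @` A) (X s w)) ->
  (forall y, A y -> a%:E <= \int[J y]_z (g z)%:E)%E ->
  (a%:E * T w <= jump_compensator A g T w)%E.
Proof.
move=> T0 a0 g0 TA aA; have [mD lD] := lebesgue_time_co T0.
rewrite -[in leLHS]lD -integral_cst //.
apply: (@le_trans _ _ (\int[leb]_(s in [set s : R | (0 <= s)%R /\ (s%:E < T w)%E])
  (if X s w is Some y then \int[J y]_z (jump_weight A g (s, y, z))%:E else 0))%E).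
  apply: ge0_integral_le => s [s0 sT]; first by rewrite lee_fin.
  have [y Ay <-] := TA s s0 sT.
  apply: le_trans (aA _ Ay) _; apply: ge0_integral_le => z _; rewrite lee_fin //.
  by rewrite jump_weight_in.
rewrite /jump_compensator [leLHS]integral_mkcond [leRHS]integral_mkcond.
apply: ge0_integral_le => s _; rewrite /patch.
  by case: ifPn => // _; exact: kernel_ge0.
case: ifPn => [/set_mem [s0 sT]|_].
  by rewrite mem_set //; split => //; exact: ltW.
by case: ifPn => // _; exact: kernel_ge0.
Qed.

Lemma compensator_le A g (T : Omega -> \bar R) (b : R) w : (0 <= T w)%E -> 0 <= b ->
  (forall z, 0 <= g z) ->
  (forall y, A y -> \int[J y]_z (g z)%:E <= b%:E)%E ->
  (jump_compensator A g T w <= b%:E * T w)%E.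
Proof.
move=> T0 b0 g0 bA; have [mD lD] := lebesgue_time_cc T0.
rewrite -[in leRHS]lD -integral_cst //.
apply: ge0_integral_le => s _; first exact: kernel_ge0.
case: (X s w) => [y|]; last by rewrite lee_fin.
have [Ay|Ay] := pselect (A y).
  apply: le_trans (bA y Ay); apply: ge0_integral_le => z _; rewrite lee_fin ?mulr_ge0 //.
  by rewrite jump_weight_in.
rewrite integral0_eq ?lee_fin // => z _.
by rewrite jump_weight_out.
Qed.

(** As [g] vanishes on [A], a jump landing in [A] does not count, so only the one at time [T] itself
    can. *)
Lemma jump_sum_le A g (T : Omega -> \bar R) w :
  (forall z, 0 <= g z) -> (forall z, A z -> g z = 0) ->
  (forall s, 0 <= s -> (s%:E < T w)%E -> (Some @` A) (X s w)) ->
  (jump_sum A g T w <= ext (EFin \o g) (at_time X (T w) w))%E.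
Proof.
move=> g0 gA TA; rewrite /jump_sum.
set a := (X in (\esum_(s in _) X s <= _)%E).
have a0 s : (0 <= a s)%E.
  rewrite /a; case: left_limit => // y; case: (X s w) => // z.
  by rewrite lee_fin mulr_ge0.
have az s : 0 <= s -> (s%:E < T w)%E -> a s = 0%E.
  move=> s0 /(TA s s0)[z Az Xz]; rewrite /a -Xz; case: left_limit => // y.
  by rewrite /jump_weight /= gA // mulr0.
have ET0 : (0 <= ext (EFin \o g) (at_time X (T w) w))%E.
  by apply: ext_ge0 => z; rewrite lee_fin.
case ET : (T w) => [t| |].
- apply: le_trans (esum_le_single (s := t) a0 _) _.
    move=> s [s0]; rewrite lee_fin => st nst; apply: az; first exact: ltW.
    by rewrite ET lte_fin lt_neqAle st andbT; exact/eqP.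
  rewrite /a /=; case: left_limit => [y|]; last by move: ET0; rewrite ET.
  case: (X t w) => //= z; rewrite lee_fin /jump_weight /= indicE.
  by case: (_ \in _); rewrite ?mul1r ?mul0r.
- rewrite esum1 // => s [s0 _]; apply: az; [exact: ltW|by rewrite ET ltry].
- rewrite (_ : [set s | _] = set0) ?esum_set0 //.
  by apply/seteqP; split => s //= [].
Qed.

(** Only the lower bound comes directly: an exit whose left limit is outside [U] contributes to
    [hit] but not to the jump sum. *)
Lemma levy_exit_ge (U : set E) (g : E -> R) (a : R) (x : E) : open U -> 0 <= a ->
  measurable_fun setT (g : borel E -> R) -> (forall z, 0 <= g z) ->
  (forall z, U z -> g z = 0) ->
  (forall y, U y -> a%:E <= \int[J y]_z (g z)%:E)%E ->
  (a%:E * mean_exit X P U (Some x) <= hit X P U (EFin \o g) (Some x))%E.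
Proof.
move=> oU a0 mg g0 gU aU.
have mU : measurable (U : set (borel E)) by exact: open_borel.
rewrite /mean_exit -ge0_integralZl_EFin //; last 2 first.
- by move=> w _; exact: open_exit_ge0.
- by apply: (measurable_paths hp); exact: (measurable_open_exit hp).
apply: (@le_trans _ _ (\int[P (Some x)]_w jump_compensator U g (S U) w)%E).
  apply: ge0_integral_le => w _.
    by rewrite mule_ge0 // ?lee_fin // open_exit_ge0.
  apply: compensator_ge => //; first exact: open_exit_ge0.
  by move=> s; exact: before_open_exit.
rewrite -levy_jump //; last exact: (open_exit_stopping hp).
apply: ge0_integral_le => w _; first exact: jump_sum_ge0.
by apply: jump_sum_le => // s; exact: before_open_exit.
Qed.

Lemma some_compact_closed (K : set E) : compact K -> closed (Some @` K : set (cemetery E)).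
Proof.
move=> cK; apply: compact_closed.
  by apply: one_point_compactification_hausdorff => //; exact: metric_hausdorff.
apply: continuous_compact => //; apply: continuous_subspaceT.
exact: one_point_compactification_some_continuous.
Qed.

(** A compact set is closed in the compactification, so the left limit at a positive exit time is in
    [K] and the whole exit value is counted as a jump out of [K]. For a merely closed set the left
    limit might be the cemetery. *)
Lemma levy_compact_exit_le (K : set E) (g : E -> R) (b : R) (x : E) : compact K -> 0 <= b ->
  measurable_fun setT (g : borel E -> R) -> (forall z, 0 <= g z) ->
  (forall z, K z -> g z = 0) -> K x ->
  (forall y, K y -> \int[J y]_z (g z)%:E <= b%:E)%E ->
  (\int[P (Some x)]_w ext (EFin \o g) (at_time X (exit_time X K w) w) <=
   b%:E * \int[P (Some x)]_w exit_time X K w)%E.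
Proof.
move=> cK b0 mg g0 gK Kx bK.
have clK : closed K by apply: compact_closed => //; exact: metric_hausdorff.
have mK : measurable (K : set (borel E)) by exact: closed_borel.
pose F w := ext (EFin \o g) (at_time X (exit_time X K w) w).
have F0 w : (0 <= F w)%E by apply: ext_ge0 => z; rewrite lee_fin.
have mF : measurable_fun setT F.
  apply: (measurable_paths hp); apply: (measurable_exit_value hp) => //.
  - by move=> w; exact: exit_time_ge0.
  - exact: (measurable_closed_exit hp).
  - exact/measurable_EFinP.
rewrite -ge0_integralZl_EFin //; last 2 first.
- by move=> w _; exact: exit_time_ge0.
- by apply: (measurable_paths hp); exact: (measurable_closed_exit hp).
(* Restricting to paths that start at [x] settles an immediate exit: its value is [g x], which is
   0. *)
pose G := F \_ [set w | X 0 w = Some x].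
have mS : measurable [set w | X 0 w = Some x].
  have -> : [set w | X 0 w = Some x] = X 0 @^-1` (Some @` [set x]).
    by apply/seteqP; split => w /=; [move=> ->; exists x|case=> _ -> <-].
  rewrite -[X in measurable X]setTI; apply: (measurable_X hp (lexx 0)) => //.
  apply: measurable_Some_image; apply: closed_borel.
  by apply: accessible_closed_set1; apply: hausdorff_accessible; exact: metric_hausdorff.
have -> : (\int[P (Some x)]_w F w = \int[P (Some x)]_w G w)%E.
  apply: ge0_ae_eq_integral => //.
  - by apply: (measurable_restrictT _ mS).1; exact: measurable_funTS.
  - by move=> w _; rewrite /G /patch; case: ifPn.
  - by apply: filterS (P_cemetery hp (Some x)) => w Xw _; rewrite /G /patch mem_set.
apply: (@le_trans _ _ (\int[P (Some x)]_w jump_compensator K g (exit_time X K) w)%E); last first.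
  apply: ge0_integral_le => w _; first by apply: integral_ge0 => s _; exact: kernel_ge0.
  by apply: compensator_le => //; exact: exit_time_ge0.
rewrite -levy_jump //; last exact: (closed_exit_stopping hp).
apply: ge0_integral_le => w _; rewrite /G /patch; first by case: ifPn.
case: ifPn => [/set_mem /= X0|_]; last exact: jump_sum_ge0.
rewrite /F; case ET : (exit_time X K w) (exit_time_ge0 X K w) => [t| |]//.
  rewrite lee_fin le_eqVlt => /predU1P[<-|t0]; rewrite /=.
    by rewrite X0 /= gK //; exact: jump_sum_ge0.
  have [y Ky yl] : (Some @` K) (left_limit X t w).
    have /cvg_ex [l cl] := @hunt_left_limits _ _ _ _ _ _ hp w t t0.
    have hC : hausdorff_space (cemetery E).
      by apply: one_point_compactification_hausdorff => //; exact: metric_hausdorff.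
    rewrite /left_limit (cvg_lim hC cl).
    apply: (closed_cvg _ (some_compact_closed cK) _ l cl).
    near=> s; apply: before_exit; first by near: s; exact: nbhs_left_ge.
    by rewrite ET lte_fin; near: s; exact: nbhs_left_lt.
  apply: esum_ge; exists [set t].
    by split => [|s ->]; [exact: finite_set1|rewrite /= ET].
  rewrite fsbig_set1 -yl; case: (X t w) => //= z.
  by rewrite jump_weight_in.
by move=> _; exact: jump_sum_ge0.
Unshelve. all: by end_near. Qed.

End levy.

Lemma ereal_rat_between_oo (R : realType) (x y : \bar R) : (0 <= x)%E -> (x < y)%E ->
  exists q : rat, [/\ 0 <= (ratr q : R), (x <= (ratr q)%:E)%E & ((ratr q)%:E < y)%E].
Proof.
move=> x0 xy.
suff [s xs sy] : exists2 s : R, (x < s%:E)%E & (s%:E <= y)%E.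
  have [q [xq qs]] := ereal_rat_between x0 xs.
  exists q; split; last by apply: lt_le_trans sy; rewrite lte_fin.
    by rewrite -lee_fin; apply: le_trans x0 (ltW xq).
  exact: ltW.
case: x y x0 xy => [x| |] [y| |]// x0 xy; first by exists y.
by exists (x + 1); rewrite ?leey // lte_fin ltrDl.
Qed.

(** * Exit from a closed set, cut at the exit from another closed set *)

Section ikeda_watanabe.
Context {R : realType} {E : pmetricType R} {d : measure_display}
  {Omega : measurableType d} (X : R -> Omega -> cemetery E)
  (P : cemetery E -> probability Omega R) (J : R.-ker (borel E) ~> (borel E))
  (hp : hunt_process X P) (lc : locally_compact [set: E]) (hJ : levy_system X P J).

Local Notation nat_oo := (natural X `[0, +oo[).
Local Notation bC := (borel (cemetery E)).
Local Notation paths := (g_sigma_algebraType nat_oo).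

Lemma stopped_lt (T1 T2 : Omega -> \bar R) : stopping_time X P T1 -> stopping_time X P T2 ->
  stopped_sigma_algebra X P T1 [set w | (T1 w < T2 w)%E].
Proof.
move=> [T10 F1] [_ F2].
have Q w : (T1 w < T2 w)%E <-> exists q : rat, [/\ 0 <= (ratr q : R), (T1 w <= (ratr q)%:E)%E &
    ((ratr q)%:E < T2 w)%E].
  by split => [/(ereal_rat_between_oo (T10 w))//|[q [_ Tq qT]]]; exact: le_lt_trans Tq qT.
have mA I : @measurable _ (g_sigma_algebraType (augmented X P I)) = augmented X P I.
  by apply: sigma_algebra_gE; exact: augmented_sigma_algebra.
have mq (I : set R) (q : rat) : (0 <= (ratr q : R)) -> `[0, (ratr q : R)] `<=` I ->
    augmented X P I ([set w | (T1 w <= (ratr q)%:E)%E] `&` ~` [set w | (T2 w <= (ratr q)%:E)%E]).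
  move=> q0 qI; rewrite -mA; apply: measurableI; last apply: measurableC; rewrite mA.
    exact: (augmented_mono qI (F1 _ q0)).
  exact: (augmented_mono qI (F2 _ q0)).
split.
  rewrite (_ : [set w | (T1 w < T2 w)%E] = \bigcup_(q in [set q : rat | 0 <= (ratr q : R)])
     ([set w | (T1 w <= (ratr q)%:E)%E] `&` ~` [set w | (T2 w <= (ratr q)%:E)%E])).
    rewrite bigcup_mkcond -mA; apply: bigcupT_measurable_rat => q.
    case: ifPn => [/set_mem q0|_]; last exact: measurable0.
    rewrite mA; apply: mq => // s /=; rewrite !in_itv /= => /andP[->] //.
  apply/seteqP; split => w /=.
    by move/Q => [q [q0 Tq qT]]; exists q => //; split => //=; apply/negP; rewrite -ltNge.
  by move=> [q q0 [Tq /= /negP]]; rewrite -ltNge => qT; apply/Q; exists q.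
move=> t t0.
rewrite (_ : _ `&` _ = ([set w | (T1 w <= t%:E)%E] `&` ~` [set w | (T2 w <= t%:E)%E]) `|`
   \bigcup_(q in [set q : rat | 0 <= (ratr q : R) <= t])
     ([set w | (T1 w <= (ratr q)%:E)%E] `&` ~` [set w | (T2 w <= (ratr q)%:E)%E])).
  rewrite -mA; apply: measurableU.
    apply: measurableI; last apply: measurableC; rewrite mA; [exact: F1|exact: F2].
  rewrite bigcup_mkcond; apply: bigcupT_measurable_rat => q.
  case: ifPn => [/set_mem /andP[q0 qt]|_]; last exact: measurable0.
  rewrite mA; apply: mq => // s /=; rewrite !in_itv /= => /andP[-> /= sq].
  exact: le_trans sq qt.
apply/seteqP; split => w /=.
  move=> [/Q[q [q0 Tq qT]] Tt].
  (* If the separating rational time lies beyond [t], then [t] itself separates. *)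
  have [qt|qt] := leP (ratr q) t.
    by right; exists q => /=; rewrite ?q0 //; split => //=; apply/negP; rewrite -ltNge.
  left; split => //; apply/negP; rewrite -ltNge; apply: lt_trans qT.
  by rewrite lte_fin.
case=> [[Tt /negP]|[q /andP[q0 qt] [Tq /= /negP]]]; rewrite -ltNge => tT.
  by split => //; exact: le_lt_trans Tt tT.
split; first exact: le_lt_trans Tq tT.
by apply: le_trans Tq _; rewrite lee_fin.
Qed.

Lemma exit_timeI (A B : set E) w :
  (Order.min (exit_time X A w) (exit_time X B w) <= exit_time X (A `&` B) w)%E.
Proof.
apply: le_ereal_inf_tmp => _ [s [s0 sAB] <-]; rewrite ge_min.
apply/orP; have [[y Ay yX]|sA] := pselect ((Some @` A) (X s w)); last first.
  by left; exact: exit_time_lb.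
right; apply: exit_time_lb => // -[z Bz zX]; apply: sAB; exists y => //; split => //.
by move: zX; rewrite -yX => -[<-].
Qed.

Definition closed_hit (K : set E) (g : E -> R) (z : cemetery E) : \bar R :=
  (\int[P z]_w ext (EFin \o g) (at_time X (exit_time X K w) w))%E.

Definition closed_mean (K : set E) (z : cemetery E) : \bar R :=
  (\int[P z]_w exit_time X K w)%E.

(** On [A] the path leaves [F] while still in [K] and is restarted there; off [A] the exits from [K]
    and from the intersection coincide. For the values there is only an inequality, since the exit
    value of the intersection is counted on [A] as well. *)
Lemma closed_exit_decomposition (K F : set E) (g : E -> R) (x : E) :
  closed K -> closed F -> measurable_fun setT (g : borel E -> R) -> (forall z, 0 <= g z) ->
  let T := exit_time X F in
  let A := [set w | (T w < exit_time X K w)%E] in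
  [/\ measurable A,
    (closed_hit K g (Some x) <= closed_hit (K `&` F) g (Some x) +
      \int[P (Some x)]_(w in A) closed_hit K g (at_time X (T w) w))%E,
    (closed_mean K (Some x) = closed_mean (K `&` F) (Some x) +
      \int[P (Some x)]_(w in A) closed_mean K (at_time X (T w) w))%E &
    measurable_fun setT (fun w => closed_mean K (at_time X (T w) w))].
Proof.
move=> cK cF mg g0 T A.
have sT : stopping_time X P T by exact: (closed_exit_stopping hp).
have sK := closed_exit_stopping hp cK.
have cKF : closed (K `&` F) by exact: closedI.
have GA := stopped_lt sT sK.
have mA : measurable A by exact: (stopped_measurable hp GA).
have AT : A `&` [set w | (T w < +oo)%E] = A.
  by apply/seteqP; split => w [] //= TK; split => //; apply: lt_le_trans TK (leey _).
have mgE : measurable_fun setT (EFin \o (g : borel E -> R)) by exact/measurable_EFinP.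
have value_meas (L : set E) : closed L ->
    measurable_fun setT (fun w : paths => ext (EFin \o g) (at_time X (exit_time X L w) w)).
  move=> cL; apply: (measurable_exit_value hp) => //; first by move=> w; exact: exit_time_ge0.
  exact: (measurable_closed_exit hp).
have g0E z : (0 <= (EFin \o g) z)%E by rewrite lee_fin.
have shiftA w : A w ->
    exit_time X K w = (T w + exit_time X K (shift_at hp T w))%E /\
    at_time X (exit_time X K w) w =
    at_time X (exit_time X K (shift_at hp T w)) (shift_at hp T w).
  rewrite /A /= /shift_at; case ET : (T w) (sT.1 w) => [t| |]//; last by move=> _; rewrite ltNge leey.
  rewrite lee_fin => t0 tK; have E1 := exit_time_shift hp t0 (ltW tK).
  by split => //; rewrite [in LHS]E1 (at_time_shift hp) // exit_time_ge0.
have KF_notA w : ~ A w -> exit_time X (K `&` F) w = exit_time X K w.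
  move=> /negP; rewrite -leNgt => KT; apply/eqP; rewrite eq_le exit_time_mono //=.
  by have := exit_timeI K F w; rewrite min_l.
have KF_A w : A w -> exit_time X (K `&` F) w = T w.
  move=> /ltW KT; apply/eqP; rewrite eq_le; apply/andP; split; first exact: exit_time_mono.
  by have := exit_timeI K F w; rewrite min_r.
split => //.
- pose Fu w := ext (EFin \o g) (at_time X (exit_time X K w) w).
  have mFu : measurable_fun setT (Fu : paths -> \bar R) by exact: value_meas.
  have <- : (\int[P (Some x)]_(w in A) Fu w =
      \int[P (Some x)]_(w in A) closed_hit K g (at_time X (T w) w))%E.
    transitivity (\int[P (Some x)]_(w in A) Fu (shift_at hp T w))%E.
      by apply: eq_integral => w /set_mem /shiftA [_ E1]; rewrite /Fu E1.
    rewrite -AT (strong_markov hp (Some x) sT GA) // => w; exact: ext_ge0.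
  rewrite [X in (_ + X)%E]integral_mkcond -ge0_integralD //.
  + apply: ge0_integral_le => w _; first exact: ext_ge0.
    rewrite /patch; case: ifPn => [_|/negP]; first by rewrite leeDr // ext_ge0.
    by rewrite inE => nA; rewrite adde0 KF_notA.
  + by move=> w _; exact: ext_ge0.
  + by apply: (measurable_paths hp); exact: value_meas.
  + by move=> w _; rewrite /patch; case: ifPn => // _; exact: ext_ge0.
  + apply: (measurable_restrictT _ mA).1; apply: measurable_funTS.
    exact: (measurable_paths hp).
- pose Fv w := exit_time X K w.
  have mFv : measurable_fun setT (Fv : paths -> \bar R) by exact: (measurable_closed_exit hp).
  have <- : (\int[P (Some x)]_(w in A) Fv (shift_at hp T w) =
      \int[P (Some x)]_(w in A) closed_mean K (at_time X (T w) w))%E.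
    rewrite -AT (strong_markov hp (Some x) sT GA) // => w; exact: exit_time_ge0.
  rewrite [X in (_ + X)%E]integral_mkcond -ge0_integralD //.
  + apply: eq_integral => w _; rewrite /patch; case: ifPn => [/set_mem Aw|/negP].
      by rewrite KF_A // (shiftA w Aw).1.
    by rewrite inE => nA; rewrite adde0 KF_notA.
  + by move=> w _; exact: exit_time_ge0.
  + by apply: (measurable_paths hp); exact: (measurable_closed_exit hp).
  + by move=> w _; rewrite /patch; case: ifPn => // _; exact: exit_time_ge0.
  + apply: (measurable_restrictT _ mA).1; apply: measurable_funTS.
    exact: (measurableT_comp mFv (measurable_shift_at hp sT)).
- have mE : measurable_fun setT (fun y : bC => closed_mean K y).
    apply: (@measurable_expectation _ _ _ _ _ _ hp (exit_time X K)).
      by move=> w; exact: exit_time_ge0.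
    exact: (measurable_closed_exit hp).
  exact: (measurableT_comp mE (at_time_measurable_fun hp sT)).
Qed.

End ikeda_watanabe.

Lemma markov_time d (T : measurableType d) (R : realType) (mu : {measure set T -> \bar R})
    (f : T -> \bar R) (t : R) (B : set T) : measurable B -> 0 <= t ->
  (forall w, 0 <= f w)%E -> (forall w, B w -> t%:E <= f w)%E ->
  (t%:E * mu B <= \int[mu]_w f w)%E.
Proof.
move=> mB t0 f0 fB; rewrite -integral_cst //= [leLHS]integral_mkcond.
apply: ge0_integral_le => w _; rewrite /patch; case: ifPn => //.
by move=> /set_mem; exact: fB.
Qed.

Lemma limn_einf_ge0 (R : realType) (u : (\bar R)^nat) :
  (forall n, 0 <= u n)%E -> (0 <= limn_einf u)%E.
Proof.
move=> u0; rewrite limn_einf_lim; apply: lime_ge; first exact: is_cvg_einfs.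
by near=> n; apply: le_ereal_inf_tmp => _ [m _ <-].
Unshelve. all: by end_near. Qed.

(** * Upper bound of exit values by mean exit times *)

Section ikeda_watanabe_upper.
Context {R : realType} {E : pmetricType R} {d : measure_display}
  {Omega : measurableType d} (X : R -> Omega -> cemetery E)
  (P : cemetery E -> probability Omega R) (J : R.-ker (borel E) ~> (borel E))
  (hp : hunt_process X P) (lc : locally_compact [set: E]) (hJ : levy_system X P J).

Local Notation S := (open_exit X).

Lemma closed_exit_lt_measurable (K : set E) t : closed K ->
  measurable [set w | (exit_time X K w < t%:E)%E].
Proof.
move=> cK; have -> : [set w | (exit_time X K w < t%:E)%E] = exit_time X K @^-1` `]-oo, t%:E[.
  by apply/seteqP; split => w; rewrite /= in_itv.
rewrite -[X in measurable X]setTI; apply: (measurable_paths hp (measurable_closed_exit hp cK)) => //.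
exact: emeasurable_itv.
Qed.

(* The path stays in a small ball up to time [t] with probability 3/4, so that the
   spare term [eta * mean] absorbs part of the error [m]. *)
Lemma iw_step (K : set E) (g : E -> R) (b eta m e t : R) (x : E) :
  closed K -> K x -> compact (cball x e) -> 0 < e -> 0 < t ->
  (P (Some x) [set w | (exit_time X (ball x e) w < t%:E)%E] <= (4^-1)%:E)%E ->
  measurable_fun setT (g : borel E -> R) -> (forall z, 0 <= g z) ->
  (forall z, K z -> g z = 0) -> 0 <= b -> 0 <= eta -> 0 <= m ->
  (forall y, K y -> \int[J y]_z (g z)%:E <= b%:E)%E ->
  (forall y, K y -> closed_hit X P K g (Some y) <=
     (b + eta)%:E * closed_mean X P K (Some y) + m%:E)%E ->
  (closed_hit X P K g (Some x) <= (b + eta)%:E * closed_mean X P K (Some x) +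
     (Num.max (m / 2) (m - eta * t / 4))%:E)%E.
Proof.
move=> cK Kx ccb e0 t0 Pt mg g0 gK b0 eta0 m0 bK IH.
have cF := @cball_closed R E x e.
have [mA Hu Hv mv] := closed_exit_decomposition hp x cK cF mg g0.
move: mA Hu Hv mv; set T := exit_time X (cball x e); set A := [set w | _] => mA Hu Hv mv.
set p := P (Some x) A; set I := (\int[P (Some x)]_(w in A) closed_mean X P K (at_time X (T w) w))%E in Hv.
set s := closed_mean X P (K `&` cball x e) (Some x) in Hv.
have cKF : compact (K `&` cball x e) by apply: subclosed_compact ccb _ => [|y []//]; exact: closedI.
have xF : cball x e x by rewrite /cball /= mdistxx ltW.
have v0 z : (0 <= closed_mean X P K z)%E by apply: integral_ge0 => w _; exact: exit_time_ge0.
have s0 : (0 <= s)%E by apply: integral_ge0 => w _; exact: exit_time_ge0.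
have I0 : (0 <= I)%E by apply: integral_ge0.
have p0 : (0 <= p)%E by exact: measure_ge0.
have be0 : 0 <= b + eta by rewrite addr_ge0.
have Hs : (closed_hit X P (K `&` cball x e) g (Some x) <= b%:E * s)%E.
  apply: (levy_compact_exit_le hp lc hJ) => //.
    by move=> z [Kz _]; exact: gK.
  by move=> y [Ky _]; exact: bK.
have HI : (\int[P (Some x)]_(w in A) closed_hit X P K g (at_time X (T w) w) <=
    (b + eta)%:E * I + m%:E * p)%E.
  rewrite /I /p -ge0_integralZl_EFin //; last exact: measurable_funTS.
  rewrite -integral_cst //= -ge0_integralD //; last 2 first.
  - by move=> w _; rewrite mule_ge0 // lee_fin.
  - by apply: measurable_funeM; exact: measurable_funTS.
  apply: ge0_integral_le => w Aw.
    by apply: integral_ge0 => w' _; apply: ext_ge0 => z; rewrite lee_fin.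
  have : (T w < exit_time X K w)%E by [].
  case ET : (T w) (exit_time_ge0 X (cball x e) w) => [u| |]; rewrite -/T ET //.
    rewrite lee_fin => u0 /(before_exit u0)[y Ky yX].
    by rewrite /= -yX; exact: IH.
  by move=> _; rewrite ltNge leey.
have Hm : (m%:E * p <= eta%:E * s + (Num.max (m / 2) (m - eta * t / 4))%:E)%E.
  have pfin : p \is a fin_num by rewrite fin_num_measure.
  have p1 : (p <= 1)%E by exact: probability_le1.
  move: p0 p1; rewrite -(fineK pfin); set q := fine p; rewrite !lee_fin => q0 q1.
  (* If [A] has probability at most 1/2, the error is halved. Otherwise, with probability at least
     1/4, the path leaves neither [K] nor the ball before time [t]; then [s] is at least [t / 4] and
     the spare term gains [eta * t / 4]. *)
  have [q2|q2] := leP q 2^-1.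
    apply: (@le_trans _ _ (m / 2)%:E); first by rewrite -EFinM lee_fin ler_wpM2l.
    apply: (@le_trans _ _ (Num.max (m / 2) (m - eta * t / 4))%:E).
      by rewrite lee_fin le_max lexx.
    by rewrite leeDr // mule_ge0 // lee_fin.
  pose B := A `\` [set w | (T w < t%:E)%E].
  have mTt : measurable [set w | (T w < t%:E)%E] by exact: closed_exit_lt_measurable.
  have mB : measurable B by exact: measurableD.
  have PT : (P (Some x) [set w | (T w < t%:E)%E] <= (4^-1)%:E)%E.
    apply: le_trans Pt; apply: le_measure; rewrite ?inE //.
      by have [] := exit_time_ball_lt hp lc x t (Some x) e0.
    move=> w /=; apply: le_lt_trans; apply: exit_time_mono => y; rewrite ballE /cball /=.
    exact: ltW.
  have PB : (4^-1%:E <= P (Some x) B)%E.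
    have pE : (p = P (Some x) B + P (Some x) (A `&` [set w | (T w < t%:E)%E]))%E.
      exact: measureDI.
    have PI : (P (Some x) (A `&` [set w | (T w < t%:E)%E]) <= (4^-1)%:E)%E.
      by apply: le_trans PT; apply: le_measure; rewrite ?inE //; exact: measurableI.
    have : (q%:E <= P (Some x) B + (4^-1)%:E)%E.
      by rewrite /q fineK // pE leeD2l.
    have Bfin : P (Some x) B \is a fin_num by rewrite fin_num_measure.
    rewrite -(fineK Bfin) -EFinD !lee_fin; lra.
  have sB : ((t / 4)%:E <= s)%E.
    apply: (@le_trans _ _ (t%:E * P (Some x) B)%E).
      by rewrite EFinM lee_pmul2l // ?lte_fin.
    apply: markov_time => //; first exact: ltW.
      by move=> w; exact: exit_time_ge0.
    move=> w [Aw /negP]; rewrite -leNgt => tT.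
    apply: le_trans (exit_timeI X K (cball x e) w).
    by rewrite le_min tT andbT; apply: le_trans tT (ltW Aw).
  apply: (@le_trans _ _ (eta%:E * (t / 4)%:E + (m - eta * t / 4)%:E)%E).
    rewrite -!EFinM -EFinD lee_fin mulrA [leRHS]addrC subrK.
    by rewrite ler_piMr.
  apply: leeD; first by rewrite lee_wpmul2l // lee_fin.
  by rewrite lee_fin le_max lexx orbT.
apply: le_trans Hu _; rewrite Hv ge0_muleDr // EFinD ge0_muleDl ?lee_fin //.
apply: le_trans (leeD Hs HI) _.
rewrite -EFinD; set c := ((b + eta)%:E * I)%E.
rewrite [leRHS](_ : _ = (b%:E * s + (c + (eta%:E * s + (Num.max (m / 2) (m - eta * t / 4))%:E)))%E).
  by apply: leeD => //; exact: leeD.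
by rewrite -!addeA; congr (_ + _)%E; rewrite addeCA.
Qed.

Hypothesis hEP : forall e0 : R, 0 < e0 -> exists e t : R, [/\ 0 < e, e < e0, 0 < t &
  forall y : E, (P (Some y) [set w | (exit_time X (ball y e) w < t%:E)%E] <= (4^-1)%:E)%E].

(** With [b + eta] instead of [b] the bound holds up to an additive error, for instance [M]. By
    [iw_step] the infimum of the admissible errors could be lowered if it were positive, so it is 0.
    Then [eta] tends to 0; an infinite mean exit time makes the claim trivial, as [b] is
    positive. *)
Lemma iw_closed (K : set E) (g : E -> R) (b e0 M : R) :
  closed K -> 0 < e0 -> (forall y e, K y -> 0 < e -> e < e0 -> compact (cball y e)) ->
  measurable_fun setT (g : borel E -> R) -> (forall z, 0 <= g z) -> (forall z, g z <= M) ->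
  (forall z, K z -> g z = 0) -> 0 < b ->
  (forall y, K y -> \int[J y]_z (g z)%:E <= b%:E)%E ->
  forall x, K x -> (closed_hit X P K g (Some x) <= b%:E * closed_mean X P K (Some x))%E.
Proof.
move=> cK e00 ccb mg g0 gM gK b0 bK.
have [e [t [ep ee0 t0 Pt]]] := hEP e00.
have v0 z : (0 <= closed_mean X P K z)%E by apply: integral_ge0 => w _; exact: exit_time_ge0.
have H eta : 0 < eta -> forall x, K x ->
    (closed_hit X P K g (Some x) <= (b + eta)%:E * closed_mean X P K (Some x))%E.
  move=> eta0.
  pose Q m := 0 <= m /\ forall y, K y -> (closed_hit X P K g (Some y) <=
     (b + eta)%:E * closed_mean X P K (Some y) + m%:E)%E.
  have be0 : 0 <= b + eta by rewrite addr_ge0 // ltW.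
  have M0 : 0 <= M by exact: le_trans (g0 point) (gM point).
  have QM : Q M.
    split => // y Ky; apply: (@le_trans _ _ M%:E); last first.
      by rewrite leeDr // mule_ge0 // lee_fin.
    apply: (@le_trans _ _ (\int[P (Some y)]_w (cst M%:E w))%E); last first.
      rewrite integral_cst //; rewrite -[leRHS]mule1; apply: lee_wpmul2l.
        by rewrite lee_fin.
      exact: probability_le1.
    apply: ge0_integral_le => w _.
      by apply: ext_ge0 => z; rewrite lee_fin.
    by case: (at_time X _ w) => [z|] /=; rewrite lee_fin.
  pose i := inf Q.
  have hasQ : has_inf Q by split; [exists M|exists 0 => m []].
  have i0 : 0 <= i by apply: lb_le_inf; [exists M|move=> m []].
  have Qi : Q i.
    split => // y Ky; apply/lee_addgt0Pr => a a0.
    have [m Qm mi] := inf_adherent a0 hasQ.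
    apply: le_trans (Qm.2 y Ky) _; rewrite -addeA -EFinD leeD2l // lee_fin; exact: ltW.
  suff i_eq0 : i = 0 by move=> x Kx; have := Qi.2 x Kx; rewrite i_eq0 adde0.
  apply/eqP; rewrite eq_le i0 andbT leNgt; apply/negP => ipos.
  pose i' := Num.max (i / 2) (i - eta * t / 4).
  have Qi' : Q i'.
    split; first by rewrite /i' le_max divr_ge0.
    move=> y Ky; apply: (iw_step (e := e)) => //; [exact: ccb|exact: ltW|exact: ltW|exact: Qi.2].
  have : i <= i' by apply: ge_inf => //; exists 0 => m [].
  rewrite leNgt => /negP; apply; rewrite /i' gt_max; apply/andP; split; first lra.
  by rewrite gtrBl; rewrite divr_gt0 // mulr_gt0.
move=> x Kx; have vx0 := v0 (Some x).
case Ev : (closed_mean X P K (Some x)) vx0 => [v| |]//; last first.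
  by move=> _; rewrite gt0_muley ?lte_fin // leey.
rewrite lee_fin => vr0; apply/lee_addgt0Pr => a a0.
have v1 : 0 < v + 1 by lra.
have := H (a / (v + 1)) (divr_gt0 a0 v1) x Kx; rewrite Ev => /le_trans; apply.
rewrite -!EFinM -EFinD lee_fin mulrDl lerD2l -mulrA ler_piMr ?ltW //.
by rewrite mulrC ltr_pdivrMr // mul1r; lra.
Qed.

(** If the exit from [U] lands in [O], quasi-left continuity puts the exits from [inner U n] in [O]
    too for large [n]; as [O] is disjoint from [U], these already are the exit from [U]. The exit
    values are thus eventually constant, and Fatou's lemma transports the bound of [iw_closed]. *)
Lemma levy_exit_le (U O : set E) (g : E -> R) (b M : R) (x : E) : open U -> open O ->
  U `&` O = set0 -> (forall z, ~ O z -> g z = 0) ->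
  measurable_fun setT (g : borel E -> R) -> (forall z, 0 <= g z) -> (forall z, g z <= M) ->
  0 < b -> (forall y, U y -> \int[J y]_z (g z)%:E <= b%:E)%E -> U x ->
  (hit X P U (EFin \o g) (Some x) <= b%:E * mean_exit X P U (Some x))%E.
Proof.
move=> oU oO UO gO mg g0 gM b0 bU Ux.
have UOn z : U z -> ~ O z by move=> Uz Oz; have : (U `&` O) z by []; rewrite UO.
have gU z : U z -> g z = 0 by move=> /UOn; exact: gO.
have [n0 xn0] := inner_cover lc oU Ux.
pose F n w := ext (EFin \o g) (at_time X (exit_time X (inner U n) w) w).
have F0 n w : (0 <= F n w)%E by apply: ext_ge0 => z; rewrite lee_fin.
have mF n : measurable_fun setT (F n).
  apply: (measurable_paths hp); apply: (measurable_exit_value hp) => //.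
  - by move=> w; exact: exit_time_ge0.
  - by apply: (measurable_closed_exit hp); exact: inner_closed.
  - exact/measurable_EFinP.
apply: (@le_trans _ _ (\int[P (Some x)]_w limn_einf (F^~ w))%E).
  apply: ae_ge0_le_integral => //.
  - by move=> w _; apply: ext_ge0 => z; rewrite lee_fin.
  - apply: (measurable_paths hp); apply: (measurable_open_exit_value hp).
    exact/measurable_EFinP.
  - by move=> w _; apply: limn_einf_ge0 => n; exact: F0.
  - rewrite /limn_einf; apply: measurableT_comp => //.
    by apply: measurable_fun_limn_esup => n; exact: measurableT_comp.
  apply: filterS (quasi_left_open_exit hp (Some x) oU) => w QL _.
  case EX : (at_time X (S U w) w) => [z|]; last first.
    by apply: limn_einf_ge0 => n; exact: F0.
  have [Oz|nOz] := pselect (O z); last first.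
    by rewrite /= gO //; apply: limn_einf_ge0 => n; exact: F0.
  have Sfin : (S U w < +oo)%E by move: EX; case: (S U w) => [s| |]//; rewrite ltry.
  have nb : nbhs (at_time X (S U w) w) (Some @` O).
    rewrite EX; apply: one_point_compactification_some_nbhs; exact: open_nbhs_nbhs.
  have near_eq : \forall n \near \oo, F n w = ext (EFin \o g) (Some z).
    have [k _ Hk] := QL Sfin _ nb; exists k => // n kn.
    have [y Oy yX] := Hk n kn.
    rewrite /= /F; suff -> : exit_time X (inner U n) w = S U w by rewrite EX.
    apply/eqP; rewrite eq_le open_exit_lb leNgt; apply/negP => nS.
    have := exit_time_ge0 X (inner U n) w; move: nS yX.
    case: exit_time => [s| |]//= sS yX; rewrite lee_fin => s0.
    have [u Uu uX] := before_open_exit s0 sS.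
    by apply: (UOn u) => //; move: uX; rewrite -yX => -[->].
  have cv : F^~ w @ \oo --> ext (EFin \o g) (Some z) by exact: cvg_near_cst.
  by rewrite (cvg_limn_einf_sup cv).1.
apply: le_trans (fatou _ _ _ _) _ => //.
rewrite limn_einf_lim.
apply: lime_le; first by apply: is_cvg_einfs.
near=> n.
apply: (@le_trans _ _ (\int[P (Some x)]_w F n w)%E).
  by apply: ereal_inf_lbound; exists n => /=.
have xn : inner U n x by apply: (inner_mono (m := n0)) => //; near: n; exact: nbhs_infty_ge.
apply: (@le_trans _ _ (b%:E * closed_mean X P (inner U n) (Some x))%E).
  apply: (@iw_closed _ _ _ n.+1%:R^-1 M) => //.
  - exact: inner_closed.
  - by move=> y e Ky e0 en; have [] := Ky e e0 en.
  - by move=> z /inner_sub /gU.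
  - by move=> y /inner_sub /bU.
apply: lee_wpmul2l; first by rewrite lee_fin ltW.
apply: ge0_integral_le => w _; first exact: exit_time_ge0.
exact: open_exit_lb.
Unshelve. all: by end_near. Qed.

End ikeda_watanabe_upper.

(** * Exit from balls *)

Section scale.
Context {R : realType} (phi : R -> R) (c beta : R).
Hypotheses (hphi : scale_function phi) (hgrow : growth_bound phi c beta).

Lemma scale_gt0 r : 0 < r -> 0 < phi r.
Proof. by move=> r0; rewrite -(scale0 hphi); apply: (scale_increasing hphi). Qed.

Lemma scale_le r s : 0 <= r -> r <= s -> phi r <= phi s.
Proof.
move=> r0; rewrite le_eqVlt => /predU1P[->//|rs]; apply: ltW.
exact: (scale_increasing hphi).
Qed.

Lemma scale_growth r k : 0 < r -> 1 <= k -> phi (k * r) <= c * k `^ beta * phi r.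
Proof.
move=> r0 k1; rewrite -ler_pdivrMr ?scale_gt0 //.
have rk : r <= k * r by rewrite ler_peMl // ltW.
by apply: le_trans (hgrow r0 rk) _; rewrite mulfK // gt_eqF.
Qed.

End scale.

Lemma mule_combination (R : realType) (p k1 k2 : R) (x y : \bar R) :
  0 <= k1 -> 0 <= k2 -> (0 <= x)%E -> (0 <= y)%E ->
  (p%:E * (k1%:E * x + k2%:E * y) = (p * k1)%:E * x + (p * k2)%:E * y)%E.
Proof.
by move=> k10 k20 x0 y0; rewrite ge0_muleDr ?mule_ge0 ?lee_fin // !muleA -!EFinM.
Qed.

Section exit_estimates.
Context {R : realType} {E : pmetricType R} {d : measure_display}
  {Omega : measurableType d} (X : R -> Omega -> cemetery E)
  (P : cemetery E -> probability Omega R) (J : R.-ker (borel E) ~> (borel E))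
  (hp : hunt_process X P) (lc : locally_compact [set: E]) (hJ : levy_system X P J)
  (phi : R -> R) (c beta C4 C5 C6 : R) (rbar r0 : \bar R).
Hypotheses (hphi : scale_function phi) (hgrow : growth_bound phi c beta)
  (C6_gt0 : 0 < C6) (r00 : (0 < r0)%E) (hEP : EP X P phi r0 C6)
  (C5_gt0 : 0 < C5) (c1 : 1 <= c) (hJt : Jt J phi rbar C4 C5).

Local Notation S := (open_exit X).
Local Notation nat_oo := (natural X `[0, +oo[).
Local Notation paths := (g_sigma_algebraType nat_oo).
Implicit Types (U A : set E) (x y : E).

Lemma small_time_exit (e0 : R) : 0 < e0 -> exists e t : R, [/\ 0 < e, e < e0, 0 < t &
  forall y : E, (P (Some y) [set w | (exit_time X (ball y e) w < t%:E)%E] <= (4^-1)%:E)%E].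
Proof.
move=> e00.
have [e [ep ee0 er0]] : exists e : R, [/\ 0 < e, e < e0 & (e%:E < r0)%E].
  move: r00; case: r0 => [r| |]//; rewrite ?lte_fin => rp.
    exists (Num.min e0 r / 2).
    have : 0 < Num.min e0 r by rewrite lt_min e00.
    have : Num.min e0 r <= e0 by rewrite ge_min lexx.
    have : Num.min e0 r <= r by rewrite ge_min lexx orbT.
    rewrite lte_fin; move: (Num.min e0 r) => m mr me m0; split; lra.
  by exists (e0 / 2); rewrite ltry; split => //; lra.
have pe := scale_gt0 hphi ep.
(* With this [t] the bound [C6 * t / phi e] of (EP) equals 1/4. *)
exists e, (phi e / (4 * C6)); split => //; first by rewrite divr_gt0 // mulr_gt0.
move=> y; apply: le_trans (hEP _ _ ep er0) _; first by rewrite divr_gt0 // mulr_gt0.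
rewrite lee_fin le_eqVlt; apply/orP; left; apply/eqP.
by field; rewrite !gt_eqF.
Qed.

Lemma jump_far x r (B : set (borel E)) : 0 < r -> (r%:E < rbar)%E -> measurable B ->
  B `<=` ~` ball x r -> (J x B <= (C5 / phi r)%:E)%E.
Proof.
move=> rp rb mB BB; have /andP[_] := hJt x rp rb; apply: le_trans.
apply: le_measure; rewrite ?inE //.
by apply: measurableC; apply: open_borel; exact: mball_open.
Qed.

Lemma mball_borel x r : measurable (ball x r : set (borel E)).
Proof. by apply: open_borel; exact: mball_open. Qed.

Lemma mball_borelC x r : measurable (~` ball x r : set (borel E)).
Proof. by apply: measurableC; exact: mball_borel. Qed.

Lemma integral_indicE y (B : set (borel E)) : measurable B ->
  (\int[J y]_z (\1_B z)%:E = J y B)%E.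
Proof. by move=> mB; rewrite integral_indic // setIT. Qed.

Lemma hit_indic_le1 U A z : (hit X P U (EFin \o \1_A) z <= 1)%E.
Proof.
apply: le_trans (hit_cst1 X P U z).
apply: ge0_integral_le => w _; first by apply: ext_ge0 => y; rewrite lee_fin.
by case: (at_time X (S U w) w) => //= y; rewrite lee_fin indicE; case: (_ \in _).
Qed.

(** The landing point tells an exit out of the ball from an exit out of [U] inside the ball; only
    the former is meant. *)
Let leave U x s (t : R) : set Omega :=
  [set w | (S (U `&` ball x s) w < t%:E)%E] `&`
  [set w | (Some @` (~` ball x s)) (at_time X (S (U `&` ball x s) w) w)].

Let leave_natural U x s t : nat_oo (leave U x s t).
Proof.
rewrite -nat_ooE; apply: measurableI; first by rewrite nat_ooE; exact: (open_exit_lt_natural hp).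
have mB : measurable (Some @` (~` ball x s) : set (borel (cemetery E))).
  by apply: measurable_Some_image; exact: mball_borelC.
have mS : measurable_fun setT (S (U `&` ball x s) : paths -> \bar R) by exact: (measurable_open_exit hp).
have := measurable_at_time hp (@open_exit_ge0 _ _ _ _ X (U `&` ball x s)) mS measurableT mB.
by rewrite setTI.
Qed.

Let leave_out U x s t (y : cemetery E) : ~ (Some @` (U `&` ball x s)) y ->
  ~ (Some @` (~` ball x s)) y -> P y (leave U x s t) = 0%E.
Proof.
move=> Wy By; have mL := natural_measurable hp (leave_natural U x s t).
have [N [mN N0 NX]] := P_cemetery hp y.
apply/eqP; rewrite eq_le measure_ge0 andbT -N0 le_measure ?inE //.
apply: subset_trans NX => w [_ Lw] /= Xw; apply: By; move: Lw.
by rewrite /= open_exit0 ?Xw //= Xw.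
Qed.

(** A start beyond distance [3 * s / 4] is charged in full. A start in [U] between [s / 2] and
    [3 * s / 4] must leave its own ball of radius [s / 4] before time [t], which (EP) controls. A
    start in the ball but outside [U] exits at once without leaving the ball. *)
Let leave_bound U x s t y : 0 < s -> (s%:E < r0)%E -> 0 < t ->
  ~ (U `&` ball x (s / 2)) y ->
  (P (Some y) (leave U x s t) <= (\1_(~` ball x (3 * s / 4)) y +
     C6 * t / phi (s / 4) * \1_(~` ball x (s / 2)) y)%:E)%E.
Proof.
move=> sp sr tp nW.
have eta0 : 0 <= C6 * t / phi (s / 4).
  by rewrite divr_ge0 ?mulr_ge0 // ltW // (scale_gt0 hphi) // divr_gt0.
have [far|near_] := pselect ((~` ball x (3 * s / 4)) y).
  apply: le_trans (probability_le1 _ _) _; first exact: (natural_measurable hp (leave_natural _ _ _ _)).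
  by rewrite lee_fin indicE mem_set // lerDl mulr_ge0.
rewrite indicE memNset // add0r; move: near_ => /contrapT; rewrite ballE => yn.
have [Uy|nUy] := pselect (U y); last first.
  rewrite leave_out; first by rewrite lee_fin mulr_ge0.
  - by move=> [z [Uz _] [zy]]; apply: nUy; rewrite -zy.
  - by move=> [z Bz [zy]]; apply: Bz; rewrite zy ballE; lra.
have yh : (~` ball x (s / 2)) y by move=> By; exact: nW.
rewrite indicE mem_set // mulr1.
have s40 : 0 < s / 4 by lra.
have s4r : ((s / 4)%:E < r0)%E by apply: le_lt_trans sr; rewrite lee_fin; lra.
apply: le_trans (hEP y tp s40 s4r).
apply: le_measure; rewrite ?inE.
- exact: (natural_measurable hp (leave_natural _ _ _ _)).
- by have [] := exit_time_ball_lt hp lc y t (Some y) s40.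
move=> w [/= St [z Bz zX]]; apply: le_lt_trans St.
move: zX; case ES : (S _ w) (open_exit_ge0 X (U `&` ball x s) w) => [u| |]//.
rewrite lee_fin => u0 /= zX; apply: exit_time_lb => // -[z' Bz' z'X].
move: z'X; rewrite -zX => -[zz]; apply: Bz; rewrite -zz; move: Bz'; rewrite !ballE => Bz'.
have := metric_triangle x y z'; lra.
Qed.

(** The strong Markov property at the exit from the half ball, with [leave_bound] for the restarted
    path. To land beyond [3 * s / 4] takes a jump of length at least [s / 4], hence the rate
    [C5 / phi (s / 4)]. *)
Let leave_step U x s t : open U -> U x -> 0 < s -> (s%:E < r0)%E -> (s%:E < rbar)%E -> 0 < t ->
  (P (Some x) (leave U x s t) <=
   (C5 / phi (s / 4))%:E * mean_exit X P (U `&` ball x (s / 2)) (Some x) +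
   (C6 * t / phi (s / 4))%:E *
     hit X P (U `&` ball x (s / 2)) (EFin \o \1_(~` ball x (s / 2))) (Some x))%E.
Proof.
move=> oU Ux sp sr srb tp.
set W := U `&` ball x s; set W' := U `&` ball x (s / 2); set L := leave U x s t.
have s20 : 0 < s / 2 by lra.
have oW : open W by apply: openI => //; exact: mball_open.
have oW' : open W' by apply: openI => //; exact: mball_open.
have W'W : W' `<=` W by apply: setIS; apply: le_ball; lra.
have W'x : W' x by split => //; exact: ballxx.
pose g1 : E -> R := \1_(~` ball x (3 * s / 4)).
pose g2 : E -> R := \1_(~` ball x (s / 2)).
have mg1 : measurable_fun setT (g1 : borel E -> R).
  by apply: measurable_indic; exact: mball_borelC.
have mg2 : measurable_fun setT (g2 : borel E -> R).
  by apply: measurable_indic; exact: mball_borelC.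
have g10 z : (0 <= (EFin \o g1) z)%E by rewrite lee_fin /g1.
have g20 z : (0 <= (EFin \o g2) z)%E by rewrite lee_fin /g2.
pose eta := C6 * t / phi (s / 4).
have eta0 : 0 <= eta.
  by rewrite divr_ge0 ?mulr_ge0 // ltW // (scale_gt0 hphi) // divr_gt0.
have mL : measurable L by exact: (natural_measurable hp (leave_natural _ _ _ _)).
have sT := open_exit_stopping hp W'.
pose D := setT `&` [set w | (S W' w < +oo)%E].
have mD : measurable D by rewrite /D setTI; exact: (stopping_finite_measurable hp).
have mLs : measurable (shift_at hp (S W') @^-1` L).
  rewrite -[X in measurable X]setTI; apply: (measurable_shift_at hp sT) => //.
  by rewrite nat_ooE; exact: leave_natural.
have [_ SM] := markov_natural hp (leave_natural U x s t).
apply: (@le_trans _ _ (P (Some x) (D `&` shift_at hp (S W') @^-1` L))).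
  have [N [mN N0 NG]] := ae_good hp lc (Some x) oW.
  have [N' [mN' N'0 NG']] := ae_good_shift hp lc (Some x) oW sT.
  have mB : measurable (D `&` shift_at hp (S W') @^-1` L) by exact: measurableI.
  apply: (@le_trans _ _ (P (Some x) ((D `&` shift_at hp (S W') @^-1` L) `|` (N `|` N')))%E).
    apply: le_measure; rewrite ?inE //; first by do !apply: measurableU.
    move=> w Lw; have [Nw|nNw] := pselect (N w); first by right; left.
    have [N'w|nN'w] := pselect (N' w); first by right; right.
    left; have gw : ~ bad X W w by apply: contrapT => b; apply: nNw; exact: NG.
    case: Lw => /= Swt SwB.
    have SSw : (S W' w <= S W w)%E by exact: open_exit_mono.
    have fin : (S W' w < +oo)%E by apply: le_lt_trans SSw (lt_le_trans Swt (leey _)).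
    have gsw : ~ bad X W (shift_at hp (S W') w).
      by apply: contrapT => b; apply: nN'w; apply: NG' => /= H; apply: b => ?; exact: H.
    split; first by split.
    move: gsw; rewrite /L /leave /= /shift_at -/W.
    case ET : (S W' w) (open_exit_ge0 X W' w) fin => [u| |]// u0 _ gsw.
    rewrite lee_fin in u0.
    have uS : (u%:E <= S W w)%E by rewrite -ET.
    have [E1 E2] := open_exit_value_shift u0 uS gw gsw.
    split; last by rewrite -/W -E2.
    apply: le_lt_trans Swt; rewrite -/W E1 leeDr // lee_fin //.
  rewrite measureU0 //; first exact: measurableU.
  apply/eqP; rewrite eq_le measure_ge0 andbT.
  apply: (@le_trans _ _ (P (Some x) N + P (Some x) N')%E); first exact: measureU2.
  by rewrite N0 N'0 adde0.
rewrite SM //; last exact: stoppedT.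
apply: (@le_trans _ _ (\int[P (Some x)]_w
   ext (fun z => (EFin \o g1) z + eta%:E * (EFin \o g2) z)%E (at_time X (S W' w) w))%E).
  rewrite integral_mkcond.
  have sum0 z : (0 <= (EFin \o g1) z + eta%:E * (EFin \o g2) z)%E.
    by rewrite adde_ge0 // mule_ge0 // lee_fin.
  apply: ae_ge0_le_integral => //.
  - by move=> w _; rewrite /patch; case: ifPn.
  - apply: (measurable_restrictT _ mD).1; apply: measurable_funTS.
    exact: (measurableT_comp (markov_natural hp (leave_natural U x s t)).1 (at_time_measurable_fun hp sT)).
  - by move=> w _; exact: ext_ge0.
  - apply: (measurable_paths hp); apply: (measurable_open_exit_value hp).
    by apply: emeasurable_funD; [|apply: measurable_funeM]; exact/measurable_EFinP.
  apply: filterS (ae_good hp lc (Some x) oW') => w gw _.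
  rewrite /patch; case: ifPn => [_|_]; last exact: ext_ge0.
  move: gw; rewrite /bad /=; case: (at_time X (S W' w) w) => [z|] gz /=.
    apply: leave_bound => // Wz; apply: gz; by exists z.
  by rewrite leave_out // => -[].
have m1 : measurable_fun setT ((EFin \o g1) : borel E -> \bar R) by exact/measurable_EFinP.
have m2 : measurable_fun setT ((EFin \o g2) : borel E -> \bar R) by exact/measurable_EFinP.
have m2' : measurable_fun setT ((fun z => eta%:E * (EFin \o g2) z)%E : borel E -> \bar R).
  exact: measurable_funeM.
have g2' z : (0 <= eta%:E * (EFin \o g2) z)%E by rewrite mule_ge0 // lee_fin.
rewrite -/(hit X P W' _ (Some x)) (hitD hp _ _ g10 g2' m1 m2') (hitZ hp) //.
apply: leeD => //.
have bp : 0 < C5 / phi (s / 4) by rewrite divr_gt0 // (scale_gt0 hphi) // divr_gt0.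
apply: (levy_exit_le hp lc hJ small_time_exit (O := ~` cball x (s / 2)) (M := 1)) => //.
- by apply: closed_openC; exact: cball_closed.
- apply/seteqP; split => z //= [[_]]; rewrite ballE => xz; rewrite /cball /= => H; apply: H.
  exact: ltW.
- move=> z /contrapT; rewrite /cball /= => xz; rewrite /g1 indicE memNset // => H; apply: H.
  by rewrite ballE; lra.
- by move=> z; rewrite /g1 indicE; case: (_ \in _).
move=> y [_]; rewrite ballE => xy.
have s40 : 0 < s / 4 by lra.
have mB : measurable (~` ball x (3 * s / 4) : set (borel E)).
  by exact: mball_borelC.
rewrite integral_indicE //; apply: jump_far => //.
  by apply: le_lt_trans srb; rewrite lee_fin; lra.
move=> z xz yz; apply: xz; move: yz; rewrite !ballE => yz.
have := metric_triangle x y z; lra.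
Qed.

(* Makes the last factor in [exit_far_step] equal to [phi (s / 2) / 2]. *)
Definition exit_scale : R := (2 * C6 * (c * 4 `^ beta) * (c * 2 `^ beta))^-1.

(** Each halving of the radius contributes half of this times the mean exit time, weighted by a
    power of 1/2; the factor 2 sums the geometric series. *)
Definition exit_const : R := 2 * (exit_scale^-1 + C5 * (c * 4 `^ beta)).

Let cpow_gt0 k : 0 < k -> 0 < c * k `^ beta.
Proof. by move=> k0; rewrite mulr_gt0 ?powR_gt0 // (lt_le_trans ltr01). Qed.

Let exit_scale_gt0 : 0 < exit_scale.
Proof. by rewrite invr_gt0 !mulr_gt0 ?powR_gt0 // (lt_le_trans ltr01). Qed.

Lemma exit_const_gt0 : 0 < exit_const.
Proof.
apply: mulr_gt0 => //; apply: addr_gt0; first by rewrite invr_gt0 exit_scale_gt0.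
by apply: mulr_gt0 => //; exact: cpow_gt0.
Qed.

(** Split at time [T = exit_scale * phi s]: staying until [T] has probability at most the mean exit
    time over [T], and leaving earlier is [leave_step]. The growth bound compares the scales [s],
    [s / 2] and [s / 4]. *)
Let exit_far_step U x s : open U -> U x -> 0 < s -> (s%:E < r0)%E -> (s%:E < rbar)%E ->
  ((phi s)%:E * hit X P (U `&` ball x s) (EFin \o \1_(~` ball x s)) (Some x) <=
   (exit_const / 2)%:E * mean_exit X P (U `&` ball x s) (Some x) +
   (phi (s / 2) / 2)%:E *
     hit X P (U `&` ball x (s / 2)) (EFin \o \1_(~` ball x (s / 2))) (Some x))%E.
Proof.
move=> oU Ux sp sr srb.
set W := U `&` ball x s; set W' := U `&` ball x (s / 2).
set q' := hit X P W' _ _; set e := mean_exit X P W _; set e' := mean_exit X P W' (Some x).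
have ps : 0 < phi s by exact: (scale_gt0 hphi).
have ps4 : 0 < phi (s / 4) by apply: (scale_gt0 hphi); rewrite divr_gt0.
have ps2 : 0 < phi (s / 2) by apply: (scale_gt0 hphi); rewrite divr_gt0.
have t0 := exit_scale_gt0.
pose T := exit_scale * phi s.
have T0 : 0 < T by rewrite mulr_gt0.
have G4 : phi s <= c * 4 `^ beta * phi (s / 4).
  have := scale_growth hphi hgrow (k := 4) (divr_gt0 sp (ltr0n _ 4)) (ler1n _ 4).
  by rewrite mulrC divfK.
have G2 : phi s <= c * 2 `^ beta * phi (s / 2).
  have := scale_growth hphi hgrow (k := 2) (divr_gt0 sp (ltr0n _ 2)) (ler1n _ 2).
  by rewrite mulrC divfK.
have e0 : (0 <= e)%E by exact: mean_exit_ge0.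
have e'0 : (0 <= e')%E by exact: mean_exit_ge0.
have q'0 : (0 <= q')%E by apply: hit_ge0 => y; rewrite lee_fin.
pose B := ~` [set w | (S W w < T%:E)%E].
have mB : measurable B.
  apply: measurableC; apply: (natural_measurable hp).
  exact: (open_exit_lt_natural hp).
have mL : measurable (leave U x s T) by exact: (natural_measurable hp (leave_natural _ _ _ _)).
have H1 : (hit X P W (EFin \o \1_(~` ball x s)) (Some x) <=
    P (Some x) B + P (Some x) (leave U x s T))%E.
  have IP (A : set Omega) : measurable A -> P (Some x) A = (\int[P (Some x)]_w (\1_A w)%:E)%E.
    by move=> mA; rewrite integral_indic // setIT.
  rewrite (IP _ mB) (IP _ mL).
  rewrite -ge0_integralD //; last 2 first.
  - by apply/measurable_EFinP; exact: measurable_indic.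
  - by apply/measurable_EFinP; exact: measurable_indic.
  apply: ge0_integral_le => w _; first by apply: ext_ge0 => y; rewrite lee_fin.
  case EX : (at_time X (S W w) w) => [y|] /=; last by rewrite -EFinD lee_fin addr_ge0.
  rewrite -EFinD lee_fin indicE; case: (boolP (y \in _)) => [/set_mem By|_]; last by rewrite addr_ge0.
  have [ST|ST] := ltP (S W w) T%:E; last first.
    rewrite (@indicE _ _ B) mem_set ?lerDl //.
    by rewrite /B /=; apply/negP; rewrite -leNgt.
  rewrite (@indicE _ _ (leave U x s T)) mem_set ?lerDr //.
  by split => //=; rewrite -/W EX; exists y.
have H2 : (T%:E * P (Some x) B <= e)%E.
  apply: markov_time => //; [exact: ltW|by move=> w; exact: open_exit_ge0|].
  by move=> w /= /negP; rewrite -leNgt.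
have H3 := leave_step oU Ux sp sr srb T0.
rewrite -/W' -/q' -/e' in H3.
apply: (@le_trans _ _ ((phi s)%:E * (P (Some x) B + P (Some x) (leave U x s T))))%E.
  by apply: lee_wpmul2l => //; rewrite lee_fin ltW.
rewrite ge0_muleDr //.
have A1 : ((phi s)%:E * P (Some x) B <= exit_scale^-1%:E * e)%E.
  have -> : (phi s)%:E = (exit_scale^-1%:E * T%:E)%E.
    by rewrite -EFinM /T mulKf // gt_eqF.
  by rewrite -muleA; apply: lee_wpmul2l => //; rewrite lee_fin invr_ge0 ltW.
have A2 : ((phi s)%:E * P (Some x) (leave U x s T) <=
    (C5 * (c * 4 `^ beta))%:E * e + (phi (s / 2) / 2)%:E * q')%E.
  apply: (@le_trans _ _ ((phi s)%:E * ((C5 / phi (s / 4))%:E * e' + (C6 * T / phi (s / 4))%:E * q')))%E.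
    by apply: lee_wpmul2l => //; rewrite lee_fin ltW.
  have k10 : 0 <= C5 / phi (s / 4) by rewrite divr_ge0 // ltW.
  have k20 : 0 <= C6 * T / phi (s / 4) by rewrite divr_ge0 ?mulr_ge0 // ltW.
  rewrite (mule_combination _ k10 k20 e'0 q'0); apply: leeD.
    apply: (@le_trans _ _ ((C5 * (c * 4 `^ beta))%:E * e')%E).
      apply: lee_wpmul2r; first exact: e'0.
      by rewrite lee_fin mulrCA ler_pM2l // ler_pdivrMr.
    apply: lee_wpmul2l; first by rewrite lee_fin; apply: mulr_ge0; apply: ltW => //; exact: cpow_gt0.
    apply: mean_exit_mono; apply: setIS; apply: le_ball; lra.
  apply: lee_wpmul2r; first exact: q'0.
  rewrite lee_fin.
  have -> : phi s * (C6 * T / phi (s / 4)) = (phi s / phi (s / 4)) * (C6 * exit_scale * phi s).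
    by rewrite /T; field; rewrite gt_eqF.
  have X4 : 0 < c * 4 `^ beta by exact: cpow_gt0.
  have X2 : 0 < c * 2 `^ beta by exact: cpow_gt0.
  apply: (@le_trans _ _ ((c * 4 `^ beta) * (C6 * exit_scale * (c * 2 `^ beta * phi (s / 2))))).
    apply: ler_pM => //; first by rewrite divr_ge0 // ltW.
    - by rewrite !mulr_ge0 // ltW.
    - by rewrite ler_pdivrMr.
    - by rewrite ler_pM2l // mulr_gt0.
  rewrite le_eqVlt; apply/orP; left; apply/eqP; rewrite /exit_scale.
  move: (c * 4 `^ beta) (c * 2 `^ beta) X4 X2 => a b a0 b0.
  by field; rewrite !gt_eqF.
apply: le_trans (leeD A1 A2) _.
have z1 : 0 <= exit_scale^-1 by rewrite invr_ge0 ltW.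
have z2 : 0 <= C5 * (c * 4 `^ beta) by apply: mulr_ge0; apply: ltW => //; exact: cpow_gt0.
rewrite addeA -ge0_muleDl ?lee_fin // -EFinD.
have -> : exit_const / 2 = exit_scale^-1 + C5 * (c * 4 `^ beta) by rewrite /exit_const mulrAC divff // mul1r.
by [].
Qed.

(* Halving the radius costs a factor 1/2 in [phi s * hit ..], so the mean exit
   term is the only one to survive. *)
Lemma exit_far U x s : open U -> U x -> 0 < s -> (s%:E < r0)%E -> (s%:E < rbar)%E ->
  ((phi s)%:E * hit X P (U `&` ball x s) (EFin \o \1_(~` ball x s)) (Some x) <=
   exit_const%:E * mean_exit X P (U `&` ball x s) (Some x))%E.
Proof.
move=> oU Ux sp sr srb.
pose s_ n := s / 2 ^+ n.
pose a n := ((phi (s_ n))%:E * hit X P (U `&` ball x (s_ n)) (EFin \o \1_(~` ball x (s_ n))) (Some x))%E.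
set e := mean_exit X P _ _.
have e0 : (0 <= e)%E by exact: mean_exit_ge0.
have s_gt0 n : 0 < s_ n by rewrite divr_gt0 // exprn_gt0.
have s_le n : s_ n <= s.
  rewrite ler_pdivrMr ?exprn_gt0 //; apply: ler_peMr; first exact: ltW.
  by rewrite exprn_ege1 // ler1n.
have mono n : (mean_exit X P (U `&` ball x (s_ n)) (Some x) <= e)%E.
  by apply: mean_exit_mono; apply: setIS; exact: le_ball.
have cK : 0 <= exit_const by rewrite ltW // exit_const_gt0.
have step n : (a n <= (exit_const / 2)%:E * e + 2^-1%:E * a n.+1)%E.
  have srn : ((s_ n)%:E < r0)%E by apply: le_lt_trans sr; rewrite lee_fin.
  have srbn : ((s_ n)%:E < rbar)%E by apply: le_lt_trans srb; rewrite lee_fin.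
  apply: le_trans (exit_far_step oU Ux (s_gt0 n) srn srbn) _.
  have -> : s_ n / 2 = s_ n.+1 by rewrite /s_ exprSr invfM mulrA.
  apply: leeD; first by apply: lee_wpmul2l; rewrite ?lee_fin ?divr_ge0.
  by rewrite /a muleA -EFinM mulrC.
(* After [n] halvings the remainder is at most [2 ^- n * phi s], because the hitting probability is
   at most 1. *)
have bound n : (a 0%N <= exit_const%:E * e + (2 ^- n * phi s)%:E)%E.
  have H : (a 0%N <= (exit_const * (1 - 2 ^- n))%:E * e + (2 ^- n)%:E * a n)%E.
    elim: n => [|n IH].
      by rewrite expr0 invr1 subrr mulr0 mul0e add0e mul1e.
    have p0 : 0 <= 2 ^- n :> R by rewrite invr_ge0 exprn_ge0.
    have p1 : 2 ^- n <= 1 :> R by rewrite invf_le1 ?exprn_gt0 // exprn_ege1 // ler1n.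
    apply: le_trans IH _.
    apply: le_trans (leeD (le_refl _) (lee_wpmul2l _ (step n))) _; first by rewrite lee_fin.
    have a0 : (0 <= a n.+1)%E.
      apply: mule_ge0; first by rewrite lee_fin ltW // (scale_gt0 hphi).
      by apply: hit_ge0 => y; rewrite lee_fin.
    have k0 : 0 <= exit_const / 2 by rewrite divr_ge0.
    have h0 : 0 <= 2^-1 :> R by rewrite invr_ge0.
    rewrite (mule_combination _ k0 h0 e0 a0) addeA -ge0_muleDl; last 2 first.
    - by rewrite lee_fin mulr_ge0 // subr_ge0.
    - by rewrite lee_fin mulr_ge0.
    rewrite -EFinD exprSr invfM le_eqVlt; apply/orP; left; apply/eqP.
    by congr (_%:E * _ + _)%E; lra.
  apply: le_trans H _; apply: leeD.
    apply: lee_wpmul2r => //; rewrite lee_fin; by apply: ler_piMr => //; rewrite gerBl.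
  rewrite EFinM; apply: lee_wpmul2l; first by rewrite lee_fin invr_ge0 exprn_ge0.
  rewrite /a -[leRHS]mule1; apply: lee_pmul.
  - by rewrite lee_fin ltW // (scale_gt0 hphi).
  - by apply: hit_ge0 => y; rewrite lee_fin.
  - by rewrite lee_fin (scale_le hphi) // ltW.
  - exact: hit_indic_le1.
have -> : ((phi s)%:E * hit X P (U `&` ball x s) (EFin \o \1_(~` ball x s)) (Some x))%E = a 0%N.
  by rewrite /a /s_ expr0 divr1.
apply/lee_addgt0Pr => eps eps0.
have ps : 0 < phi s by exact: (scale_gt0 hphi).
have [n nP] : exists n, 2 ^- n * phi s < eps.
  have [n] := ltr_add_invr (divr_gt0 eps0 ps); rewrite add0r => nP; exists n.
  rewrite -ltr_pdivlMr //; apply: le_lt_trans nP.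
  rewrite lef_pV2 ?posrE ?exprn_gt0 // -natrX ler_nat.
  by rewrite ltn_expl.
by apply: le_trans (bound n) _; rewrite leeD2l // lee_fin ltW.
Qed.

End exit_estimates.

(** * Comparison of jump kernels at different points *)

Section integral_comparison.
Import HBSimple HBNNSimple.

Lemma ge0_le_integral_scaled d (T : measurableType d) (R : realType)
    (m1 m2 : {measure set T -> \bar R}) (B : set T) (k : R) (g : T -> \bar R) :
  0 <= k -> (forall A, measurable A -> A `<=` B -> m1 A <= k%:E * m2 A)%E ->
  (forall z, 0 <= g z)%E -> (forall z, ~ B z -> g z = 0%E) ->
  (\int[m1]_z g z <= k%:E * \int[m2]_z g z)%E.
Proof.
move=> k0 m12 g0 gB; rewrite !ge0_integralTE //.
apply: ge_ereal_sup => _ [h hg <-].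
apply: (@le_trans _ _ (k%:E * sintegral m2 h)%E); last first.
  by apply: lee_wpmul2l; rewrite ?lee_fin //; apply: ereal_sup_ubound; exists h.
rewrite !sintegralE ge0_mule_fsumr; last by move=> x; exact: nnsfun_mulemu_ge0.
apply: lee_fsum => // x _; rewrite muleCA.
have [x0|x0] := ltP 0 x; last first.
  have [xlt|xge] := ltP x 0.
    by rewrite preimage_nnfun0 // !measure0 !mule0.
  have -> : x = 0 by lra.
  by rewrite !mul0e.
apply: lee_wpmul2l; first by rewrite lee_fin ltW.
apply: m12 => // z /= hz; apply: contrapT => /gB gz.
by have := hg z; rewrite gz hz lee_fin leNgt x0.
Qed.

End integral_comparison.

Section kernel_comparison.
Context {R : realType} {E : pmetricType R} (J : R.-ker (borel E) ~> (borel E))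
  (C1 C2 C3 theta C4 C5 : R) (rbar : \bar R).
Hypotheses (C1_gt0 : 0 < C1) (theta_gt0 : 0 < theta) (hJc : Jc J rbar C1 C2 C3 theta).

(** Bounds the factor in (Jc.1): if [mdist x y <= 2 * r] and [delta * r <= mdist x z], then
    [mdist y z / mdist x z] is at most [1 + 2 / delta]. *)
Definition comparison_const (delta : R) : R := C1 * (2 + 2 / delta) `^ theta.

Lemma comparison_const_gt0 delta : 0 < delta -> 0 < comparison_const delta.
Proof. by move=> d0; rewrite mulr_gt0 // powR_gt0 // addr_gt0 // divr_gt0. Qed.

Lemma jump_comparison (x y : E) (r delta : R) (B : set (borel E)) :
  0 < r -> ((2 * r)%:E < rbar)%E -> mdist x y <= 2 * r -> 0 < delta ->
  measurable B -> (forall z, B z -> delta * r <= mdist x z) ->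
  (J x B <= (comparison_const delta)%:E * J y B)%E.
Proof.
move=> r0 rb xy d0 mB Bz.
have xyb : ((mdist x y)%:E < rbar)%E by apply: le_lt_trans rb; rewrite lee_fin.
have [/(_ xyb B mB) H _] := hJc x y.
apply: le_trans H _; rewrite -[leRHS]integral_cst //.
apply: ge0_integral_le => z zB.
  by rewrite lee_fin mulr_ge0 ?powR_ge0 // ltW.
rewrite lee_fin /comparison_const ler_pM2l //.
have xz := Bz z zB; have dr : 0 < delta * r by rewrite mulr_gt0.
have xz0 : 0 < mdist x z by exact: lt_le_trans dr xz.
apply: ge0_ler_powR; rewrite ?nnegrE.
- exact: ltW.
- by rewrite addr_ge0 // divr_ge0 // mdist_ge0.
- by rewrite addr_ge0 // divr_ge0 // ltW.
have : mdist y z <= 2 * r + mdist x z.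
  by have := metric_triangle y x z; rewrite (metric_sym y x); lra.
move=> yz; have : mdist y z / mdist x z <= 1 + 2 / delta; last by lra.
rewrite ler_pdivrMr // mulrDl mul1r addrC.
apply: le_trans yz _; rewrite lerD2r.
by rewrite -mulrA ler_pM2l // ler_pdivlMl.
Qed.

End kernel_comparison.

(** * Decay at the boundary *)

Section boundary_decay.
Context {R : realType} {E : pmetricType R} {d : measure_display}
  {Omega : measurableType d} (X : R -> Omega -> cemetery E)
  (P : cemetery E -> probability Omega R) (J : R.-ker (borel E) ~> (borel E))
  (hp : hunt_process X P) (lc : locally_compact [set: E]) (hJ : levy_system X P J)
  (phi : R -> R) (kappa C1 C2 C3 theta c beta C4 C5 C6 : R) (rbar r0 : \bar R).
Hypotheses (hphi : scale_function phi) (hgrow : growth_bound phi c beta)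
  (kappa_bounds : 0 < kappa < 2)
  (C1_gt0 : 0 < C1) (C2_bounds : 0 < C2 < 1) (C3_gt1 : 1 < C3)
  (theta_gt0 : 0 < theta) (C4_gt0 : 0 < C4) (C5_gt0 : 0 < C5)
  (C6_gt0 : 0 < C6) (c_ge1 : 1 <= c)
  (r00 : (0 < r0)%E) (hJc : Jc J rbar C1 C2 C3 theta)
  (hJt : Jt J phi rbar C4 C5) (hEP : EP X P phi r0 C6).
Variables (D : set E) (r : R) (xi : E).
Hypotheses (oD : open D) (r_gt0 : 0 < r) (r_lt : (r%:E < r0)%E) (r2_lt : ((2 * r)%:E < rbar)%E).
Variables (u : E -> R) (M : R).

Local Notation B rho := (ball xi (rho * r)).
Local Notation H W g x := (hit X P W (EFin \o g) (Some x)).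
Local Notation V W x := (mean_exit X P W (Some x)).
Local Notation k_ n := (kappa + n%:R * ((2 - kappa) / 5)).
Local Notation e := ((2 - kappa) / 5).
Local Notation c0 := (comparison_const C1 theta).
Local Notation measurable_real g := (measurable_fun setT (g : borel E -> R)).

Hypotheses (u0 : forall z, 0 <= u z) (uM : forall z, u z <= M) (mu : measurable_real u)
  (harmonic : forall W z, open W -> W `<=` D `&` B 2 -> H W u z = (u z)%:E)
  (uD : forall z, (B 2 `\` D) z -> u z = 0).

Let e_gt0 : 0 < e.
Proof. by case/andP: kappa_bounds => *; rewrite divr_gt0 // subr_gt0. Qed.

Let e_lt : e < 2 / 5.
Proof. by case/andP: kappa_bounds => *; lra. Qed.

Lemma smaller_radius s : s <= 2 * r -> (s%:E < rbar)%E.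
Proof. by move=> sr; apply: le_lt_trans r2_lt; rewrite lee_fin. Qed.

Definition outside_mass : \bar R := (\int[J xi]_z (u z * \1_(~` B (k_ 2)) z)%:E)%E.

Lemma measurable_ind (A : set (borel E)) : measurable A -> measurable_real (\1_A).
Proof. exact: measurable_indic. Qed.

Lemma measurable_u_ind (A : set (borel E)) : measurable A ->
  measurable_real (fun z => u z * \1_A z).
Proof. by move=> mA; apply: measurable_funM => //; exact: measurable_indic. Qed.

Lemma u_ind_ge0 A z : 0 <= u z * \1_A z.
Proof. by rewrite mulr_ge0. Qed.

Lemma ind01 (A : set E) (z : E) : 0 <= (\1_A z : R) <= 1.
Proof. by rewrite indicE; case: (_ \in _); rewrite /= ?lexx ?ler01. Qed.

Lemma indic_in (A : set E) (z : E) : A z -> \1_A z = 1 :> R.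
Proof. by move=> Az; rewrite indicE mem_set. Qed.

Lemma indic_out (A : set E) (z : E) : ~ A z -> \1_A z = 0 :> R.
Proof. by move=> Az; rewrite indicE memNset. Qed.

Lemma outside_mass_fin : outside_mass \is a fin_num.
Proof.
have k2 : 0 < k_ 2 * r by apply: mulr_gt0 => //; case/andP: kappa_bounds => *; lra.
have M0 : 0 <= M by exact: le_trans (u0 xi) (uM xi).
rewrite ge0_fin_numE; last by apply: integral_ge0 => z _; rewrite lee_fin u_ind_ge0.
apply: (@le_lt_trans _ _ (M%:E * (C5 / phi (k_ 2 * r))%:E)%E); last by rewrite -EFinM ltry.
apply: (@le_trans _ _ (M%:E * J xi (~` B (k_ 2)))%E).
  rewrite -integral_indicE; last exact: mball_borelC.
  rewrite -ge0_integralZl_EFin //; last first.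
    by apply/measurable_EFinP; apply: measurable_indic; exact: mball_borelC.
  apply: ge0_integral_le => z _; rewrite lee_fin ?u_ind_ge0 //.
  by apply: ler_wpM2r.
apply: lee_wpmul2l; first by rewrite lee_fin.
have k2r : k_ 2 * r <= 2 * r by apply: ler_wpM2r; [exact: ltW|case/andP: kappa_bounds => *; lra].
by have /andP[_] := hJt xi k2 (smaller_radius k2r).
Qed.

(** Every point of the ball has distance at least [delta * r] from [A], so its jump rate into [A],
    weighted by [u], is at most [c0 delta] times the one at [xi]. A positive [lam] stands in for
    [outside_mass], which may be 0, because [levy_exit_le] takes a positive rate. *)
Lemma far_part (a x : E) (s delta lam : R) (A : set (borel E)) :
  ball a s `<=` B 2 -> (D `&` ball a s) x -> 0 < delta -> measurable A ->
  A `<=` ~` B (k_ 2) -> (forall z, A z -> s + delta * r <= mdist a z) ->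
  0 < lam -> (outside_mass <= lam%:E)%E ->
  (H (D `&` ball a s) (fun z => u z * \1_A z)%R x <=
   (c0 delta * lam)%:E * V (D `&` ball a s) x)%E.
Proof.
move=> aB Wx d0 mA A2 Aa lam0 Lam.
have dr : 0 < delta * r by rewrite mulr_gt0.
have oW : open (D `&` ball a s) by apply: openI => //; exact: mball_open.
have cg0 : 0 < c0 delta by exact: comparison_const_gt0.
apply: (levy_exit_le hp lc hJ (small_time_exit hphi C6_gt0 r00 hEP)
  (O := ~` cball a s) (M := M)) => //.
- by apply: closed_openC; exact: cball_closed.
- apply/seteqP; split => z //= [[_]]; rewrite ballE => az; rewrite /cball /= => K; apply: K.
  exact: ltW.
- move=> z /contrapT; rewrite /cball /= => az; rewrite indic_out ?mulr0 // => /Aa; lra.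
- exact: measurable_u_ind.
- by move=> z; exact: u_ind_ge0.
- move=> z; have /andP[i0 i1] := ind01 A z; apply: le_trans (uM z).
  by apply: ler_piMr.
- by rewrite mulr_gt0.
move=> y [_ ay]; move: (aB _ ay); rewrite !ballE in ay * => yr.
apply: (@le_trans _ _ ((c0 delta)%:E * \int[J xi]_z (u z * \1_A z)%:E)%E); last first.
  rewrite (EFinM (c0 delta) lam); apply: lee_wpmul2l; first by rewrite lee_fin ltW.
  apply: le_trans Lam; apply: ge0_integral_le => z _; rewrite lee_fin ?u_ind_ge0 //.
  apply: ler_wpM2l => //; have [Az|nAz] := pselect (A z); last first.
    by rewrite [leLHS]indic_out //; have /andP[] := ind01 (~` B (k_ 2)) z.
  by rewrite !indic_in //; exact: A2.
apply: (ge0_le_integral_scaled (B := A)).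
- exact: ltW.
- move=> A' mA' AA'; apply: (jump_comparison C1_gt0 theta_gt0 hJc (r := r)) => //.
    by rewrite (metric_sym y xi) ltW.
  move=> z /AA' /Aa az; have := metric_triangle a y z; lra.
- by move=> z; rewrite lee_fin u_ind_ge0.
- by move=> z nA; rewrite indic_out // mulr0.
Qed.

Lemma jump_mean_exit (W : set E) (A : set (borel E)) (l : R) x : open W -> 0 <= l ->
  measurable A -> (forall z, W z -> ~ A z) ->
  (forall y, W y -> l%:E <= J y A)%E ->
  (l%:E * V W x <= H W (\1_A) x)%E.
Proof.
move=> oW l0 mA WA lA; apply: (levy_exit_ge hp hJ x oW l0 (measurable_ind mA)).
- by [].
- by move=> z /WA nA; rewrite indic_out.
- by move=> y Wy; rewrite integral_indicE //; exact: lA.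
Qed.

Lemma harmonic_split (W : set E) (A N : set (borel E)) (m : R) x :
  open W -> W `<=` D `&` B 2 -> measurable A -> measurable N -> 0 <= m ->
  (forall z, ~ W z -> u z <= u z * \1_A z + m * \1_N z) ->
  ((u x)%:E <= H W (fun z => u z * \1_A z)%R x + m%:E * H W (\1_N) x)%E.
Proof.
move=> oW WU mA mN m0 uAN; rewrite -(harmonic x oW WU).
pose f1 z : \bar R := (u z * \1_A z)%:E.
pose f2 z : \bar R := (\1_N z)%:E.
have g10 z : (0 <= f1 z)%E by rewrite lee_fin u_ind_ge0.
have g20 z : (0 <= f2 z)%E by rewrite lee_fin; case/andP: (ind01 N z).
have m1 : measurable_fun setT (f1 : borel E -> \bar R).
  by apply/measurable_EFinP; exact: measurable_u_ind.
have m2 : measurable_fun setT (f2 : borel E -> \bar R).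
  by apply/measurable_EFinP; exact: measurable_indic.
have m2' : measurable_fun setT ((fun z => m%:E * f2 z)%E : borel E -> \bar R).
  exact: measurable_funeM.
have g2' z : (0 <= m%:E * f2 z)%E by rewrite mule_ge0 // lee_fin.
rewrite -(hitZ hp W (Some x) m0 g20 m2) -(hitD hp W (Some x) g10 g2' m1 m2').
apply: (hit_mono hp lc) => //.
- by move=> z; rewrite adde_ge0.
- exact/measurable_EFinP.
- exact: emeasurable_funD.
Qed.

(** The jump rate into [A] times the mean exit time is at most a probability. *)
Lemma mean_exit_le (W : set E) (A : set (borel E)) (l : R) x : open W -> 0 < l ->
  measurable A -> (forall z, W z -> ~ A z) ->
  (forall y, W y -> l%:E <= J y A)%E -> (V W x <= (l^-1)%:E)%E.
Proof.
move=> oW l0 mA WA lA.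
have := le_trans (jump_mean_exit x oW (ltW l0) mA WA lA) (hit_indic_le1 X P W A (Some x)).
by rewrite -lee_pdivlMl // mule1.
Qed.

Lemma real_of_bounded (a : \bar R) (b : R) : (0 <= a)%E -> (a <= b%:E)%E ->
  exists2 a', a = a'%:E & 0 <= a' <= b.
Proof. by case: a => // a; rewrite !lee_fin => a0 ab; exists a => //; rewrite a0. Qed.

Lemma hit_indic_real W N x : exists2 n, H W (\1_N) x = n%:E & 0 <= n <= 1.
Proof.
apply: real_of_bounded; last exact: hit_indic_le1.
by apply: hit_ge0 => z; rewrite lee_fin.
Qed.

(** In [near_exit] the landing probability [n] satisfies [n <= Cb * a1] and [n <= 1 - cb * a1],
    where [a1] is the mean exit time over [phi s]. The two bounds meet at this value. *)
Definition near_const : R :=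
  exit_const c beta C5 C6 / (exit_const c beta C5 C6 + (1 - C2) * C4 / (c * 3 `^ beta)).

Local Notation q := near_const.
Local Notation Cb := (exit_const c beta C5 C6).
Local Notation cb := ((1 - C2) * C4 / (c * 3 `^ beta)).

Let Cb_gt0 : 0 < Cb.
Proof. exact: exit_const_gt0. Qed.

Let cb_gt0 : 0 < cb.
Proof.
case/andP: C2_bounds => _ C21.
by rewrite divr_gt0 ?mulr_gt0 ?subr_gt0 ?powR_gt0 // (lt_le_trans ltr01).
Qed.

Lemma near_const_bounds : 0 < q < 1.
Proof.
have D0 : 0 < Cb + cb by exact: addr_gt0.
by rewrite divr_gt0 // ltr_pdivrMr // mul1r ltrDl.
Qed.

(* Exiting the ball with positive probability over the far away region, which
   bounds the mean exit time, balances [exit_far], which bounds the probability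
   of exiting at all by the mean exit time. *)
Lemma near_exit (y : E) (s : R) : D y -> k_ 3 * r <= mdist xi y ->
  mdist xi y + 2 * s <= 2 * r -> 0 < s -> (3 * C3 + 1) * s < e * r ->
  (V (D `&` ball y s) y <= (phi (3 * s) / C4)%:E)%E /\
  (H (D `&` ball y s) (\1_((ball y (2 * s) `|` B (k_ 2)) `&` ~` ball y s)) y <= q%:E)%E.
Proof.
move=> Dy yk ys s0 se.
have se3 : 3 * s < e * r.
  apply: le_lt_trans se; apply: ler_wpM2r; first exact: ltW.
  by have := C3_gt1; lra.
have er : e * r <= 2 / 5 * r by apply: ler_wpM2r; exact: ltW.
have rp := r_gt0.
set W := D `&` ball y s.
have oW : open W by apply: openI => //; exact: mball_open.
have Wy : W y by split => //; exact: ballxx.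
have s30 : 0 < 3 * s by lra.
have s3b : ((3 * s)%:E < rbar)%E by apply: smaller_radius; lra.
have p3 : 0 < phi (3 * s) by exact: (scale_gt0 hphi).
have p1 : 0 < phi s by exact: (scale_gt0 hphi).
have l0 : 0 < C4 / phi (3 * s) by rewrite divr_gt0.
have farJ w : W w -> ((C4 / phi (3 * s))%:E <= J w (~` ball w (3 * s)))%E.
  by move=> _; have /andP[] := hJt w s30 s3b.
have mV : measurable (~` ball y (2 * s) `&` ~` B (k_ 2) : set (borel E)).
  by apply: measurableI; exact: mball_borelC.
have mN : measurable ((ball y (2 * s) `|` B (k_ 2)) `&` ~` ball y s : set (borel E)).
  by apply: measurableI; [apply: measurableU; exact: mball_borel|exact: mball_borelC].
have yw w : W w -> mdist y w < s by case=> _; rewrite ballE.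
have mean1 : (V W y <= (phi (3 * s) / C4)%:E)%E.
  rewrite -[X in (_ <= X%:E)%E]invf_div.
  apply: (@mean_exit_le _ (~` ball y (2 * s))) => //.
  - exact: mball_borelC.
  - by move=> z /yw yz nz; apply: nz; rewrite ballE; lra.
  move=> w Ww; apply: le_trans (farJ w Ww) _; apply: le_measure.
  - by rewrite inE; exact: mball_borelC.
  - by rewrite inE; exact: mball_borelC.
  move=> z wz yz; apply: wz; move: yz; rewrite !ballE => yz.
  by have := metric_triangle w y z; rewrite (metric_sym w y); have := yw _ Ww; lra.
split => //.
have [a aE /andP[a0 _]] := real_of_bounded (mean_exit_ge0 X P W (Some y)) mean1.
set N := (_ `&` ~` ball y s).
have [n nE /andP[n0 n1]] := hit_indic_real W N y.
have [v vE /andP[v0 _]] := hit_indic_real W (~` ball y (2 * s) `&` ~` B (k_ 2)) y.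
(* The two landing sets are disjoint. *)
have nv : n + v <= 1.
  rewrite -lee_fin EFinD -nE -vE.
  rewrite -(hitD hp W (Some y)); last 4 first.
  - by move=> z; rewrite lee_fin.
  - by move=> z; rewrite lee_fin.
  - by apply/measurable_EFinP; exact: measurable_indic.
  - by apply/measurable_EFinP; exact: measurable_indic.
  apply: le_trans (hit_indic_le1 X P W setT (Some y)).
  apply: (hit_mono hp lc) => //.
  - by move=> z; rewrite /= -EFinD lee_fin addr_ge0.
  - by move=> z; rewrite lee_fin.
  - by apply: emeasurable_funD; apply/measurable_EFinP; exact: measurable_indic.
  - by apply/measurable_EFinP; exact: measurable_indic.
  move=> z _; rewrite /= -EFinD lee_fin indicT.
  have [Nz|nNz] := pselect (N z).
    rewrite (indic_in Nz) indic_out ?addr0 // => -[z1 z2].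
    by case: Nz => [[]].
  by rewrite (indic_out nNz) add0r; case/andP: (ind01 (~` ball y (2 * s) `&` ~` B (k_ 2)) z).
have C21 : 0 < 1 - C2 by case/andP: C2_bounds => *; lra.
have lower : (1 - C2) * C4 / phi (3 * s) * a <= v.
  rewrite -lee_fin EFinM -aE -vE; apply: jump_mean_exit => //.
  - by rewrite ltW // divr_gt0 // mulr_gt0.
  - by move=> z /yw yz [nz _]; apply: nz; rewrite ballE; lra.
  move=> w Ww; have yww := yw _ Ww.
  have wxi : mdist xi y <= mdist w xi + s.
    by have := metric_triangle xi w y; rewrite (metric_sym w y) (metric_sym xi w); lra.
  have k20 : 0 < k_ 2 * r by rewrite mulr_gt0 //; case/andP: kappa_bounds => *; lra.
  have k2b : ((k_ 2 * r)%:E < rbar)%E.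
    by apply: smaller_radius; apply: ler_wpM2r; [exact: ltW|case/andP: kappa_bounds => *; lra].
  (* (Jc.2) with radii [3 * s] and [k_ 2 * r]: [w] is farther than [k_ 3 * r - s] from [xi], and
     [(3 * C3 + 1) * s < e * r] leaves room for [C3 * (3 * s)]. So at least a fraction [1 - C2] of
     the jumps longer than [3 * s] land outside [B (k_ 2)]. *)
  have [_ /(_ _ _ s30 s3b k20 k2b) J2] := hJc w xi.
  have {}J2 : (J w (B (k_ 2)) <= C2%:E * J w (~` ball w (3 * s)))%E.
    apply: J2; lra.
  have Jf : J w (~` ball w (3 * s)) \is a fin_num.
    rewrite ge0_fin_numE //; have /andP[_ J5] := hJt w s30 s3b.
    by apply: le_lt_trans J5 _; exact: ltry.
  have Jsub : (J w (~` ball w (3 * s)) <=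
      J w (~` ball y (2 * s) `&` ~` B (k_ 2)) + J w (B (k_ 2)))%E.
    apply: le_trans (measureU2 _ mV (mball_borel xi _)); apply: le_measure; rewrite ?inE.
    - exact: mball_borelC.
    - by apply: measurableU => //; exact: mball_borel.
    move=> z wz; have [Bz|nBz] := pselect (B (k_ 2) z); first by right.
    left; split => // yz; apply: wz; move: yz; rewrite !ballE => yz.
    by have := metric_triangle w y z; rewrite (metric_sym w y); lra.
  have b0 : (0 <= J w (B (k_ 2)))%E by exact: measure_ge0.
  have := farJ w Ww; move: Jf J2 Jsub b0.
  case: (J w (~` ball w (3 * s))) => // j _; case: (J w (B _)) => [b| |] //; rewrite ?leye_eq //.
  case: (J w _) => [f| |] //; last by move=> *; exact: leey.
  rewrite -EFinM -EFinD !lee_fin => bj jfb _ lj.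
  have : (1 - C2) * (C4 / phi (3 * s)) <= (1 - C2) * j by rewrite ler_pM2l.
  by rewrite mulrA; lra.
have upper : phi s * n <= Cb * a.
  rewrite -lee_fin !EFinM -aE -nE.
  apply: le_trans (exit_far hp lc hJ hphi hgrow C6_gt0 r00 hEP C5_gt0 c_ge1 hJt oD Dy s0 _ _).
  - apply: lee_wpmul2l; first by rewrite lee_fin ltW.
    apply: (hit_mono hp lc) => //.
    + by move=> z; rewrite lee_fin.
    + by move=> z; rewrite lee_fin.
    + by apply/measurable_EFinP; exact: measurable_indic.
    + by apply/measurable_EFinP; apply: measurable_indic; exact: mball_borelC.
    move=> z _; rewrite lee_fin; have [Nz|nNz] := pselect (N z).
      by rewrite !indic_in //; case: Nz.
    by rewrite indic_out //; case/andP: (ind01 (~` ball y s) z).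
  - by apply: le_lt_trans r_lt; rewrite lee_fin; lra.
  - by apply: smaller_radius; lra.
have G3 : phi (3 * s) <= c * 3 `^ beta * phi s.
  by apply: (scale_growth hphi hgrow) => //; rewrite ler1n.
have K3 : 0 < c * 3 `^ beta by rewrite mulr_gt0 ?powR_gt0 // (lt_le_trans ltr01).
suff Hq : n <= q by move: Hq; rewrite -lee_fin -nE.
rewrite /near_const ler_pdivlMr ?addr_gt0 //.
pose a1 := a / phi s.
have n2 : n <= Cb * a1 by rewrite mulrA ler_pdivlMr // mulrC.
have n3 : n <= 1 - cb * a1.
  suff : cb * a1 <= v by lra.
  apply: le_trans lower; rewrite /a1.
  move: (c * 3 `^ beta) G3 K3 => K G3 K3.
  have -> : (1 - C2) * C4 / K * (a / phi s) = (1 - C2) * C4 * a * (K * phi s)^-1.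
    by field; rewrite !gt_eqF.
  have -> : (1 - C2) * C4 / phi (3 * s) * a = (1 - C2) * C4 * a * (phi (3 * s))^-1.
    by field; rewrite gt_eqF.
  apply: ler_wpM2l; first by rewrite !mulr_ge0 // ltW.
  by rewrite lef_pV2 ?posrE // mulr_gt0.
(* The two bounds are added with weights that cancel [a1]. *)
have H1 : Cb * n <= Cb * (1 - cb * a1) by apply: ler_wpM2l => //; exact: ltW.
have H2 : cb * n <= cb * (Cb * a1) by apply: ler_wpM2l => //; exact: ltW.
rewrite mulrDr mulrC (mulrC n cb); apply: le_trans (lerD H1 H2) _.
by rewrite mulrBr mulr1 mulrCA subrK.
Qed.

(** At the exit from the ball of radius [s], a far landing is paid for by [far_part] and the mean
    exit time, any other by [m] times a probability of at most [q]. *)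
Lemma near_estimate (y : E) (s lam m : R) : D y -> k_ 3 * r <= mdist xi y ->
  mdist xi y + 2 * s <= 2 * r -> 0 < s -> (3 * C3 + 1) * s < e * r ->
  0 < lam -> (outside_mass <= lam%:E)%E -> 0 <= m ->
  (forall z, D z -> (ball y (2 * s) `|` B (k_ 2)) z -> u z <= m) ->
  u y <= c0 (s / r) * lam * (phi (3 * s) / C4) + m * q.
Proof.
move=> Dy yk ys s0 se lam0 Lam m0 um.
have [mean1 near1] := near_exit Dy yk ys s0 se.
set W := D `&` ball y s in mean1 near1.
have oW : open W by apply: openI => //; exact: mball_open.
have sr : 0 < s / r by rewrite divr_gt0.
have ball2 t : t <= 2 * s -> ball y t `<=` B 2.
  by move=> ts z; rewrite !ballE; have := metric_triangle xi y z; lra.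
have mV : measurable (~` ball y (2 * s) `&` ~` B (k_ 2) : set (borel E)).
  by apply: measurableI; exact: mball_borelC.
have mN : measurable ((ball y (2 * s) `|` B (k_ 2)) `&` ~` ball y s : set (borel E)).
  by apply: measurableI; [apply: measurableU; exact: mball_borel|exact: mball_borelC].
have split_u z : ~ W z -> u z <= u z * \1_(~` ball y (2 * s) `&` ~` B (k_ 2)) z +
    m * \1_((ball y (2 * s) `|` B (k_ 2)) `&` ~` ball y s) z.
  move=> nWz; have [Vz|nVz] := pselect ((~` ball y (2 * s) `&` ~` B (k_ 2)) z).
    by rewrite (indic_in Vz) mulr1 lerDl mulr_ge0.
  have {nVz} Nz : (ball y (2 * s) `|` B (k_ 2)) z.
    by rewrite -setCU in nVz; apply: contrapT => nz; exact: nVz.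
  have [Dz|nDz] := pselect (D z).
    have Nz' : ((ball y (2 * s) `|` B (k_ 2)) `&` ~` ball y s) z.
      by split => // yz; apply: nWz; split.
    by rewrite (indic_in Nz') mulr1; apply: le_trans (um z Dz Nz) _; rewrite lerDr u_ind_ge0.
  rewrite uD; first by rewrite mul0r add0r mulr_ge0.
  split => //; case: Nz; first by apply: ball2.
  rewrite !ballE => xz; apply: lt_le_trans xz _; apply: ler_wpM2r; first exact: ltW.
  by case/andP: kappa_bounds => *; lra.
have WU : W `<=` D `&` B 2 by apply: setIS; apply: ball2; lra.
have := harmonic_split y oW WU mV mN m0 split_u.
have aB : ball y s `<=` B 2 by apply: ball2; lra.
have Wy : W y by split => //; exact: ballxx.
have Vd z : (~` ball y (2 * s) `&` ~` B (k_ 2)) z -> s + s / r * r <= mdist y z.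
  by rewrite divfK ?gt_eqF // => -[nz _]; rewrite leNgt; apply/negP => yz; apply: nz; rewrite ballE; lra.
have := far_part aB Wy sr mV (@subIsetr _ _ _) Vd lam0 Lam.
have cg : 0 <= c0 (s / r) * lam by rewrite mulr_ge0 // ltW // comparison_const_gt0.
move=> F1 F2; rewrite -lee_fin; apply: le_trans F2 _; rewrite EFinD; apply: leeD.
  apply: le_trans F1 _; rewrite (EFinM (_ * lam)); apply: lee_wpmul2l => //.
by rewrite EFinM; apply: lee_wpmul2l.
Qed.

(* The weight vanishes at the boundary of [B 2], where no uniform bound can hold. *)
Definition weight (z : E) : R := Num.min (2 - mdist xi z / r) e.

(** Halfway between [near_const] and 1: the margin pays for the loss of weight over one small
    ball. *)
Definition contraction_const : R := (1 + q) / 2.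

(** The first term makes [1 - 2 * step_const] to the power [theta] at least
    [near_const / contraction_const]; the second gives the room for (Jc.2) that [near_exit] asks
    for. *)
Definition step_const : R :=
  Num.min ((1 - (q / contraction_const) `^ theta^-1) / 2) (2 * (3 * C3 + 1))^-1.

Local Notation q' := contraction_const.
Local Notation eps := step_const.

Let q'_bounds : 0 < q' < 1.
Proof. by have := near_const_bounds; rewrite /q'; move: q => p; lra. Qed.

Let qq'_bounds : 0 < q / q' < 1.
Proof.
have := near_const_bounds; have /andP[p0 _] := q'_bounds; case/andP => q0 q1.
rewrite divr_gt0 //= ltr_pdivrMr // mul1r /contraction_const; lra.
Qed.

Lemma step_const_bounds : [/\ 0 < eps, 2 * eps < 1, (3 * C3 + 1) * eps < 1 &
  q <= q' * (1 - 2 * eps) `^ theta].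
Proof.
have /andP[r0q r1q] := qq'_bounds; have C31 := C3_gt1.
have /andP[p0 _] := q'_bounds.
set p := (q / q') `^ theta^-1.
have p_gt0 : 0 < p by rewrite powR_gt0.
have pth : p `^ theta = q / q' by rewrite -powRrM mulVf ?gt_eqF // powRr1 // ltW.
have p_lt1 : p < 1.
  rewrite ltNge; apply/negP => p1.
  have : 1 `^ theta <= p `^ theta by apply: ge0_ler_powR; rewrite ?nnegrE // ltW.
  by rewrite powR1 pth leNgt r1q.
have k0 : 0 < 3 * C3 + 1 by lra.
have e1 : eps <= (1 - p) / 2 by rewrite /eps ge_min lexx.
have e2 : eps <= (2 * (3 * C3 + 1))^-1 by rewrite /eps ge_min lexx orbT.
split.
- rewrite /eps lt_min; apply/andP; split; last by rewrite invr_gt0 mulr_gt0.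
  by rewrite divr_gt0 // subr_gt0.
- lra.
- rewrite mulrC -ltr_pdivlMr // mul1r; apply: le_lt_trans e2 _.
  by rewrite ltf_pV2 ?posrE ?mulr_gt0 // ltr_pMl // ltr1n.
- rewrite mulrC -ler_pdivrMr // -pth; apply: ge0_ler_powR; rewrite ?nnegrE; [exact: ltW|lra..].
Qed.

Lemma weight_in z : B 2 z -> 0 < weight z <= e.
Proof.
rewrite ballE => xz; rewrite /weight ge_min lexx orbT andbT lt_min e_gt0 andbT.
by rewrite subr_gt0 ltr_pdivrMr.
Qed.

Lemma weight_center z : mdist xi z <= k_ 4 * r -> weight z = e.
Proof.
move=> xz; apply: min_idPr.
have : mdist xi z / r <= k_ 4 by rewrite ler_pdivrMr.
lra.
Qed.

Lemma weight_lipschitz y z s : mdist y z <= s * r -> weight y - s <= weight z.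
Proof.
move=> yz.
have xz : mdist xi z / r <= mdist xi y / r + s.
  rewrite ler_pdivrMr // mulrDl divfK ?gt_eqF //.
  by have := metric_triangle xi y z; lra.
have w1 : weight y <= 2 - mdist xi y / r by rewrite ge_min lexx.
have w2 : weight y <= e by rewrite ge_min lexx orbT.
have s0 : 0 <= s.
  by have := le_trans (mdist_ge0 y z) yz; rewrite pmulr_lge0.
by rewrite le_min; apply/andP; split; lra.
Qed.

Let e1 : e < 1.
Proof. by have := e_lt; lra. Qed.

(** The comparison constant at scale [delta] blows up like [delta] to the power [-theta]; this is
    what fixes [theta] as the exponent of the weight. *)
Lemma comparison_const_scaled delta k : 0 < delta -> delta <= 1 -> 0 < k ->
  delta `^ theta * c0 (k * delta) <= c0 k.
Proof.
move=> d0 d1 k0; rewrite /comparison_const mulrCA ler_pM2l //.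
rewrite -powRM; [|exact: ltW|by rewrite addr_ge0 // divr_ge0 // mulr_ge0 // ltW].
have kd : 0 < k * delta by rewrite mulr_gt0.
apply: ge0_ler_powR; rewrite ?nnegrE.
- exact: ltW.
- by rewrite mulr_ge0 ?addr_ge0 ?divr_ge0 // ltW.
- by rewrite addr_ge0 // divr_ge0 // ltW.
have -> : delta * (2 + 2 / (k * delta)) = 2 * delta + 2 / k by field; rewrite !gt_eqF.
by rewrite lerD2r; lra.
Qed.

(** The ball about [y] has a radius proportional to the weight of [y]. Over its double the weight
    keeps at least a fraction [1 - 2 * eps], and by [comparison_const_scaled] the weighted far part
    is bounded uniformly in [y]. *)
Lemma weighted_outer (lam m : R) y : D y -> k_ 3 * r <= mdist xi y -> B 2 y ->
  0 < lam -> (outside_mass <= lam%:E)%E -> 0 <= m ->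
  (forall z, D z -> B 2 z -> u z * weight z `^ theta <= m) ->
  u y * weight y `^ theta <= c0 eps / C4 * phi r * lam + q' * m.
Proof.
move=> Dy yk B2y lam0 Lam m0 um.
have [ep e2 e3 e4] := step_const_bounds.
have /andP[w0 we] := weight_in B2y.
have w1 : weight y <= 2 - mdist xi y / r by rewrite ge_min lexx.
have ew : eps * weight y <= e * eps by rewrite mulrC ler_pM2r.
have rp := r_gt0.
have C31 := C3_gt1.
pose s := eps * weight y * r.
have s0 : 0 < s by rewrite !mulr_gt0.
have c12 : 0 < 1 - 2 * eps by lra.
have wc : 0 < weight y * (1 - 2 * eps) by rewrite mulr_gt0.
(* Bounds [u] wherever the weight is at least [weight y * (1 - 2 * eps)]. *)
pose m1 := m / (weight y * (1 - 2 * eps)) `^ theta.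
have m10 : 0 <= m1 by rewrite divr_ge0 // powR_ge0.
have ys : mdist xi y + 2 * s <= 2 * r.
  have : 2 * eps * (weight y * r) <= 1 * (weight y * r).
    by apply: ler_wpM2r; [rewrite mulr_ge0 // ltW|exact: ltW].
  have : weight y * r <= (2 - mdist xi y / r) * r by rewrite ler_pM2r.
  by rewrite mulrBl divfK ?gt_eqF // /s; lra.
have se : (3 * C3 + 1) * s < e * r.
  rewrite /s mulrA ltr_pM2r //.
  apply: (@le_lt_trans _ _ ((3 * C3 + 1) * (e * eps))); first by rewrite ler_pM2l //; lra.
  by rewrite mulrCA gtr_pMr.
have bound z : D z -> (ball y (2 * s) `|` B (k_ 2)) z -> u z <= m1.
  move=> Dz Nz.
  have [B2z wz] : B 2 z /\ weight y * (1 - 2 * eps) <= weight z.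
    case: Nz => [yz|xz]; rewrite !ballE.
      rewrite ballE in yz; split; first by have := metric_triangle xi y z; lra.
      have : mdist y z <= (2 * eps * weight y) * r by move: yz; rewrite /s; lra.
      by move/weight_lipschitz; lra.
    (* On [B (k_ 2)] the weight has its maximal value [e]. *)
    have xk : mdist xi z <= k_ 4 * r.
      move: xz; rewrite ballE => /ltW xz; apply: le_trans xz _.
      by apply: ler_wpM2r; [exact: ltW|move: e_gt0; lra].
    rewrite (weight_center xk); split.
      by apply: le_lt_trans xk _; rewrite ltr_pM2r //; move: e_gt0; lra.
    by apply: le_trans we; rewrite ger_pMr //; lra.
  rewrite ler_pdivlMr ?powR_gt0 //; apply: le_trans (um z Dz B2z).
  apply: ler_wpM2l => //; apply: ge0_ler_powR; rewrite ?nnegrE; [exact: ltW|exact: ltW| |by []].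
  by apply: le_trans wz; exact: ltW.
have main := near_estimate Dy yk ys s0 se lam0 Lam m10 bound.
have wt : 0 < weight y `^ theta by rewrite powR_gt0.
have [->|u_neq0] := eqVneq (u y) 0.
  have /andP[/ltW q0 _] := q'_bounds; rewrite mul0r.
  have pr : 0 < phi r by exact: (scale_gt0 hphi).
  have cg : 0 < c0 eps by exact: comparison_const_gt0.
  apply: addr_ge0; last by apply: mulr_ge0.
  by do 2?apply: mulr_ge0; apply: ltW => //; rewrite divr_gt0.
have {}main := ler_wpM2r (ltW wt) main.
apply: le_trans main _; rewrite mulrDl; apply: lerD.
  have p3 : phi (3 * s) <= phi r.
    apply: (scale_le hphi); first by rewrite mulr_ge0 // ltW.
    have : 3 * s <= (3 * C3 + 1) * s by apply: ler_wpM2r; [exact: ltW|lra].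
    have : e * r <= 1 * r by apply: ler_wpM2r; exact: ltW.
    lra.
  have -> : s / r = eps * weight y by rewrite mulfK // gt_eqF.
  have cs := comparison_const_scaled w0 (le_trans we (ltW e1)) ep.
  have -> : c0 (eps * weight y) * lam * (phi (3 * s) / C4) * weight y `^ theta =
    weight y `^ theta * c0 (eps * weight y) * (phi (3 * s) * (lam / C4)) by ring.
  have -> : c0 eps / C4 * phi r * lam = c0 eps * (phi r * (lam / C4)) by ring.
  have lC : 0 < lam / C4 by rewrite divr_gt0.
  apply: ler_pM => //.
  - by rewrite mulr_ge0 // ltW // comparison_const_gt0 // mulr_gt0.
  - by rewrite mulr_ge0 // ltW // (scale_gt0 hphi) // mulr_gt0.
  - by rewrite ler_pM2r.
rewrite /m1 (powRM _ (ltW w0) (ltW c12)).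
have ct : 0 < (1 - 2 * eps) `^ theta by rewrite powR_gt0.
have -> : m / (weight y `^ theta * (1 - 2 * eps) `^ theta) * q * weight y `^ theta =
  m * (q / (1 - 2 * eps) `^ theta) by field; rewrite !gt_eqF.
by rewrite (mulrC q' m); apply: ler_wpM2l => //; rewrite ler_pdivrMr.
Qed.

Lemma powR_le1 (a : R) : 0 <= a -> a <= 1 -> a `^ theta <= 1.
Proof.
move=> a0 a1; have : a `^ theta <= 1 `^ theta.
  by apply: ge0_ler_powR; rewrite ?nnegrE // ltW.
by rewrite powR1.
Qed.

(** From every point of [B k], jumps out of [B k] occur at rate at least [C4 / phi (2 * r) / c0 e],
    by comparison with the kernel at [xi]. *)
Lemma mean_exit_center (k : R) x : e <= k <= 2 ->
  (V (D `&` B k) x <= (c0 e / C4 * phi (2 * r))%:E)%E.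
Proof.
case/andP=> ek k2; have ep := e_gt0; have rp := r_gt0.
have kr : 0 < k * r by rewrite mulr_gt0 //; exact: lt_le_trans ek.
have k2r : k * r <= 2 * r by rewrite ler_pM2r.
have p2 : 0 < phi (2 * r) by apply: (scale_gt0 hphi); rewrite mulr_gt0.
have cg : 0 < c0 e by exact: comparison_const_gt0.
have -> : c0 e / C4 * phi (2 * r) = (C4 / phi (2 * r) / c0 e)^-1.
  by field; rewrite !gt_eqF.
apply: (@mean_exit_le _ (~` B k)).
- by apply: openI => //; exact: mball_open.
- by rewrite !divr_gt0.
- exact: mball_borelC.
- by move=> z [_ Bz].
move=> y [_ By].
have y2 : mdist xi y <= 2 * r by move: By; rewrite ballE; lra.
have /andP[J4 _] := hJt xi kr (smaller_radius k2r).
have := jump_comparison C1_gt0 theta_gt0 hJc r_gt0 r2_lt y2 ep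
  (mball_borelC xi (k * r)) (B := ~` B k).
move=> Jc1; rewrite mulrC EFinM lee_pdivrMl //.
apply: le_trans (Jc1 _) => [|z nz].
  apply: le_trans J4; rewrite lee_fin ler_pM2l // lef_pV2 ?posrE //.
    by apply: (scale_le hphi) => //; exact: ltW.
  exact: (scale_gt0 hphi).
apply: (@le_trans _ _ (k * r)); first by rewrite ler_pM2r.
by rewrite leNgt; apply/negP => zk; apply: nz; rewrite ballE.
Qed.

Definition outer_const : R := c0 eps / C4.

(** One factor [c0 e] comes from [far_part], the other from [mean_exit_center]; the growth bound
    turns [phi (2 * r)] into [phi r]. *)
Definition inner_const : R := c0 e ^+ 2 / C4 * (c * 2 `^ beta).

(** For [y] in [B (k_ 3)], where [near_exit] does not apply, stop at the exit from that ball: a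
    landing in [B (k_ 4)] is covered by [weighted_outer] with the same weight [e], a farther one by
    [far_part]. The coefficient of [m] remains [q']. *)
Lemma weighted_step (lam m : R) y : D y -> B 2 y ->
  0 < lam -> (outside_mass <= lam%:E)%E -> 0 <= m ->
  (forall z, D z -> B 2 z -> u z * weight z `^ theta <= m) ->
  u y * weight y `^ theta <= (outer_const + inner_const) * phi r * lam + q' * m.
Proof.
move=> Dy By lam0 Lam m0 um.
have ep := e_gt0; have rp := r_gt0; have e1' := e1.
have pr : 0 < phi r by exact: (scale_gt0 hphi).
have K2 : 0 < c * 2 `^ beta by rewrite mulr_gt0 ?powR_gt0 // (lt_le_trans ltr01).
have cg : 0 < c0 e by exact: comparison_const_gt0.
have icc : 0 < inner_const by rewrite /inner_const mulr_gt0 // divr_gt0 // exprn_gt0.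
have ic : 0 <= inner_const * phi r * lam by apply: ltW; do 2!apply: mulr_gt0 => //.
have [yk|yk] := leP (k_ 3 * r) (mdist xi y).
  apply: le_trans (weighted_outer Dy yk By lam0 Lam m0 um) _.
  by rewrite lerD2r !mulrDl lerDl.
have k34 : k_ 3 * r <= k_ 4 * r by rewrite ler_pM2r //; lra.
have k3' : e <= k_ 3 <= 2 by case/andP: kappa_bounds => *; apply/andP; split; lra.
have we : weight y = e by apply: weight_center; lra.
set m1 := outer_const * phi r * lam + q' * m.
have m10 : 0 <= m1.
  have /andP[/ltW q0 _] := q'_bounds.
  have oc : 0 < outer_const.
    by rewrite divr_gt0 // comparison_const_gt0 //; case: step_const_bounds.
  by apply: addr_ge0; [apply: ltW; do 2!apply: mulr_gt0 => //|apply: mulr_ge0].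
have et : 0 < e `^ theta by rewrite powR_gt0.
have et1 : e `^ theta <= 1.
  by apply: powR_le1; exact: ltW.
have oW : open (D `&` B (k_ 3)) by apply: openI => //; exact: mball_open.
have B32 : B (k_ 3) `<=` B 2 by apply: le_ball; rewrite ler_pM2r //; case/andP: k3'.
have WU : D `&` B (k_ 3) `<=` D `&` B 2 by exact: setIS.
have mA : measurable (~` B (k_ 4) : set (borel E)) by exact: mball_borelC.
have mN : measurable (B (k_ 4) `&` ~` B (k_ 3) : set (borel E)).
  by apply: measurableI; [exact: mball_borel|exact: mball_borelC].
have m20 : 0 <= m1 / e `^ theta by rewrite divr_ge0 // ltW.
have split_u z : ~ (D `&` B (k_ 3)) z -> u z <= u z * \1_(~` B (k_ 4)) z +
    m1 / e `^ theta * \1_(B (k_ 4) `&` ~` B (k_ 3)) z.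
  move=> nWz; have [Bz|nBz] := pselect (B (k_ 4) z); last first.
    by rewrite (indic_in (A := ~` B (k_ 4))) // mulr1 lerDl mulr_ge0.
  have B2z : B 2 z.
    by apply: (le_ball _ Bz); rewrite ler_pM2r //; case/andP: kappa_bounds => *; lra.
  have [Dz|nDz] := pselect (D z); last first.
    by rewrite (uD (conj B2z nDz)) mul0r add0r mulr_ge0.
  have nB3 : (~` B (k_ 3)) z by move=> B3; apply: nWz.
  have Nz : (B (k_ 4) `&` ~` B (k_ 3)) z by [].
  rewrite (indic_in Nz) mulr1; apply: (@le_trans _ _ (m1 / e `^ theta)); last first.
    by rewrite lerDr u_ind_ge0.
  rewrite ler_pdivlMr // -(weight_center (z := z)); last by apply: ltW; rewrite ballE in Bz.
  apply: weighted_outer => //.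
  by rewrite leNgt; apply/negP => zk; apply: nB3; rewrite ballE.
have F1 := harmonic_split y oW WU mA mN m20 split_u.
have Wy : (D `&` B (k_ 3)) y by split => //; rewrite ballE.
have Ad z : (~` B (k_ 4)) z -> k_ 3 * r + e * r <= mdist xi z.
  move=> nz; rewrite leNgt; apply/negP => zk; apply: nz; rewrite ballE.
  by apply: lt_le_trans zk _; rewrite -mulrDl ler_pM2r //; lra.
have A2 : ~` B (k_ 4) `<=` ~` B (k_ 2).
  by apply: subsetC; apply: le_ball; rewrite ler_pM2r //; lra.
have F2 := far_part B32 Wy ep mA A2 Ad lam0 Lam.
have F3 := mean_exit_center y k3'.
have uy : u y <= c0 e * lam * (c0 e / C4 * phi (2 * r)) + m1 / e `^ theta.
  rewrite -lee_fin; apply: le_trans F1 _; rewrite EFinD; apply: leeD.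
    apply: le_trans F2 _; rewrite (EFinM (_ * lam)); apply: lee_wpmul2l => //.
    by rewrite lee_fin; apply: ltW; rewrite mulr_gt0.
  rewrite -[leRHS]mule1; apply: lee_wpmul2l; first by rewrite lee_fin.
  exact: hit_indic_le1.
have G2 : phi (2 * r) <= c * 2 `^ beta * phi r.
  by apply: (scale_growth hphi hgrow) => //; rewrite ler1n.
rewrite we; apply: (@le_trans _ _ ((c0 e * lam * (c0 e / C4 * phi (2 * r)) + m1 / e `^ theta) * e `^ theta)).
  by rewrite ler_pM2r.
rewrite mulrDl divfK ?gt_eqF // /m1 addrA lerD2r.
have -> : (outer_const + inner_const) * phi r * lam =
  inner_const * phi r * lam + outer_const * phi r * lam by rewrite -mulrDl -mulrDl addrC.
rewrite lerD2r.
apply: (@le_trans _ _ (c0 e * lam * (c0 e / C4 * phi (2 * r)))).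
  apply: ler_piMr => //; apply: ltW.
  have p2 : 0 < phi (2 * r) by apply: (scale_gt0 hphi); exact: mulr_gt0.
  by apply: mulr_gt0; [exact: mulr_gt0|apply: mulr_gt0 => //; exact: divr_gt0].
have -> : c0 e * lam * (c0 e / C4 * phi (2 * r)) = (c0 e ^+ 2 / C4 * lam) * phi (2 * r) by ring.
have -> : inner_const * phi r * lam = (c0 e ^+ 2 / C4 * lam) * (c * 2 `^ beta * phi r).
  by rewrite /inner_const; ring.
rewrite ler_pM2l //; apply: mulr_gt0 => //; apply: divr_gt0 => //; exact: exprn_gt0.
Qed.

(** Solves the inequality of [weighted_step] for the supremum and divides by the power [theta] of
    the weight, which is constantly [e] on [B (k_ 2)]. *)
Definition bulk_const : R := (outer_const + inner_const) / ((1 - q') * e `^ theta).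

(** Since [u] is bounded by [M], the weighted supremum is finite and its multiple by [q'] can be
    moved to the left. [M] itself leaves no trace in the bound. *)
Lemma bulk_bound (lam : R) y : (D `&` B (k_ 2)) y -> 0 < lam ->
  (outside_mass <= lam%:E)%E -> u y <= bulk_const * phi r * lam.
Proof.
move=> [Dy By] lam0 Lam; have ep := e_gt0; have rp := r_gt0.
have /andP[q0 q1] := q'_bounds.
have k2 : k_ 2 * r <= 2 * r by rewrite ler_pM2r //; case/andP: kappa_bounds => *; lra.
have B2y : B 2 y by exact: (le_ball k2 By).
pose A : set R := [set a | exists z, [/\ D z, B 2 z & a = u z * weight z `^ theta]].
have A0 : A !=set0 by exists (u y * weight y `^ theta), y.
have AM : ubound A M.
  move=> _ [z [Dz Bz ->]]; apply: le_trans (uM z); apply: ler_piMr => //.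
  have /andP[w0 we] := weight_in Bz.
  by apply: powR_le1; [exact: ltW|apply: le_trans we _; exact: ltW].
have supA : has_sup A by split => //; exists M.
have ub z : D z -> B 2 z -> u z * weight z `^ theta <= sup A.
  by move=> Dz Bz; apply: sup_upper_bound => //; exists z.
have s0 : 0 <= sup A by apply: le_trans (ub _ Dy B2y); rewrite mulr_ge0 // powR_ge0.
have : sup A <= (outer_const + inner_const) * phi r * lam + q' * sup A.
  by apply: ge_sup => // _ [z [Dz Bz ->]]; exact: weighted_step.
move=> sA; have et : 0 < e `^ theta by rewrite powR_gt0.
have := ub _ Dy B2y; rewrite weight_center; last first.
  by move: By; rewrite ballE => /ltW By; apply: le_trans By _; rewrite ler_pM2r //; lra.
rewrite -ler_pdivlMr // => uy; apply: le_trans uy _.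
have -> : bulk_const * phi r * lam = ((outer_const + inner_const) * phi r * lam / (1 - q')) / e `^ theta.
  by rewrite /bulk_const; field; rewrite gt_eqF //= subr_eq0 eq_sym lt_eqF.
rewrite ler_pM2r ?invr_gt0 // ler_pdivlMr ?subr_gt0 //.
by rewrite mulrBr mulr1 lerBlDr (mulrC (sup A)).
Qed.

(** The first summand is for exits landing outside [B (k_ 2)]. The second is for the others:
    [bulk_bound] times a probability of at most [Cb] times the mean exit time over [phi (e * r)],
    with the growth bound comparing [phi r] to [phi (e * r)]. *)
Definition mass_const : R := c0 e + bulk_const * (Cb * (c * e^-1 `^ beta)).

Let bulk_const_gt0 : 0 < bulk_const.
Proof.
have ep := e_gt0; have /andP[_ q1] := q'_bounds; have [? _ _ _] := step_const_bounds.
have cK : 0 < c * 2 `^ beta by rewrite mulr_gt0 ?powR_gt0 // (lt_le_trans ltr01).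
apply: divr_gt0; last by rewrite mulr_gt0 ?subr_gt0 // powR_gt0.
apply: addr_gt0; first by rewrite divr_gt0 // comparison_const_gt0.
by apply: mulr_gt0 => //; rewrite divr_gt0 // exprn_gt0 // comparison_const_gt0.
Qed.

(** The ball of radius [e * r] about [x] lies in [B (k_ 1)], so [exit_far] applies to it. To reach
    [N] the path must leave this ball: if it leaves [D] inside the ball, it has exited at a point
    outside [N]. *)
Lemma near_center_exit x (N : set (borel E)) : (D `&` B kappa) x -> measurable N -> N `<=` D ->
  ((phi (e * r))%:E * H (D `&` B (k_ 1)) (\1_N) x <= Cb%:E * V (D `&` B (k_ 1)) x)%E.
Proof.
move=> [Dx Bx] mN ND; have ep := e_gt0; have rp := r_gt0; have e1' := e1.
have er : 0 < e * r by exact: mulr_gt0.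
have er1 : e * r < r by rewrite gtr_pMl.
set W := D `&` B (k_ 1); set W' := D `&` ball x (e * r).
have oW : open W by apply: openI => //; exact: mball_open.
have oW' : open W' by apply: openI => //; exact: mball_open.
have W'W : W' `<=` W.
  apply: setIS => z; rewrite !ballE in Bx * => xz.
  have := metric_triangle xi x z.
  have -> : k_ 1 * r = kappa * r + e * r by rewrite mulrDl mul1r.
  lra.
have f0 z : (0 <= (EFin \o (\1_N : E -> R)) z)%E by rewrite lee_fin.
have mf : measurable_fun setT (EFin \o (\1_N : E -> R) : borel E -> \bar R).
  by apply/measurable_EFinP; exact: measurable_indic.
rewrite -(hit_hit hp lc (Some x) oW oW' W'W f0 mf).
have mB : measurable (~` ball x (e * r) : set (borel E)) by exact: mball_borelC.
apply: (@le_trans _ _ ((phi (e * r))%:E * H W' (\1_(~` ball x (e * r))) x)%E).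
  apply: lee_wpmul2l; first by rewrite lee_fin ltW // (scale_gt0 hphi).
  apply: (hit_mono hp lc) => //.
  - by move=> z; exact: hit_ge0.
  - by move=> z; rewrite lee_fin.
  - exact: (measurable_hit hp).
  - by apply/measurable_EFinP; exact: measurable_indic.
  move=> z nW'; have [Bz|nBz] := pselect (ball x (e * r) z); last first.
    by rewrite /comp (indic_in (A := ~` ball x (e * r))) //; exact: hit_indic_le1.
  have nDz : ~ D z by move=> Dz; apply: nW'.
  rewrite (hit_out hp f0 mf); last by move=> [z' [Dz' _] [zz]]; apply: nDz; rewrite -zz.
  by rewrite /= lee_fin (indic_out (A := N)) // => /ND.
apply: le_trans (exit_far hp lc hJ hphi hgrow C6_gt0 r00 hEP C5_gt0 c_ge1 hJt oD Dx er _ _) _.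
- by apply: lt_trans r_lt; rewrite lte_fin.
- by apply: smaller_radius; lra.
apply: lee_wpmul2l; first by rewrite lee_fin ltW.
exact: mean_exit_mono.
Qed.

(** The lower bound on [u] keeps only the exits that land outside [B (k_ 2)]; the upper bound adds
    the remaining ones, controlled by [bulk_bound] and [near_center_exit]. *)
Lemma mass_representation x : (D `&` B kappa) x ->
  [/\ 0 <= fine outside_mass, 0 <= fine (V (D `&` B (k_ 1)) x),
      fine outside_mass * fine (V (D `&` B (k_ 1)) x) <= c0 e * u x &
      u x <= mass_const * fine outside_mass * fine (V (D `&` B (k_ 1)) x)].
Proof.
move=> Dx; have ep := e_gt0; have rp := r_gt0; have e1' := e1.
have k13 : e <= k_ 1 <= 2 by case/andP: kappa_bounds => *; apply/andP; split; lra.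
have [L LE L0] : exists2 L, outside_mass = L%:E & 0 <= L.
  exists (fine outside_mass); first by rewrite fineK // outside_mass_fin.
  by apply: fine_ge0; apply: integral_ge0 => z _; rewrite lee_fin u_ind_ge0.
have [v vE /andP[v0 _]] := real_of_bounded (mean_exit_ge0 X P (D `&` B (k_ 1)) (Some x))
  (mean_exit_center x k13).
rewrite LE vE /=; split => //.
  have cg : 0 < c0 e by exact: comparison_const_gt0.
  set W := D `&` B (k_ 1) in vE *.
  have oW : open W by apply: openI => //; exact: mball_open.
  have mA : measurable (~` B (k_ 2) : set (borel E)) by exact: mball_borelC.
  have WU : W `<=` D `&` B 2.
    by apply: setIS; apply: le_ball; rewrite ler_pM2r //; case/andP: k13.
  have k12 : k_ 1 * r <= k_ 2 * r by rewrite ler_pM2r //; lra.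
  have low : ((L / c0 e)%:E * V W x <= H W (fun z => u z * \1_(~` B (k_ 2)) z)%R x)%E.
    apply: (levy_exit_ge hp hJ) => //.
    - by rewrite divr_ge0 // ltW.
    - exact: measurable_u_ind.
    - by move=> z; exact: u_ind_ge0.
    - by move=> z [_ Bz]; rewrite indic_out ?mulr0 // => nz; apply: nz; exact: (le_ball k12).
    move=> y [_ By]; rewrite mulrC EFinM lee_pdivrMl // -LE.
    rewrite /outside_mass; apply: (ge0_le_integral_scaled (B := (~` B (k_ 2) : set (borel E)))).
    - exact: ltW.
    - move=> A' mA' AA'; apply: (jump_comparison C1_gt0 theta_gt0 hJc (r := r)) => //.
        by move: By; rewrite ballE => /ltW /le_trans; apply; rewrite ler_pM2r //; case/andP: k13.
      move=> z /AA' nz; apply: (@le_trans _ _ (k_ 2 * r)); first by rewrite ler_pM2r //; lra.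
      by rewrite leNgt; apply/negP => zk; apply: nz; rewrite ballE.
    - by move=> z; rewrite lee_fin u_ind_ge0.
    - by move=> z nA; rewrite indic_out ?mulr0.
  have up : (H W (fun z => u z * \1_(~` B (k_ 2)) z)%R x <= (u x)%:E)%E.
    rewrite -(harmonic x oW WU); apply: (hit_mono hp lc) => //.
    + by move=> z; rewrite lee_fin u_ind_ge0.
    + by apply/measurable_EFinP; exact: measurable_u_ind.
    + exact/measurable_EFinP.
    by move=> z _; rewrite lee_fin; exact: ler_piMr.
  have := le_trans low up; rewrite vE -EFinM lee_fin mulrAC ler_pdivrMr //.
  by rewrite (mulrC (u x)).
have upper lam : 0 < lam -> L <= lam -> u x <= mass_const * lam * v.
  move=> lam0 Llam.
  have Lam : (outside_mass <= lam%:E)%E by rewrite LE lee_fin.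
  set W := D `&` B (k_ 1) in vE *.
  pose N := D `&` (B (k_ 2) `&` ~` B (k_ 1)).
  have oW : open W by apply: openI => //; exact: mball_open.
  have mN : measurable (N : set (borel E)).
    apply: measurableI; first exact: open_borel.
    by apply: measurableI; [exact: mball_borel|exact: mball_borelC].
  have mA : measurable (~` B (k_ 2) : set (borel E)) by exact: mball_borelC.
  have k12r : k_ 1 * r <= 2 * r by rewrite ler_pM2r //; case/andP: k13.
  have k22r : k_ 2 * r <= 2 * r by rewrite ler_pM2r //; case/andP: kappa_bounds => *; lra.
  have B12 : B (k_ 1) `<=` B 2 by exact: le_ball.
  have WU : W `<=` D `&` B 2 by exact: setIS.
  have pr : 0 < phi r by exact: (scale_gt0 hphi).
  have bg := bulk_const_gt0.
  pose m := bulk_const * phi r * lam.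
  have m0 : 0 <= m by apply: ltW; do 2!apply: mulr_gt0 => //.
  have split_u z : ~ W z -> u z <= u z * \1_(~` B (k_ 2)) z + m * \1_N z.
    move=> nWz; have [Bz|nBz] := pselect (B (k_ 2) z); last first.
      by rewrite (indic_in (A := ~` B (k_ 2))) // mulr1 lerDl mulr_ge0.
    have [Dz|nDz] := pselect (D z); last first.
      rewrite uD ?mul0r ?add0r; first by rewrite mulr_ge0.
      by split => //; exact: (le_ball k22r).
    have Nz : N z by split => //; split => // Bz1; apply: nWz.
    rewrite (indic_in Nz) mulr1; apply: (@le_trans _ _ m); last by rewrite lerDr u_ind_ge0.
    exact: bulk_bound.
  have F1 := harmonic_split x oW WU mA mN m0 split_u.
  have Wx : (D `&` B (k_ 1)) x.
    case: Dx => Dx Bx; split => //; apply: (le_ball _ Bx); rewrite ler_pM2r //.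
    by rewrite lerDl mul1r ltW.
  have Ad z : (~` B (k_ 2)) z -> k_ 1 * r + e * r <= mdist xi z.
    move=> nz; rewrite leNgt; apply/negP => zk; apply: nz; rewrite ballE.
    by apply: lt_le_trans zk _; rewrite -mulrDl ler_pM2r //; lra.
  have F2 := far_part B12 Wx ep mA (@subset_refl _ _) Ad lam0 Lam.
  have ND : N `<=` D by move=> z [].
  have F3 := near_center_exit Dx mN ND.
  have [h hE /andP[h0 _]] := hit_indic_real W N x.
  rewrite -/W hE vE -!EFinM lee_fin in F3.
  rewrite -/W vE -EFinM in F2.
  rewrite hE -EFinM in F1.
  have F : u x <= c0 e * lam * v + m * h.
    rewrite -lee_fin; apply: le_trans F1 _; rewrite EFinD; exact: leeD.
  apply: le_trans F _.
  have Ge : phi r <= c * e^-1 `^ beta * phi (e * r).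
    have ei : 1 <= e^-1 by rewrite invf_ge1 // ltW.
    have := scale_growth hphi hgrow (mulr_gt0 ep rp) ei.
    by rewrite mulrA mulVf ?mul1r // gt_eqF.
  have K2 : 0 < c * e^-1 `^ beta.
    by rewrite mulr_gt0 ?powR_gt0 ?invr_gt0 // (lt_le_trans ltr01).
  have Gh : phi r * h <= (c * e^-1 `^ beta) * (Cb * v).
    apply: le_trans (ler_wpM2r h0 Ge) _; rewrite -[leLHS]mulrA.
    by apply: ler_wpM2l => //; exact: ltW.
  have -> : mass_const * lam * v = c0 e * lam * v +
      bulk_const * lam * ((c * e^-1 `^ beta) * (Cb * v)) by rewrite /mass_const; ring.
  rewrite lerD2l /m.
  have -> : bulk_const * phi r * lam * h = bulk_const * lam * (phi r * h) by ring.
  by rewrite ler_pM2l // mulr_gt0.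
have mc : 0 < mass_const.
  apply: addr_gt0; first exact: comparison_const_gt0.
  apply: mulr_gt0; first exact: bulk_const_gt0.
  rewrite mulr_gt0 // mulr_gt0 ?powR_gt0 ?invr_gt0 // (lt_le_trans ltr01) //.
(* [upper] takes a positive [lam] while [L] may be 0, so it is applied to [L + t] with a small
   [t]. *)
apply/ler_addgt0Pr => eta eta0.
have mv : 0 < mass_const * v + 1 by rewrite ltr_pwDr // mulr_ge0 // ltW.
pose t := eta / (mass_const * v + 1).
have t0 : 0 < t by rewrite divr_gt0.
have Lt : L <= L + t by rewrite lerDl ltW.
have Lt0 : 0 < L + t by rewrite ltr_wpDl.
apply: le_trans (upper _ Lt0 Lt) _.
have -> : mass_const * (L + t) * v = mass_const * L * v + mass_const * v * t by ring.
rewrite lerD2l /t mulrA ler_pdivrMr // mulrC ler_pM2l //.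
by rewrite lerDl.
Qed.

End boundary_decay.

(** * Truncation of the exit data *)

Section truncation.
Context {R : realType} {E : pmetricType R} {d : measure_display}
  {Omega : measurableType d} (X : R -> Omega -> cemetery E)
  (P : cemetery E -> probability Omega R)
  (hp : hunt_process X P) (lc : locally_compact [set: E]).
Variables (U : set E) (h : E -> R).
Hypotheses (oU : open U) (h0 : forall z, 0 <= h z)
  (mh : measurable_fun setT (h : borel E -> R)).

(** Regular harmonicity is stated with [exit_time], which equals [open_exit] off [bad]; paths that
    never exit contribute 0, being at the cemetery at time [+oo]. *)
Lemma regular_harmonic_hit x : regular_harmonic X P h U -> U x ->
  hit X P U (EFin \o h) (Some x) = (h x)%:E.
Proof.
move=> [_ /(_ x) rh] Ux; have [_ ->] := rh Ux.
pose F w := ext (EFin \o h) (at_time X (exit_time X U w) w).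
pose G w := ext (EFin \o h) (at_time X (open_exit X U w) w).
transitivity (\int[P (Some x)]_w F w)%E; last first.
  rewrite [RHS]integral_mkcond; apply: eq_integral => w _.
  rewrite /patch /F; case: ifPn => [_|].
    by case: (at_time X (exit_time X U w) w).
  by rewrite notin_setE /=; case: (exit_time X U w) => // t /(_ (ltry t)).
have eF0 z : (0 <= ext (EFin \o h) z)%E by apply: ext_ge0 => y; rewrite lee_fin.
have mG : measurable_fun setT (G : g_sigma_algebraType (natural X `[0, +oo[) -> \bar R).
  by apply: (measurable_open_exit_value hp); exact/measurable_EFinP.
have FG w : ~ bad X U w -> F w = G w by move=> /good_exit gw; rewrite /F /G gw.
have mF : measurable_fun [set: Omega] F.
  move=> _ B mB; rewrite setTI.
  have mGB : natural X `[0, +oo[ (G @^-1` B).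
    by rewrite -nat_ooE -[X in measurable X]setTI; exact: mG.
  have GF : (G @^-1` B) `\` bad X U = (F @^-1` B) `\` bad X U.
    by apply/seteqP; split => w [Bw nb]; split => //; move: Bw; rewrite /= (FG w nb).
  by have [] := ae_eq_measurable hp (bad_natural hp oU) (bad_null hp lc oU) mGB GF.
apply: ge0_ae_eq_integral => //.
- exact: (measurable_paths hp).
- by move=> w _; exact: eF0.
by apply: filterS (ae_good hp lc (Some x) oU) => w gw _; rewrite FG.
Qed.

(** The exit data are cut at [n], not [h] itself, whose minimum with [n] need not be harmonic. The
    extension is harmonic, bounded by [n], and zero at the points outside [U] where [h] is. *)
Definition truncation (n : nat) (z : E) : R :=
  fine (hit X P U (fun y => (Num.min (h y) n%:R)%:E) (Some z)).

Let g_ n (y : E) : \bar R := (Num.min (h y) n%:R)%:E.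

Let g_ge0 n y : (0 <= g_ n y)%E.
Proof. by rewrite lee_fin le_min h0 /=. Qed.

Let mg n : measurable_fun setT (g_ n : borel E -> \bar R).
Proof. by apply/measurable_EFinP; exact: measurable_minr. Qed.

Let hit_g_le n z : (hit X P U (g_ n) z <= n%:R%:E)%E.
Proof.
apply: (@le_trans _ _ (n%:R%:E * hit X P U (cst 1%E) z)%E); last first.
  by rewrite -[leRHS]mule1; apply: lee_wpmul2l => //; exact: hit_cst1.
rewrite -(hitZ hp) //.
by apply: (hit_mono hp lc) => //;
  [move=> y; rewrite mule1 lee_fin|move=> y _; rewrite mule1 lee_fin ge_min lexx orbT].
Qed.

Lemma truncationE n z : (truncation n z)%:E = hit X P U (g_ n) (Some z).
Proof.
rewrite fineK // ge0_fin_numE; last by apply: hit_ge0 => y; exact: (g_ge0 n).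
by apply: le_lt_trans (hit_g_le _ _) _; exact: ltry.
Qed.

Lemma truncation_ge0 n z : 0 <= truncation n z.
Proof. by apply: fine_ge0; apply: hit_ge0 => y; exact: (g_ge0 n). Qed.

Lemma truncation_le n z : truncation n z <= n%:R.
Proof. by rewrite -lee_fin truncationE hit_g_le. Qed.

Lemma measurable_truncation n : measurable_fun setT (truncation n : borel E -> R).
Proof. exact: (measurableT_comp (@fine_measurable R setT measurableT) (measurable_hit hp U (g_ge0 n) (mg n))). Qed.

Lemma truncation_harmonic n W z : open W -> W `<=` U ->
  hit X P W (EFin \o truncation n) (Some z) = (truncation n z)%:E.
Proof.
move=> oW WU; rewrite truncationE -(hit_hit hp lc (Some z) oU oW WU (g_ge0 n) (mg n)).
by congr (hit X P W _ _); apply/funext => y; rewrite /= truncationE.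
Qed.

Lemma truncation_out n z : ~ U z -> h z = 0 -> truncation n z = 0.
Proof.
move=> Uz hz; apply: EFin_inj; rewrite truncationE (hit_out hp) //.
  by rewrite /= /g_ hz min_l.
by move=> [y Uy [yz]]; apply: Uz; rewrite -yz.
Qed.

(** Monotone convergence; along each path the truncated exit value is eventually exact. *)
Lemma truncation_cvg x : regular_harmonic X P h U -> U x ->
  truncation n x @[n --> \oo] --> h x.
Proof.
move=> rh Ux; apply: fine_cvg; rewrite -(regular_harmonic_hit rh Ux).
have := @cvg_monotone_convergence _ _ _ (P (Some x)) setT measurableT
  (fun n w => ext (g_ n) (at_time X (open_exit X U w) w)).
move/(_ _ _ _)/cvg_trans; apply.
- move=> n; apply: (measurable_paths hp); exact: (measurable_open_exit_value hp).
- by move=> n w _; apply: ext_ge0.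
- move=> w _ m n mn; case: (at_time X (open_exit X U w) w) => //= y.
  by rewrite lee_fin le_min2 // ler_nat.
have -> // : (fun w => limn (fun n => ext (g_ n) (at_time X (open_exit X U w) w))) =
  fun w => ext (EFin \o h) (at_time X (open_exit X U w) w).
apply/funext => w; apply/cvg_lim => //; case: (at_time X (open_exit X U w) w) => /= [y|].
  apply: cvg_near_cst; near=> n; rewrite /g_ min_l //.
  by near: n; exact: nbhs_infty_ger.
exact: cvg_cst.
Unshelve. all: by end_near. Qed.

End truncation.

(** * The product inequality *)

Lemma cross_comparison (R : realFieldType) (m k L L' v v' a a' b b' : R) :
  0 <= L -> 0 <= L' -> 0 <= v -> 0 <= v' -> 0 <= a -> 0 <= b' ->
  a <= m * L * v -> L * v' <= k * a' -> L' * v <= k * b -> b' <= m * L' * v' ->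
  a * b' <= (m * k) ^+ 2 * (a' * b).
Proof.
move=> L0 L'0 v0 v'0 a0 b'0 am a'k bk b'm.
apply: (@le_trans _ _ ((m * L * v) * (m * L' * v'))); first exact: ler_pM.
(* Exchanging [v] and [v'] between the two products turns the upper bounds for [a] and [b'] into the
   quantities bounded by [a'] and [b]. *)
have -> : (m * L * v) * (m * L' * v') = m ^+ 2 * ((L * v') * (L' * v)) by ring.
have -> : (m * k) ^+ 2 * (a' * b) = m ^+ 2 * ((k * a') * (k * b)) by ring.
by apply: ler_wpM2l; [exact: sqr_ge0|apply: ler_pM => //; exact: mulr_ge0].
Qed.

Theorem theorem1p6 (R : realType)
    (kappa C1 C2 C3 theta C4 C5 C6 c beta : R)
    (kappa_bounds : 0 < kappa < 2)
    (C1_gt0 : 0 < C1) (C2_bounds : 0 < C2 < 1) (C3_gt1 : 1 < C3)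
    (theta_gt0 : 0 < theta) (C4_gt0 : 0 < C4) (C4_le_C5 : C4 <= C5)
    (C6_gt0 : 0 < C6) (c_ge1 : 1 <= c) (beta_gt0 : 0 < beta) :
  exists C : R, 1 < C /\
  forall (E : pmetricType R) (d : measure_display) (Omega : measurableType d)
    (X : R -> Omega -> cemetery E) (P : cemetery E -> probability Omega R)
    (J : R.-ker (borel E) ~> (borel E)) (phi : R -> R) (rbar r0 : \bar R),
  locally_compact [set: E] ->
  hunt_process X P ->
  jump_kernel J ->
  levy_system X P J ->
  scale_function phi ->
  growth_bound phi c beta ->
  (0 < rbar)%E -> (0 < r0)%E ->
  Jc J rbar C1 C2 C3 theta ->
  Jt J phi rbar C4 C5 ->
  EP X P phi r0 C6 ->
  forall D : set E, open D -> D <> setT ->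
  forall r : R, 0 < r -> (r%:E < Order.min (rbar * (2^-1)%:E) r0)%E ->
  forall xi : E, boundary D xi ->
  forall h1 h2 : E -> R,
  (forall x, 0 <= h1 x) -> (forall x, 0 <= h2 x) ->
  regular_harmonic X P h1 (D `&` ball xi (2 * r)) ->
  regular_harmonic X P h2 (D `&` ball xi (2 * r)) ->
  (forall x, (ball xi (2 * r) `\` D) x -> h1 x = 0) ->
  (forall x, (ball xi (2 * r) `\` D) x -> h2 x = 0) ->
  forall x y : E,
  (D `&` ball xi (kappa * r)) x -> (D `&` ball xi (kappa * r)) y ->
  h1 x * h2 y <= C * h1 y * h2 x.

Proof.
have C5_gt0 : 0 < C5 by exact: lt_le_trans C4_le_C5.
pose e := (2 - kappa) / 5.
pose K := mass_const kappa C1 C2 C3 theta c beta C4 C5 C6 * comparison_const C1 theta e.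
(* [K] is the product of the two constants of [mass_representation], squared because there are two
   functions; the maximum with 2 secures [1 < C]. *)
exists (Num.max 2 (K ^+ 2)); split; first by rewrite lt_max ltr1n.
move=> E d Omega X P J phi rbar r0 lc hp _ hJ hphi hgrow _ r00 hJc hJt hEP D oD _ r r_gt0 rR
  xi _ h1 h2 h10 h20 rh1 rh2 h1D h2D x y Dx Dy.
have [r_lt r2_lt] : (r%:E < r0)%E /\ ((2 * r)%:E < rbar)%E.
  move: rR; rewrite lt_min => /andP[rb ->]; split => //; move: rb.
  case: rbar {hJc hJt} => [b| |] //; last first.
    by rewrite mulNyr gtr0_sg ?invr_gt0 // mul1e.
    by rewrite ltry.
  by rewrite -EFinM !lte_fin ltr_pdivlMr // mulrC.
have oU : open (D `&` ball xi (2 * r)) by apply: openI => //; exact: mball_open.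
have sub z : (D `&` ball xi (kappa * r)) z -> (D `&` ball xi (2 * r)) z.
  case=> Dz Bz; split => //; apply: le_ball Bz; rewrite ler_pM2r //.
  by case/andP: kappa_bounds => _ /ltW.
pose u (h : E -> R) n := truncation X P (D `&` ball xi (2 * r)) h n.
have cvg_u h z : (forall z, 0 <= h z) -> regular_harmonic X P h (D `&` ball xi (2 * r)) ->
    (D `&` ball xi (kappa * r)) z -> u h n z @[n --> \oo] --> h z.
  by move=> h0 rh Dz; apply: (truncation_cvg hp lc oU h0) => //; [case: rh|exact: sub].
pose L h n := fine (outside_mass J kappa r xi (u h n)).
pose v z := fine (mean_exit X P (D `&` ball xi ((kappa + 1%:R * e) * r)) (Some z)).
pose m := mass_const kappa C1 C2 C3 theta c beta C4 C5 C6.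
pose k := comparison_const C1 theta e.
have repr h n z : (forall z, 0 <= h z) -> regular_harmonic X P h (D `&` ball xi (2 * r)) ->
    (forall x, (ball xi (2 * r) `\` D) x -> h x = 0) -> (D `&` ball xi (kappa * r)) z ->
    [/\ 0 <= L h n, 0 <= v z, L h n * v z <= k * u h n z & u h n z <= m * L h n * v z].
  move=> h0 [mh _] hD Dz.
  apply: (mass_representation hp lc hJ hphi hgrow kappa_bounds C1_gt0 C2_bounds C3_gt1
    theta_gt0 C4_gt0 C5_gt0 C6_gt0 c_ge1 r00 hJc hJt hEP oD r_gt0 r_lt r2_lt (M := n%:R)) => //.
  - by move=> a; exact: truncation_ge0.
  - by move=> a; exact: truncation_le.
  - exact: measurable_truncation.
  - by move=> W a; exact: truncation_harmonic.
  - by move=> a [Ba nDa]; apply: truncation_out => //; [case|exact: hD].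
have bound n : u h1 n x * u h2 n y <= K ^+ 2 * (u h1 n y * u h2 n x).
  have [L1 vx l1x u1x] := repr h1 n x h10 rh1 h1D Dx.
  have [_ vy l1y _] := repr h1 n y h10 rh1 h1D Dy.
  have [L2 _ l2x _] := repr h2 n x h20 rh2 h2D Dx.
  have [_ _ _ u2y] := repr h2 n y h20 rh2 h2D Dy.
  have u1 := truncation_ge0 X P (D `&` ball xi (2 * r)) h10 n x.
  have u2 := truncation_ge0 X P (D `&` ball xi (2 * r)) h20 n y.
  exact: (cross_comparison L1 L2 vx vy u1 u2 u1x l1y l2x u2y).
have c1 : u h1 n x * u h2 n y @[n --> \oo] --> h1 x * h2 y.
  by apply: cvgM; [apply: (cvg_u h1)|apply: (cvg_u h2)].
have c2 : K ^+ 2 * (u h1 n y * u h2 n x) @[n --> \oo] --> K ^+ 2 * (h1 y * h2 x).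
  by apply: cvgM; [exact: cvg_cst|apply: cvgM; [apply: (cvg_u h1)|apply: (cvg_u h2)]].
have low : h1 x * h2 y <= K ^+ 2 * (h1 y * h2 x).
  (* [K] does not depend on [n], so the inequality survives the limit. *)
  by apply: (ler_cvg_to c1 c2); apply: nearW => n; exact: bound.
apply: le_trans low _; rewrite -mulrA; apply: ler_wpM2r; first by rewrite mulr_ge0.
by rewrite le_max lexx orbT.
Qed.
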